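(* Let $K$ be a field and let $E$ and $F$ be finite graphs with no sinks. Then $K^{\mathrm{gr}}_0(\mathcal L(E))\cong K^{\mathrm{gr}}_0(\mathcal L(F))$ as ordered abelian groups if and only if the categories $\mathrm{QGr}\text{-}\mathcal P(E)$ and $\mathrm{QGr}\text{-}\mathcal P(F)$ are equivalent.
   Context: Graphs are directed graphs $E=(E^0,E^1,r,s)$ with vertex set $E^0$, edge set $E^1$, and range and source maps $r,s:E^1\to E^0$. Finite means $E^0$ and $E^1$ are finite. A sink is a vertex emitting no edge. $\mathcal P(E)$ is the path algebra of $E$ over $K$: the $K$-vector space with basis the paths in $E$ (vertices being the paths of length $0$), where the product of paths $p,q$ is the concatenation $pq$ if $r(p)=s(q)$ and $0$ otherwise. It is $\mathbb Z$-graded by path length. $\mathrm{Gr}\text{-}\mathcal P(E)$ is the category of $\mathbb Z$-graded right $\mathcal P(E)$-modules with degree-preserving homomorphisms, $\mathrm{Fdim}\text{-}\mathcal P(E)$ is its full (Serre, localising) subcategory of modules that are the sum of their finite-dimensional submodules, and $\mathrm{QGr}\text{-}\mathcal P(E):=\mathrm{Gr}\text{-}\mathcal P(E)/\mathrm{Fdim}\text{-}\mathcal P(E)$ is the quotient category. The Leavitt path algebra $\mathcal L(E)$ over $K$ is the $K$-algebra generated by the sets $\{v: v\in E^0\}$, $\{\alpha:\alpha\in E^1\}$, $\{\alpha^*:\alpha\in E^1\}$ subject to: (1) $vw=\delta_{v,w}v$ for $v,w\in E^0$; (2) $s(\alpha)\alpha=\alpha r(\alpha)=\alpha$ and $r(\alpha)\alpha^*=\alpha^*s(\alpha)=\alpha^*$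 for $\alpha\in E^1$; (3) $\alpha^*\beta=\delta_{\alpha,\beta}r(\alpha)$ for $\alpha,\beta\in E^1$; (4) $\sum_{\alpha\in s^{-1}(v)}\alpha\alpha^*=v$ for every $v\in E^0$ with $s^{-1}(v)\neq\emptyset$. It is $\mathbb Z$-graded by $\deg v=0$, $\deg\alpha=1$, $\deg\alpha^*=-1$; for finite $E$ it is unital with identity $\sum_{v\in E^0}v$. For a unital $\mathbb Z$-graded ring $R$, $K_0^{\mathrm{gr}}(R)$ is the group completion of the monoid $\mathcal V^{\mathrm{gr}}(R)$ (under direct sum) of graded isomorphism classes of graded finitely generated projective right $R$-modules, with positive cone $K_0^{\mathrm{gr}}(R)_+$ the image of $\mathcal V^{\mathrm{gr}}(R)$. An isomorphism of ordered abelian groups is a group isomorphism mapping the positive cone onto the positive cone. *)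

(* Defs.v *)
From HB Require Import structures.
From mathcomp Require Import all_boot all_order all_algebra.
From mathcomp Require Import finmap.
From mathcomp Require Import monalg.
From mathcomp.classical Require Import boolp.

Set Implicit Arguments.
Unset Strict Implicit.
Unset Printing Implicit Defensive.

Import GRing.Theory.

Local Open Scope ring_scope.

(* Quotient of a type by a Prop-valued equivalence relation, as the type of
   classes. Unlike [{eq_quot _}] it applies to types that are too large to be
   a choiceType, such as the type of all modules over a ring. *)

Section Quot.
Variables (T : Type) (e : T -> T -> Prop).

Record is_equivalence : Prop := IsEquivalence {
  eqv_refl : forall x, e x x;
  eqv_sym : forall x y, e x y -> e y x;
  eqv_trans : forall x y z, e x y -> e y z -> e x z }.

Definition quot : Type := {c : T -> Prop | exists x, c = e x}.

Definition qpi (x : T) : quot := exist _ (e x) (ex_intro _ x erefl).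

Lemma qpi_surj (c : quot) : exists x, qpi x = c.
Proof.
by case: c => c [x cx]; exists x; apply: eq_exist; rewrite /= cx.
Qed.

Definition qrepr (c : quot) : T := projT1 (cid (qpi_surj c)).

Lemma qreprK (c : quot) : qpi (qrepr c) = c.
Proof. exact: (projT2 (cid (qpi_surj c))). Qed.

Hypothesis eqvP : is_equivalence.

Lemma qpi_eq x y : qpi x = qpi y <-> e x y.
Proof.
split=> [/(congr1 (@proj1_sig _ _)) /= exy|exy].
  by rewrite exy; apply: eqv_refl.
apply: eq_exist => /=; apply: funext => z; apply: propext.
by split=> h; apply: eqv_trans h => //; apply: eqv_sym.
Qed.

Lemma qreprP x : e (qrepr (qpi x)) x.
Proof. by apply/qpi_eq; rewrite qreprK. Qed.

End Quot.

Record category := Category {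
  ob :> Type;
  hom : ob -> ob -> Type;
  idc : forall a, hom a a;
  ccomp : forall a b c, hom b c -> hom a b -> hom a c;
  ccomp1l : forall a b (f : hom a b), ccomp (idc b) f = f;
  ccomp1r : forall a b (f : hom a b), ccomp f (idc a) = f;
  ccompA : forall a b c d (h : hom c d) (g : hom b c) (f : hom a b),
    ccomp h (ccomp g f) = ccomp (ccomp h g) f }.

Arguments hom {C} _ _ : rename.
Arguments idc {C} a : rename.
Arguments ccomp {C a b c} _ _ : rename.

Definition is_iso (C : category) (a b : C) (f : hom a b) : Prop :=
  exists g : hom b a, ccomp g f = idc a /\ ccomp f g = idc b.

Definition isomorphic (C : category) (a b : C) : Prop :=
  exists f : hom a b, is_iso f.

Lemma isomorphic_equiv (C : category) : is_equivalence (@isomorphic C).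
Proof.
split=> [a|a b [f [g [gf fg]]]|a b c [f [f' [f'f ff']]] [g [g' [g'g gg']]]].
- by exists (idc a), (idc a); rewrite ccomp1l.
- by exists g, f.
- exists (ccomp g f), (ccomp f' g'); split.
    by rewrite -ccompA (ccompA g') g'g ccomp1l.
  by rewrite -ccompA (ccompA f) ff' ccomp1l.
Qed.

Record functor (C D : category) := Functor {
  fob :> C -> D;
  fhom : forall a b, hom a b -> hom (fob a) (fob b);
  fhom_id : forall a, fhom (idc a) = idc (fob a);
  fhom_comp : forall a b c (g : hom b c) (f : hom a b),
    fhom (ccomp g f) = ccomp (fhom g) (fhom f) }.

Arguments fhom {C D} F {a b} _ : rename.

Definition functor_id (C : category) : functor C C :=
  @Functor C C id (fun _ _ f => f) (fun=> erefl) (fun _ _ _ _ _ => erefl).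

Lemma functor_comp_id (C D E : category) (G : functor D E) (F : functor C D) a :
  fhom G (fhom F (idc a)) = idc (G (F a)).
Proof. by rewrite !fhom_id. Qed.

Lemma functor_comp_comp (C D E : category) (G : functor D E) (F : functor C D)
    a b c (g : hom b c) (f : hom a b) :
  fhom G (fhom F (ccomp g f)) = ccomp (fhom G (fhom F g)) (fhom G (fhom F f)).
Proof. by rewrite !fhom_comp. Qed.

Definition functor_comp (C D E : category) (G : functor D E) (F : functor C D) :
    functor C E :=
  @Functor C E (fun a => G (F a)) (fun _ _ f => fhom G (fhom F f))
    (functor_comp_id G F) (@functor_comp_comp _ _ _ G F).

Definition naturally_isomorphic (C D : category) (F G : functor C D) : Prop :=
  exists t : forall a, hom (F a) (G a),
    (forall a b (f : hom a b), ccomp (t b) (fhom F f) = ccomp (fhom G f) (t a))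
    /\ (forall a, is_iso (t a)).

Definition equivalent_categories (C D : category) : Prop :=
  exists (F : functor C D) (G : functor D C),
    naturally_isomorphic (functor_comp G F) (functor_id C)
    /\ naturally_isomorphic (functor_comp F G) (functor_id D).

(* The localisation C[W^-1] of a category C at a class of morphisms W: a morphism is a
   finite string of composable arrows, each of them either a morphism of C or
   the formal inverse of a morphism in W, up to the congruence generated by
   composition in C and by w w^-1 = 1 = w^-1 w. In [zz_fwd f p] and
   [zz_bwd Ww p] the first arrow to be travelled is f, resp. w^-1. *)

Section Localisation.
Variables (C : category) (W : forall a b : C, hom a b -> Prop).

Inductive zigzag : C -> C -> Type :=
| zz_nil a : zigzag a a
| zz_fwd a b c (f : hom a b) (p : zigzag b c) : zigzag a c
| zz_bwd a b c (w : hom b a) (Ww : W w) (p : zigzag b c) : zigzag a c.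

Inductive zz_eq : forall a b : C, zigzag a b -> zigzag a b -> Prop :=
| zz_refl a b (p : zigzag a b) : zz_eq p p
| zz_sym a b (p q : zigzag a b) : zz_eq p q -> zz_eq q p
| zz_trans a b (p q r : zigzag a b) : zz_eq p q -> zz_eq q r -> zz_eq p r
| zz_fwd_congr a b c (f : hom a b) (p q : zigzag b c) :
    zz_eq p q -> zz_eq (zz_fwd f p) (zz_fwd f q)
| zz_bwd_congr a b c (w : hom b a) (Ww : W w) (p q : zigzag b c) :
    zz_eq p q -> zz_eq (zz_bwd Ww p) (zz_bwd Ww q)
| zz_fwd_id a b (p : zigzag a b) : zz_eq (zz_fwd (idc a) p) p
| zz_fwd_comp a b c d (f : hom a b) (g : hom b c) (p : zigzag c d) :
    zz_eq (zz_fwd f (zz_fwd g p)) (zz_fwd (ccomp g f) p)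
| zz_fwd_bwd a b c (w : hom a b) (Ww : W w) (p : zigzag a c) :
    zz_eq (zz_fwd w (zz_bwd Ww p)) p
| zz_bwd_fwd a b c (w : hom b a) (Ww : W w) (p : zigzag a c) :
    zz_eq (zz_bwd Ww (zz_fwd w p)) p.

Fixpoint zz_cat a b c (p : zigzag a b) : zigzag b c -> zigzag a c :=
  match p in zigzag a b return zigzag b c -> zigzag a c with
  | zz_nil _ => fun q => q
  | zz_fwd _ _ _ f p => fun q => zz_fwd f (zz_cat p q)
  | zz_bwd _ _ _ _ Ww p => fun q => zz_bwd Ww (zz_cat p q)
  end.

Lemma zz_eqP a b : is_equivalence (@zz_eq a b).
Proof.
by split=> [p|p q|p q r]; [apply: zz_refl|apply: zz_sym|apply: zz_trans].
Qed.

Lemma zz_cats0 a b (p : zigzag a b) : zz_cat p (zz_nil b) = p.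
Proof. by elim: p => //= *; congr zz_fwd + congr zz_bwd. Qed.

Lemma zz_catA a b c d (p : zigzag a b) (q : zigzag b c) (r : zigzag c d) :
  zz_cat p (zz_cat q r) = zz_cat (zz_cat p q) r.
Proof. by elim: p q => //= *; congr zz_fwd + congr zz_bwd. Qed.

Lemma zz_catl a b c (p : zigzag a b) (q q' : zigzag b c) :
  zz_eq q q' -> zz_eq (zz_cat p q) (zz_cat p q').
Proof.
elim: p q q' => //= [a' b' c' f p IH|a' b' c' w Ww p IH] q q' qq'.
  by apply: zz_fwd_congr; apply: IH.
by apply: zz_bwd_congr; apply: IH.
Qed.

Lemma zz_catr a b c (p p' : zigzag a b) (q : zigzag b c) :
  zz_eq p p' -> zz_eq (zz_cat p q) (zz_cat p' q).
Proof.
move=> pp'; elim: pp' q => /=.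
- by move=> *; apply: zz_refl.
- by move=> a' b' p1 p2 _ IH q; apply/zz_sym/IH.
- by move=> a' b' p1 p2 p3 _ IH1 _ IH2 q; apply: zz_trans (IH2 q); apply: IH1.
- by move=> a' b' c' f p1 p2 _ IH q; apply/zz_fwd_congr/IH.
- by move=> a' b' c' w Ww p1 p2 _ IH q; apply/zz_bwd_congr/IH.
- by move=> *; apply: zz_fwd_id.
- by move=> *; apply: zz_fwd_comp.
- by move=> *; apply: zz_fwd_bwd.
- by move=> *; apply: zz_bwd_fwd.
Qed.

Definition lhom (a b : C) : Type := quot (@zz_eq a b).

Definition lid (a : C) : lhom a a := qpi (@zz_eq a a) (zz_nil a).

Definition lcomp a b c (g : lhom b c) (f : lhom a b) : lhom a c :=
  qpi (@zz_eq a c) (zz_cat (qrepr f) (qrepr g)).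

Lemma lcomp_pi a b c (q : zigzag b c) (p : zigzag a b) :
  lcomp (qpi (@zz_eq b c) q) (qpi (@zz_eq a b) p)
    = qpi (@zz_eq a c) (zz_cat p q).
Proof.
apply/(qpi_eq (zz_eqP a c)); apply: zz_trans (zz_catr _ (qreprP (zz_eqP a b) p)).
exact/zz_catl/(qreprP (zz_eqP b c)).
Qed.

Lemma lcomp1l a b (f : lhom a b) : lcomp (lid b) f = f.
Proof. by rewrite -(qreprK f) lcomp_pi zz_cats0. Qed.

Lemma lcomp1r a b (f : lhom a b) : lcomp f (lid a) = f.
Proof. by rewrite -(qreprK f) lcomp_pi. Qed.

Lemma lcompA a b c d (h : lhom c d) (g : lhom b c) (f : lhom a b) :
  lcomp h (lcomp g f) = lcomp (lcomp h g) f.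
Proof.
by rewrite -(qreprK h) -(qreprK g) -(qreprK f) !lcomp_pi zz_catA.
Qed.

Definition localisation : category := Category lcomp1l lcomp1r lcompA.

End Localisation.

Record cmonoid := CMonoid {
  cm_sort :> Type;
  cm0 : cm_sort;
  cmD : cm_sort -> cm_sort -> cm_sort;
  cmDA : associative cmD;
  cmDC : commutative cmD;
  cm0D : left_id cm0 cmD }.

(* An abelian group with a set of positive elements. *)
Record preordered_group := PreorderedGroup {
  pg_sort :> Type;
  pg0 : pg_sort;
  pgN : pg_sort -> pg_sort;
  pgD : pg_sort -> pg_sort -> pg_sort;
  pgDA : associative pgD;
  pgDC : commutative pgD;
  pg0D : left_id pg0 pgD;
  pgND : left_inverse pg0 pgN pgD;
  pg_pos : pg_sort -> Prop }.

Arguments pgD {G} _ _ : rename.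
Arguments pg_pos {G} _ : rename.

Definition ordered_isomorphic (G H : preordered_group) : Prop :=
  exists f : G -> H,
    [/\ bijective f, {morph f : x y / pgD x y}
      & forall y, pg_pos y <-> exists2 x, pg_pos x & f x = y].

Section GroupCompletion.
Variable M : cmonoid.
Local Notation "x + y" := (cmD x y).

Definition gc_eq (x y : M * M) : Prop :=
  exists e : M, (x.1 + y.2) + e = (y.1 + x.2) + e.

Lemma cmDAC (a b c : M) : (a + b) + c = (a + c) + b.
Proof. by rewrite -!cmDA (cmDC b). Qed.

Lemma cmDACA (a b c d : M) : (a + b) + (c + d) = (a + c) + (b + d).
Proof. by rewrite !cmDA (cmDAC a b). Qed.

Lemma gc_shuffle (a b c d e f : M) :
  (a + b) + ((c + d) + (e + f)) = ((a + d) + e) + ((c + b) + f).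
Proof. by rewrite cmDA [RHS]cmDACA (cmDC c b) (cmDACA a d) (cmDC d c). Qed.

Lemma gc_eqP : is_equivalence gc_eq.
Proof.
split=> [x|x y [e exy]|[x1 x2] [y1 y2] [z1 z2] [e exy] [e' eyz]].
- by exists (cm0 M).
- by exists e.
- move: exy eyz => /= exy eyz; exists ((y1 + y2) + (e + e')) => /=.
  by rewrite gc_shuffle exy eyz (cmDC e) gc_shuffle cmDC.
Qed.

Local Notation gc := (qpi gc_eq).
Local Notation gcP := (qpi_eq gc_eqP).

Definition gc_sort : Type := quot gc_eq.
Definition gc0 : gc_sort := gc (cm0 M, cm0 M).
Definition gcN (x : gc_sort) : gc_sort := gc ((qrepr x).2, (qrepr x).1).
Definition gcD (x y : gc_sort) : gc_sort :=
  gc ((qrepr x).1 + (qrepr y).1, (qrepr x).2 + (qrepr y).2).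
Definition gc_pos (x : gc_sort) : Prop := exists a : M, x = gc (a, cm0 M).

Lemma gcN_pi a b : gcN (gc (a, b)) = gc (b, a).
Proof.
have [e /= eab] := qreprP gc_eqP (a, b).
by apply/gcP; exists e => /=; rewrite (cmDC _ a) (cmDC b).
Qed.

Lemma gcD_pi a b c d : gcD (gc (a, b)) (gc (c, d)) = gc (a + c, b + d).
Proof.
have [e /= eab] := qreprP gc_eqP (a, b).
have [f /= fcd] := qreprP gc_eqP (c, d).
apply/gcP; exists (e + f) => /=.
by rewrite (cmDACA _ _ b d) (cmDACA a c) !(cmDACA _ _ e f) eab fcd.
Qed.

Lemma gcDA : associative gcD.
Proof.
move=> x y z; rewrite -(qreprK x) -(qreprK y) -(qreprK z).
case: (qrepr x) (qrepr y) (qrepr z) => [? ?] [? ?] [? ?].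
by rewrite !gcD_pi !cmDA.
Qed.

Lemma gcDC : commutative gcD.
Proof. by move=> x y; rewrite /gcD (cmDC (qrepr x).1) (cmDC (qrepr x).2). Qed.

Lemma gc0D : left_id gc0 gcD.
Proof.
move=> x; rewrite -(qreprK x); case: (qrepr x) => [? ?].
by rewrite gcD_pi !cm0D.
Qed.

Lemma gcND : left_inverse gc0 gcN gcD.
Proof.
move=> x; rewrite -(qreprK x); case: (qrepr x) => [a b].
rewrite gcN_pi gcD_pi; apply/gcP; exists (cm0 M) => /=.
by rewrite !cm0D (cmDC a) (cmDC _ (cm0 M)) !cm0D.
Qed.

Definition group_completion : preordered_group :=
  PreorderedGroup gcDA gcDC gc0D gcND gc_pos.

End GroupCompletion.

(* Graded rings and graded right modules. A right module over R is a left
   module over the converse ring R^c: for a : R, [a *: x] stands for x a. *)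

Record grading (V : zmodType) (C : int -> V -> Prop) : Prop := Grading {
  grading0 : forall n, C n 0;
  gradingB : forall n x y, C n x -> C n y -> C n (x - y);
  grading_sum : forall x, exists (s : seq int) (c : int -> V),
    (forall n, C n (c n)) /\ x = \sum_(n <- s) c n;
  grading_direct : forall (s : seq int) (c : int -> V), uniq s ->
    (forall n, C n (c n)) -> \sum_(n <- s) c n = 0 ->
    forall n, n \in s -> c n = 0 }.

Section GradingTheory.
Variables (V : zmodType) (C : int -> V -> Prop).
Hypothesis CP : grading C.

Lemma gradingD n x y : C n x -> C n y -> C n (x + y).
Proof.
move=> Cx Cy; rewrite -[y]opprK -[- y]sub0r.
by do 2?apply: gradingB => //; apply: grading0.
Qed.

Lemma grading_bigsum n (I : Type) (r : seq I) (P : pred I) (F : I -> V) :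
  (forall i, P i -> C n (F i)) -> C n (\sum_(i <- r | P i) F i).
Proof.
by move=> h; elim/big_rec: _ => [|i x Pi]; [apply: grading0|apply/gradingD/h].
Qed.

Lemma big_int_subset (s t : seq int) (c : int -> V) : uniq s -> uniq t ->
  {subset s <= t} -> (forall n, n \notin s -> c n = 0) ->
  \sum_(n <- t) c n = \sum_(n <- s) c n.
Proof.
move=> us ut st c0; rewrite (bigID (mem s)) /= [X in _ + X]big1 ?addr0 //.
rewrite -big_filter; apply/perm_big/uniq_perm; rewrite ?filter_uniq // => n.
by rewrite mem_filter /=; case: (boolP (n \in s)) => //= /st.
Qed.

Lemma grading_sum_uniq x : exists (s : seq int) (c : int -> V),
  [/\ uniq s, forall n, C n (c n), forall n, n \notin s -> c n = 0
    & x = \sum_(n <- s) c n].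
Proof.
have [s [c [Cc ->]]] := grading_sum CP x.
exists (undup s), (fun n => \sum_(m <- s | m == n) c m); split.
- exact: undup_uniq.
- by move=> n; apply: grading_bigsum => m /eqP <-.
- move=> n; rewrite mem_undup => ns; rewrite big_seq_cond big1 // => m.
  by case/andP=> ms /eqP mn; rewrite -mn ms in ns.
- rewrite (exchange_big_dep xpredT) //=; apply: eq_big_seq => m ms.
  by rewrite (big_rem m) ?mem_undup //= eqxx big1_seq ?addr0 // => n /andP[/eqP <-];
     rewrite mem_rem_uniq ?undup_uniq // inE eqxx.
Qed.

End GradingTheory.

Record gradedRing := GradedRing {
  gr_ring :> pzRingType;
  gr_comp : int -> gr_ring -> Prop;
  gr_grading : grading gr_comp;
  gr_comp1 : gr_comp 0 1;
  gr_compM : forall m n a b,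
    gr_comp m a -> gr_comp n b -> gr_comp (m + n) (a * b) }.

Record grmod (R : gradedRing) := GrMod {
  gm_mod :> lmodType R^c;
  gm_comp : int -> gm_mod -> Prop;
  gm_grading : grading gm_comp;
  gm_compZ : forall m n (x : gm_mod) (a : R),
    gm_comp m x -> gr_comp n a -> gm_comp (m + n) ((a : R^c) *: x) }.

Arguments gm_comp {R M} _ _ : rename.

Section GradedModules.
Variable R : gradedRing.

Record grhom (M N : grmod R) := GrHom {
  grhom_lin :> {linear M -> N};
  grhom_deg : forall n x, gm_comp n x -> gm_comp n (grhom_lin x) }.

Lemma grhom_eq (M N : grmod R) (f g : grhom M N) : f =1 g -> f = g.
Proof.
case: f g => [[f [[fa] [fs]]] fd] [[g [[ga] [gs]]] gd] /= /funext efg.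
rewrite /= in efg; subst g.
rewrite (Prop_irrelevance ga fa) (Prop_irrelevance gs fs) in gd *.
by rewrite (Prop_irrelevance gd fd).
Qed.

Definition grhom_id (M : grmod R) : grhom M M :=
  @GrHom M M idfun (fun _ _ h => h).

Definition grhom_comp (M N P : grmod R) (g : grhom N P) (f : grhom M N) :
    grhom M P :=
  @GrHom M P (g \o f) (fun n x h => grhom_deg g (grhom_deg f h)).

Lemma grhom_comp1l M N (f : grhom M N) : grhom_comp (grhom_id N) f = f.
Proof. exact: grhom_eq. Qed.

Lemma grhom_comp1r M N (f : grhom M N) : grhom_comp f (grhom_id M) = f.
Proof. exact: grhom_eq. Qed.

Lemma grhom_compA M N P Q (h : grhom P Q) (g : grhom N P) (f : grhom M N) :
  grhom_comp h (grhom_comp g f) = grhom_comp (grhom_comp h g) f.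
Proof. exact: grhom_eq. Qed.

Definition Gr : category := Category grhom_comp1l grhom_comp1r grhom_compA.

Definition finitely_generated (M : grmod R) : Prop :=
  exists (n : nat) (g : 'I_n -> M), forall x, exists a : 'I_n -> R,
    x = \sum_(i < n) (a i : R^c) *: g i.

(* P is a projective object of Gr: epimorphisms of Gr are surjective. *)
Definition graded_projective (P : grmod R) : Prop :=
  forall (M N : grmod R) (q : grhom M N) (f : grhom P N),
    (forall y, exists x, q x = y) -> exists g : grhom P M, forall x, q (g x) = f x.

Record fgproj := FGProj {
  fgp_mod :> grmod R;
  fgp_fg : finitely_generated fgp_mod;
  fgp_proj : graded_projective fgp_mod }.

Section Zero.
Definition zero_comp (n : int) (x : 'rV[R^c]_0) : Prop := True.

Lemma zero_grading : grading zero_comp.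
Proof.
split=> // [x|s c _ _ _ n _].
  by exists [::], (fun=> 0); split=> //; rewrite big_nil thinmx0.
exact: thinmx0.
Qed.

Definition zero_grmod : grmod R := @GrMod R 'rV[R^c]_0 zero_comp zero_grading (fun _ _ _ _ _ _ => I).

Lemma zero_fg : finitely_generated zero_grmod.
Proof.
exists 0%N, (fun=> 0) => x; exists (fun=> 0).
by rewrite big_ord0; apply: thinmx0.
Qed.
End Zero.

Section DirectSum.
Variables M N : grmod R.
Definition dsum_comp (n : int) (x : M * N) : Prop :=
  gm_comp n x.1 /\ gm_comp n x.2.


Lemma dsum_grading : grading dsum_comp.
Proof.
split=> [n|n x y [x1 x2] [y1 y2]|x|s c us Cc c0 n ns].
- by split; apply: grading0; apply: gm_grading.
- by split; apply: gradingB; rewrite //; apply: gm_grading.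
- have [s [c [us Cc c0 xc]]] := grading_sum_uniq (gm_grading M) x.1.
  have [t [d [ut Cd d0 xd]]] := grading_sum_uniq (gm_grading N) x.2.
  exists (undup (s ++ t)), (fun n => (c n, d n)); split=> [n|]; first by split.
  have st n : n \in s -> n \in undup (s ++ t).
    by rewrite mem_undup mem_cat => ->.
  have ts n : n \in t -> n \in undup (s ++ t).
    by rewrite mem_undup mem_cat orbC => ->.
  have ust := undup_uniq (s ++ t).
  rewrite [LHS]surjective_pairing xc xd -(big_int_subset us ust st c0).
  rewrite -(big_int_subset ut ust ts d0).
  by elim/big_rec3: _ => // i x1 x2 y _ <-.
- have e1 : \sum_(i <- s) (c i).1 = 0 by rewrite -(raddf_sum fst) c0.
  have e2 : \sum_(i <- s) (c i).2 = 0 by rewrite -(raddf_sum snd) c0.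
  rewrite [LHS]surjective_pairing.
  rewrite (grading_direct (gm_grading M) us (fun i => (Cc i).1) e1 ns).
  by rewrite (grading_direct (gm_grading N) us (fun i => (Cc i).2) e2 ns).
Qed.

Lemma dsum_compZ m n (x : M * N) (a : R) :
  dsum_comp m x -> gr_comp n a -> dsum_comp (m + n) ((a : R^c) *: x).
Proof. by move=> [x1 x2] an; split; apply: gm_compZ. Qed.

Definition dsum : grmod R := GrMod dsum_grading dsum_compZ.

End DirectSum.

Section DirectSumTheory.

Definition grfst M N : grhom (dsum M N) M :=
  @GrHom (dsum M N) M fst (fun n x h => proj1 h).

Definition grsnd M N : grhom (dsum M N) N :=
  @GrHom (dsum M N) N snd (fun n x h => proj2 h).

Section Pairing.
Variables (X M N : grmod R) (f : grhom X M) (g : grhom X N).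

Definition pair_fun (x : X) : M * N := (f x, g x).

Lemma pair_fun_linear : linear pair_fun.
Proof. by move=> a x y; rewrite /pair_fun !linearP. Qed.

HB.instance Definition _ :=
  GRing.isLinear.Build R^c X (M * N)%type _ pair_fun pair_fun_linear.

Definition grpair : grhom X (dsum M N) :=
  @GrHom X (dsum M N) pair_fun
    (fun n x h => conj (grhom_deg f h) (grhom_deg g h)).

End Pairing.

Lemma copair_deg M N X (f : grhom M X) (g : grhom N X) n (x : dsum M N) :
  gm_comp n x -> gm_comp n (((f \o fst) \+ (g \o snd)) x).
Proof.
by case=> x1 x2; apply: (gradingD (gm_grading X)); apply: grhom_deg.
Qed.

Definition grcopair M N X (f : grhom M X) (g : grhom N X) :
    grhom (dsum M N) X :=
  @GrHom (dsum M N) X ((f \o fst) \+ (g \o snd)) (@copair_deg M N X f g).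

Lemma null_deg (M N : grmod R) n (x : M) :
  gm_comp n x -> gm_comp n ((\0 : {linear M -> N}) x).
Proof. by move=> _; exact: (grading0 (gm_grading N)). Qed.

Definition grnull M N : grhom M N := @GrHom M N \0 (@null_deg M N).

Lemma gr_cancel (M N : Gr) (f : grhom M N) (g : grhom N M) :
  grhom_comp g f = grhom_id M -> cancel f g.
Proof. by move=> gf x; rewrite -[RHS]/(grhom_id M x) -gf. Qed.

Lemma dsum_iso (M M' N N' : Gr) :
  isomorphic M M' -> isomorphic N N' ->
  isomorphic (dsum M N : Gr) (dsum M' N').
Proof.
move=> [f [f' [f'f ff']]] [g [g' [g'g gg']]].
have fe := gr_cancel f'f; have fe' := gr_cancel ff'.
have ge := gr_cancel g'g; have ge' := gr_cancel gg'.
exists (grpair (grhom_comp f (grfst M N)) (grhom_comp g (grsnd M N))).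
exists (grpair (grhom_comp f' (grfst M' N')) (grhom_comp g' (grsnd M' N'))).
by split; apply: grhom_eq => -[x y] /=; rewrite /pair_fun /= ?fe ?fe' ?ge ?ge'.
Qed.

Lemma dsum_isoC (M N : Gr) : isomorphic (dsum M N : Gr) (dsum N M).
Proof.
exists (grpair (grsnd M N) (grfst M N)), (grpair (grsnd N M) (grfst N M)).
by split; apply: grhom_eq => -[x y].
Qed.

Lemma dsum_isoA (M N P : Gr) :
  isomorphic (dsum M (dsum N P) : Gr) (dsum (dsum M N) P).
Proof.
exists (grpair (grpair (grfst _ _) (grhom_comp (grfst _ _) (grsnd _ _)))
               (grhom_comp (grsnd _ _) (grsnd _ _))).
exists (grpair (grhom_comp (grfst _ _) (grfst _ _))
               (grpair (grhom_comp (grsnd _ _) (grfst _ _)) (grsnd _ _))).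
by split; apply: grhom_eq; [move=> [x [y z]]|move=> [[x y] z]].
Qed.

Lemma dsum_iso0 (M : Gr) : isomorphic (dsum zero_grmod M : Gr) M.
Proof.
exists (grsnd _ _), (grpair (grnull _ _) (grhom_id M)).
split; apply: grhom_eq => //= -[x y] /=; rewrite /pair_fun /=.
by congr pair; rewrite [RHS]thinmx0.
Qed.

Lemma dsum_fg (M N : grmod R) :
  finitely_generated M -> finitely_generated N -> finitely_generated (dsum M N).
Proof.
move=> [m [g gP]] [n [h hP]].
exists (m + n)%N, (fun i => match split i with
                            | inl i => (g i, 0) | inr j => (0, h j) end).
move=> [x y]; have [a ->] := gP x; have [b ->] := hP y.
exists (fun i => match split i with inl i => a i | inr j => b j end).
rewrite big_split_ord /=.
under [X in _ = X + _]eq_bigr => i _ do rewrite (unsplitK (inl _ i)).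
under [X in _ = _ + X]eq_bigr => i _ do rewrite (unsplitK (inr _ i)).
apply: injective_projections => /=; rewrite !raddf_sum /=.
  by rewrite [X in _ = _ + X]big1 ?addr0 // => i _; rewrite scaler0.
by rewrite [X in _ = X + _]big1 ?add0r // => i _; rewrite scaler0.
Qed.

Lemma dsum_proj (M N : grmod R) :
  graded_projective M -> graded_projective N -> graded_projective (dsum M N).
Proof.
move=> Mp Np A B q f qs.
have [g gP] := Mp A B q (grhom_comp f (grpair (grhom_id M) (grnull M N))) qs.
have [h hP] := Np A B q (grhom_comp f (grpair (grnull N M) (grhom_id N))) qs.
exists (grcopair g h) => -[x y] /=; rewrite linearD gP hP /= -linearD.
by congr (f _); apply: injective_projections; rewrite /= ?addr0 ?add0r.
Qed.

Lemma zero_proj : graded_projective zero_grmod.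
Proof.
move=> A B q f _; exists (grnull _ _) => x /=.
by rewrite linear0 (_ : x = 0) ?linear0 //; apply: thinmx0.
Qed.

End DirectSumTheory.

Definition fgp_zero : fgproj := FGProj zero_fg zero_proj.

Definition fgp_dsum (P Q : fgproj) : fgproj :=
  FGProj (dsum_fg (fgp_fg P) (fgp_fg Q)) (dsum_proj (@fgp_proj P) (@fgp_proj Q)).

Definition fgp_iso (P Q : fgproj) : Prop := isomorphic (P : Gr) (Q : Gr).

Lemma fgp_isoP : is_equivalence fgp_iso.
Proof.
have [h1 h2 h3] := isomorphic_equiv Gr.
by split=> [P|P Q|P Q S]; [apply: h1|apply: h2|apply: h3].
Qed.

Local Notation cls := (qpi fgp_iso).
Local Notation clsP := (qpi_eq fgp_isoP).

Definition V_sort : Type := quot fgp_iso.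
Definition V_zero : V_sort := cls fgp_zero.
Definition V_add (x y : V_sort) : V_sort := cls (fgp_dsum (qrepr x) (qrepr y)).

Lemma V_add_pi P Q : V_add (cls P) (cls Q) = cls (fgp_dsum P Q).
Proof. by apply/clsP; apply: dsum_iso; apply: (qreprP fgp_isoP). Qed.

Lemma V_addA : associative V_add.
Proof.
move=> x y z; rewrite -(qreprK x) -(qreprK y) -(qreprK z) !V_add_pi.
by apply/clsP; apply: dsum_isoA.
Qed.

Lemma V_addC : commutative V_add.
Proof. by move=> x y; apply/clsP; apply: dsum_isoC. Qed.

Lemma V_add0 : left_id V_zero V_add.
Proof.
by move=> x; rewrite -(qreprK x) V_add_pi; apply/clsP; apply: dsum_iso0.
Qed.

(* V^gr(R) and K_0^gr(R) *)
Definition Vgr : cmonoid := CMonoid V_addA V_addC V_add0.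

Definition K0gr : preordered_group := group_completion Vgr.

End GradedModules.

HB.lock Definition lin_ext (K : fieldType) (T : choiceType) (V : lmodType K)
    (h : T -> V) (f : {malg K[T]}) : V :=
  \sum_(t <- msupp f) f@_t *: h t.
Canonical lin_ext_unlockable := Unlockable lin_ext.unlock.

Section FreeModule.
Variables (K : fieldType) (T : choiceType).
Implicit Types (f g : {malg K[T]}) (V : lmodType K).

Lemma malg_ind (P : {malg K[T]} -> Prop) :
  P 0 -> (forall f g, P f -> P g -> P (f + g)) ->
  (forall c t, P (c *: << t >>)) -> forall f, P f.
Proof.
move=> P0 PD PZ f; rewrite (monalgE f).
elim/big_rec: _ => // t g _ Pg; apply: PD => //.
have -> : << f@_t *g t >> = f@_t *: << t >> :> {malg K[T]}; last exact: PZ.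
by apply/malgP => u; rewrite mcoeffZ !mcoeffU mulrnAr mulr1.
Qed.

Lemma lin_extEw V (h : T -> V) f (d : {fset T}) : {subset msupp f <= d} ->
  lin_ext h f = \sum_(t <- d) f@_t *: h t.
Proof.
move=> fd; rewrite unlock; apply: big_fset_incl; first exact/fsubsetP.
by move=> t _ /mcoeff_outdom ->; rewrite scale0r.
Qed.

Lemma lin_ext_is_linear V (h : T -> V) : linear (lin_ext h).
Proof.
move=> c f g; pose d := (msupp f `|` msupp g `|` msupp (c *: f + g))%fset.
rewrite (@lin_extEw _ _ f d) ?(@lin_extEw _ _ g d) ?(@lin_extEw _ _ (c *: f + g) d).
- rewrite scaler_sumr -big_split /=; apply: eq_bigr => t _.
  by rewrite mcoeffD mcoeffZ scalerA scalerDl.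
all: by move=> t; rewrite !inE => ->; rewrite ?orbT.
Qed.

HB.instance Definition _ V (h : T -> V) :=
  GRing.isLinear.Build K {malg K[T]} V _ (lin_ext h) (lin_ext_is_linear h).

Lemma lin_extU V (h : T -> V) t : lin_ext h << t >> = h t.
Proof.
rewrite (@lin_extEw _ _ _ [fset t]%fset) ?big_seq_fset1 ?mcoeffUU ?scale1r //.
by apply/fsubsetP/msuppU_le.
Qed.

Lemma lin_ext_eqr V (h h' : T -> V) f : h =1 h' -> lin_ext h f = lin_ext h' f.
Proof. by move=> hh'; rewrite unlock; apply: eq_bigr => t _; rewrite hh'. Qed.

Lemma lin_extD V (h h' : T -> V) f :
  lin_ext (fun t => h t + h' t) f = lin_ext h f + lin_ext h' f.
Proof.
by rewrite unlock -big_split; apply: eq_bigr => t _; rewrite scalerDr.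
Qed.

Lemma lin_extZ V c (h : T -> V) f :
  lin_ext (fun t => c *: h t) f = c *: lin_ext h f.
Proof.
by rewrite unlock scaler_sumr; apply: eq_bigr => t _; rewrite !scalerA mulrC.
Qed.

Lemma malg_mulA (mul : {malg K[T]} -> {malg K[T]} -> {malg K[T]}) :
  left_distributive mul +%R -> right_distributive mul +%R ->
  (forall c f g, mul (c *: f) g = c *: mul f g) ->
  (forall c f g, mul f (c *: g) = c *: mul f g) ->
  (forall p q r, mul << p >> (mul << q >> << r >>)
                   = mul (mul << p >> << q >>) << r >>) ->
  associative mul.
Proof.
move=> Dl Dr Zl Zr mulA f g h.
have l0 x : mul 0 x = 0 by have := Zl 0 0 x; rewrite !scale0r.
have r0 x : mul x 0 = 0 by have := Zr 0 x 0; rewrite !scale0r.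
elim/malg_ind: f => [|f f' Hf Hf'|c p].
- by rewrite !l0.
- by rewrite !Dl Hf Hf'.
rewrite !Zl; congr (_ *: _); elim/malg_ind: g => [|g g' Hg Hg'|d q].
- by rewrite l0 r0 l0.
- by rewrite Dl !Dr Dl Hg Hg'.
rewrite Zl !Zr Zl; congr (_ *: _); elim/malg_ind: h => [|h h' Hh Hh'|e r].
- by rewrite !r0.
- by rewrite !Dr Hh Hh'.
by rewrite !Zr mulA.
Qed.

Variable deg : T -> int.

Definition homog (n : int) f : Prop := forall t, f@_t != 0 -> deg t = n.

Definition homog_part (n : int) : {malg K[T]} -> {malg K[T]} :=
  lin_ext (fun t => if deg t == n then << t >> else 0).

HB.instance Definition _ n :=
  GRing.isLinear.Build K {malg K[T]} {malg K[T]} _ (homog_part n)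
    (lin_ext_is_linear _).

Lemma homog_partE n f t :
  (homog_part n f)@_t = if deg t == n then f@_t else 0.
Proof.
elim/malg_ind: f => [|f g Hf Hg|c u].
- by rewrite linear0 !mcoeff0 if_same.
- by rewrite linearD !mcoeffD Hf Hg; case: ifP => // _; rewrite addr0.
rewrite linearZ /= /homog_part lin_extU !mcoeffZ mcoeffU.
have [->|ut] := eqVneq u t; first by case: ifP; rewrite ?mcoeff0 ?mulr0 ?mcoeffUU.
by rewrite mulr0n mulr0 if_same; case: ifP; rewrite ?mcoeff0 ?mcoeffU ?(negPf ut) mulr0.
Qed.

Lemma homog_part_homog n f : homog n (homog_part n f).
Proof. by move=> t; rewrite homog_partE; case: (deg t =P n) => // _; rewrite eqxx. Qed.

Lemma homog_part_id n f : homog n f -> homog_part n f = f.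
Proof.
move=> fn; apply/malgP => t; rewrite homog_partE; case: eqP => // /eqP tn.
by case: (eqVneq f@_t 0) => // /fn /eqP; rewrite (negPf tn).
Qed.

Lemma homog_part_neq m n f : homog m f -> m != n -> homog_part n f = 0.
Proof.
move=> fm mn; apply/malgP => t; rewrite homog_partE mcoeff0; case: eqP => // tn.
by case: (eqVneq f@_t 0) => // /fm tm; rewrite -tm tn eqxx in mn.
Qed.

Lemma homogU t : homog (deg t) << t >>.
Proof.
by move=> u; rewrite mcoeffU; case: (eqVneq t u) => [->//|_]; rewrite mulr0n eqxx.
Qed.

Lemma homog0 n : homog n 0.
Proof. by move=> t; rewrite mcoeff0 eqxx. Qed.

Lemma homogD n f g : homog n f -> homog n g -> homog n (f + g).
Proof.
move=> fn gn t; rewrite mcoeffD.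
by case: (eqVneq f@_t 0) => [->|/fn //]; rewrite add0r => /gn.
Qed.

Lemma homogZ n c f : homog n f -> homog n (c *: f).
Proof.
move=> fn t; rewrite mcoeffZ => cf; apply: fn.
by apply: contraNneq cf => ->; rewrite mulr0.
Qed.

Lemma homogB n f g : homog n f -> homog n g -> homog n (f - g).
Proof. by move=> fn gn; rewrite -scaleN1r; apply/homogD/homogZ. Qed.

Lemma homog_sum n (I : Type) (r : seq I) (P : pred I) (F : I -> {malg K[T]}) :
  (forall i, P i -> homog n (F i)) -> homog n (\sum_(i <- r | P i) F i).
Proof.
by move=> h; elim/big_rec: _ => [|i x Pi]; [apply: homog0|apply/homogD/h].
Qed.

Lemma homog_decomp f :
  f = \sum_(n <- undup [seq deg t | t <- msupp f]) homog_part n f.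
Proof.
apply/malgP => t; rewrite raddf_sum /=.
under eq_bigr do rewrite homog_partE.
have [ft|/mcoeff_outdom ->] := boolP (t \in msupp f); last first.
  by rewrite big1 // => n _; rewrite if_same.
rewrite (bigD1_seq (deg t)) ?undup_uniq ?mem_undup ?map_f //= eqxx.
by rewrite big1 ?addr0 // => n; rewrite eq_sym => /negPf ->.
Qed.

Lemma homog_grading : grading homog.
Proof.
split.
- exact: homog0.
- exact: homogB.
- move=> f; exists (undup [seq deg t | t <- msupp f]), (homog_part^~ f).
  by split; [move=> n; apply: homog_part_homog|apply: homog_decomp].
- move=> s c us cn c0 n ns.
  have := congr1 (homog_part n) c0; rewrite linear0 linear_sum /=.
  rewrite (bigD1_seq n) //= homog_part_id // big1 ?addr0 // => m mn.
  exact: homog_part_neq (cn m) mn.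
Qed.

End FreeModule.

Record finite_graph := FiniteGraph {
  vert : finType;
  edge : finType;
  src : edge -> vert;
  rng : edge -> vert }.

Arguments src {E} _ : rename.
Arguments rng {E} _ : rename.

Definition sink (E : finite_graph) (v : vert E) : Prop :=
  forall e : edge E, src e <> v.

Definition no_sinks (E : finite_graph) : Prop := forall v : vert E, ~ sink v.

Section Paths.
Variable E : finite_graph.

Fixpoint is_path (v : vert E) (s : seq (edge E)) : bool :=
  if s is e :: s' then (src e == v) && is_path (rng e) s' else true.

(* A path is its source together with its sequence of edges. *)
Definition gpath : Type := {p : vert E * seq (edge E) | is_path p.1 p.2}.
HB.instance Definition _ := Choice.on gpath.

Definition psrc (p : gpath) : vert E := (val p).1.
Definition pedges (p : gpath) : seq (edge E) := (val p).2.
Definition prng (p : gpath) : vert E := last (psrc p) (map rng (pedges p)).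
Definition plength (p : gpath) : int := (size (pedges p))%:Z.

Definition vpath (v : vert E) : gpath :=
  exist (fun p => is_path p.1 p.2) (v, [::]) isT.

Lemma is_path_cat v s t :
  is_path v (s ++ t) = is_path v s && is_path (last v (map rng s)) t.
Proof. by elim: s v => //= e s IH v; rewrite IH andbA. Qed.

(* The default value [p] is only taken when [prng p != psrc q]. *)
Definition pconcat (p q : gpath) : gpath :=
  insubd p (psrc p, pedges p ++ pedges q).

Lemma val_pconcat p q : prng p = psrc q ->
  val (pconcat p q) = (psrc p, pedges p ++ pedges q).
Proof.
move=> pq; rewrite /pconcat val_insubd /= is_path_cat -/(prng p) pq.
by rewrite /psrc /pedges (valP p) (valP q).
Qed.

Lemma psrc_pconcat p q : prng p = psrc q -> psrc (pconcat p q) = psrc p.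
Proof. by move=> pq; rewrite {1}/psrc val_pconcat. Qed.

Lemma prng_pconcat p q : prng p = psrc q -> prng (pconcat p q) = prng q.
Proof.
move=> pq; rewrite {1}/prng psrc_pconcat // {1}/pedges val_pconcat //=.
by rewrite map_cat last_cat -/(prng p) pq.
Qed.

Lemma plength_pconcat p q : prng p = psrc q ->
  plength (pconcat p q) = plength p + plength q.
Proof.
by move=> pq; rewrite {1}/plength /pedges val_pconcat //= size_cat PoszD.
Qed.

Lemma pconcatA p q r : prng p = psrc q -> prng q = psrc r ->
  pconcat p (pconcat q r) = pconcat (pconcat p q) r.
Proof.
move=> pq qr; apply: val_inj.
rewrite !val_pconcat ?psrc_pconcat ?prng_pconcat //.
by rewrite /pedges !val_pconcat //= catA.
Qed.

Lemma pconcat1p p : pconcat (vpath (psrc p)) p = p.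
Proof. by apply: val_inj; rewrite val_pconcat //; case: p => [[]]. Qed.

Lemma pconcatp1 p : pconcat p (vpath (prng p)) = p.
Proof.
by apply: val_inj; rewrite val_pconcat // cats0; case: p => [[]].
Qed.

End Paths.

Section PathAlgebra.
Variables (K : fieldType) (E : finite_graph).

Local Notation A := {malg K[gpath E]}.

Definition path_mul (p q : gpath E) : A :=
  if prng p == psrc q then << pconcat p q >> else 0.

(* The bilinear extension of [path_mul] *)
Definition pa_mul (f g : A) : A :=
  lin_ext (fun p => lin_ext (path_mul p) g) f.

Definition pa_one : A := \sum_(v : vert E) << vpath v >>.

Lemma pa_mulDl : left_distributive pa_mul +%R.
Proof. by move=> f g h; rewrite /pa_mul linearD. Qed.

Lemma pa_mulZl c f g : pa_mul (c *: f) g = c *: pa_mul f g.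
Proof. by rewrite /pa_mul linearZ. Qed.

Lemma pa_mul0l f : pa_mul 0 f = 0.
Proof. by rewrite /pa_mul linear0. Qed.

Lemma pa_mulDr : right_distributive pa_mul +%R.
Proof.
move=> f g h; rewrite /pa_mul -lin_extD; apply: lin_ext_eqr => p.
exact: linearD.
Qed.

Lemma pa_mulZr c f g : pa_mul f (c *: g) = c *: pa_mul f g.
Proof.
rewrite /pa_mul -lin_extZ; apply: lin_ext_eqr => p.
exact: linearZ.
Qed.

Lemma pa_mul0r f : pa_mul f 0 = 0.
Proof. by have := pa_mulZr 0 f 0; rewrite !scale0r. Qed.

Lemma pa_mulU p q : pa_mul << p >> << q >> = path_mul p q.
Proof. by rewrite /pa_mul !lin_extU. Qed.

Lemma path_mulA p q r :
  pa_mul << p >> (path_mul q r) = pa_mul (path_mul p q) << r >>.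
Proof.
rewrite /path_mul; case: eqP => [qr|qr]; last first.
  rewrite pa_mul0r; case: eqP => [pq|_]; last by rewrite pa_mul0l.
  by rewrite pa_mulU /path_mul prng_pconcat //; case: eqP.
rewrite pa_mulU /path_mul psrc_pconcat //; case: eqP => [pq|_]; last first.
  by rewrite pa_mul0l.
by rewrite pa_mulU /path_mul prng_pconcat // qr eqxx pconcatA.
Qed.

Lemma pa_mulA : associative pa_mul.
Proof.
apply: malg_mulA; [exact: pa_mulDl|exact: pa_mulDr|exact: pa_mulZl|exact: pa_mulZr|].
move=> p q r; apply: etrans (congr1 (pa_mul << p >>) (pa_mulU q r)) _.
apply: etrans (path_mulA p q r) _.
exact: (congr1 (pa_mul^~ << r >>) (esym (pa_mulU p q))).
Qed.

Lemma pa_mul1l : left_id pa_one pa_mul.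
Proof.
elim/malg_ind => [|f g Hf Hg|c p]; first exact: pa_mul0r.
  by rewrite pa_mulDr Hf Hg.
rewrite pa_mulZr; congr (_ *: _).
rewrite /pa_one (big_morph (pa_mul^~ _) (fun f g => pa_mulDl f g _) (pa_mul0l _)).
under eq_bigr do rewrite pa_mulU /path_mul /=.
by rewrite -big_mkcond big_pred1_eq pconcat1p.
Qed.

Lemma pa_mul1r : right_id pa_one pa_mul.
Proof.
elim/malg_ind => [|f g Hf Hg|c p]; first exact: pa_mul0l.
  by rewrite pa_mulDl Hf Hg.
rewrite pa_mulZl; congr (_ *: _).
rewrite /pa_one (big_morph (pa_mul _) (pa_mulDr _) (pa_mul0r _)).
under eq_bigr do rewrite pa_mulU /path_mul eq_sym /=.
by rewrite -big_mkcond big_pred1_eq pconcatp1.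
Qed.

Definition path_algebra : Type := {malg K[gpath E]}.
HB.instance Definition _ := GRing.Lmodule.on path_algebra.

HB.instance Definition _ := GRing.Zmodule_isPzRing.Build path_algebra
  pa_mulA pa_mul1l pa_mul1r pa_mulDl pa_mulDr.

Lemma path_algebraU (p q : gpath E) :
  (<< p >> : path_algebra) * << q >> = path_mul p q.
Proof. exact: pa_mulU. Qed.

Definition pa_comp : int -> path_algebra -> Prop := homog (@plength E).

Lemma pa_grading : grading pa_comp.
Proof. exact: homog_grading. Qed.

Lemma pa_comp1 : pa_comp 0 1.
Proof. by apply: homog_sum => v _; apply: homogU (vpath v). Qed.

Lemma pa_compM m n (f g : path_algebra) :
  pa_comp m f -> pa_comp n g -> pa_comp (m + n) (f * g).
Proof.
move=> fm gn; rewrite /GRing.mul /= /pa_mul unlock.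
apply: homog_sum => p _; case: (eqVneq f@_p 0) => [->|/fm <-].
  by rewrite scale0r; apply: homog0.
apply/homogZ/homog_sum => q _; case: (eqVneq g@_q 0) => [->|/gn <-].
  by rewrite scale0r; apply: homog0.
apply: homogZ; rewrite /path_mul; case: eqP => [pq|_]; last exact: homog0.
by rewrite -plength_pconcat //; apply: homogU.
Qed.

Definition path_gralgebra : gradedRing :=
  GradedRing pa_grading pa_comp1 pa_compM.

End PathAlgebra.

Section QGr.
Variables (K : fieldType) (E : finite_graph).
Local Notation P := (path_gralgebra K E).

Record graded_submodule (M : grmod P) (N : M -> Prop) : Prop :=
  GradedSubmodule {
    gsub0 : N 0;
    gsubD : forall x y, N x -> N y -> N (x + y);
    gsubZ : forall (a : P^c) x, N x -> N (a *: x);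
    gsub_homog : forall (s : seq int) (c : int -> M), uniq s ->
      (forall n, gm_comp n (c n)) -> N (\sum_(n <- s) c n) ->
      forall n, n \in s -> N (c n) }.

(* The scalar k in K acts on a P-module as the element k 1 of P. *)
Definition finite_dimensional (M : grmod P) (N : M -> Prop) : Prop :=
  exists (n : nat) (b : 'I_n -> M), (forall i, N (b i)) /\
    forall x, N x -> exists k : 'I_n -> K,
      x = \sum_(i < n) ((k i *: (1 : path_algebra K E)) : P^c) *: b i.

Definition Fdim (M : grmod P) : Prop :=
  forall x : M, exists s : seq M, x = \sum_(y <- s) y /\
    forall y, y \in s -> exists N : M -> Prop,
      [/\ graded_submodule N, finite_dimensional N & N y].

(* Morphisms whose kernel and cokernel lie in Fdim; the kernel and the
   cokernel are taken up to isomorphism, as modules completing f to an exact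
   sequence 0 -> X -> M -> N -> Y -> 0. *)
Definition Fdim_iso (M N : Gr P) (f : grhom M N) : Prop :=
  exists (X : grmod P) (i : grhom X M) (Y : grmod P) (q : grhom N Y),
    [/\ injective i, forall x, f x = 0 <-> (exists z, i z = x),
        forall y, q y = 0 <-> (exists x, f x = y), forall z, exists y, q y = z
      & Fdim X /\ Fdim Y].

(* The quotient of Gr by the Serre subcategory Fdim: the localisation of Gr at
   the morphisms that are invertible modulo Fdim. *)
Definition QGr : category := localisation (C := Gr P) Fdim_iso.

End QGr.

(* Quotient of a ring by the two-sided ideal generated by relations x = y *)

Section PresentedRing.
Variables (A : pzRingType) (rel : A -> A -> Prop).

Inductive rel_ideal : A -> Prop :=
| rel_ideal0 : rel_ideal 0
| rel_idealD x y : rel_ideal x -> rel_ideal y -> rel_ideal (x + y)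
| rel_ideal_gen a x y b : rel x y -> rel_ideal (a * (x - y) * b).

Lemma rel_idealN x : rel_ideal x -> rel_ideal (- x).
Proof.
elim=> [|y z _ Hy _ Hz|a y z b yz]; first by rewrite oppr0; constructor.
  by rewrite opprD; constructor.
by rewrite -!mulNr; constructor.
Qed.

Lemma rel_idealMl c x : rel_ideal x -> rel_ideal (c * x).
Proof.
elim=> [|y z _ Hy _ Hz|a y z b yz]; first by rewrite mulr0; constructor.
  by rewrite mulrDr; constructor.
by rewrite !mulrA; constructor.
Qed.

Lemma rel_idealMr c x : rel_ideal x -> rel_ideal (x * c).
Proof.
elim=> [|y z _ Hy _ Hz|a y z b yz]; first by rewrite mul0r; constructor.
  by rewrite mulrDl; constructor.
by rewrite -(mulrA _ b); constructor.
Qed.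

Definition rel_idealb : {pred A} := [pred x | `[< rel_ideal x >]].

Lemma rel_idealb_closed : zmod_closed rel_idealb.
Proof.
split=> [|x y /asboolP Ix /asboolP Iy]; apply/asboolP; first by constructor.
by constructor; last exact: rel_idealN.
Qed.

HB.instance Definition _ := GRing.isZmodClosed.Build A rel_idealb rel_idealb_closed.

Definition rel_idealq : zmodClosed A := rel_idealb.

Definition presented_ring : Type := Quotient.quot rel_idealq.
HB.instance Definition _ := GRing.Zmodule.on presented_ring.

Local Open Scope quotient_scope.

Definition pr_pi (x : A) : presented_ring := \pi_(Quotient.quot rel_idealq) x.

Lemma pr_piP x y : pr_pi x = pr_pi y <-> rel_ideal (x - y).
Proof.
split=> [/eqP|h]; first by rewrite -Quotient.idealrBE => /asboolP.
by apply/eqP; rewrite -Quotient.idealrBE; apply/asboolP.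
Qed.

Lemma pr_piB : {morph pr_pi : x y / x - y}.
Proof. by move=> x y; rewrite /pr_pi raddfB. Qed.

HB.instance Definition _ := GRing.isZmodMorphism.Build A presented_ring pr_pi pr_piB.

Definition pr_repr (x : presented_ring) : A := repr (x : Quotient.quot rel_idealq).

Lemma pr_reprK : cancel pr_repr pr_pi.
Proof. by move=> x; rewrite /pr_pi reprK. Qed.

Definition pr_one : presented_ring := pr_pi 1.
Definition pr_mul (x y : presented_ring) : presented_ring :=
  pr_pi (pr_repr x * pr_repr y).

Lemma pr_mul_pi x y : pr_mul (pr_pi x) (pr_pi y) = pr_pi (x * y).
Proof.
apply/pr_piP; set x' := pr_repr _; set y' := pr_repr _.
have Ix : rel_ideal (x' - x) by apply/pr_piP; rewrite pr_reprK.
have Iy : rel_ideal (y' - y) by apply/pr_piP; rewrite pr_reprK.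
have -> : x' * y' - x * y = x' * (y' - y) + (x' - x) * y.
  by rewrite mulrBr mulrBl addrA subrK.
by constructor; [apply: rel_idealMl|apply: rel_idealMr].
Qed.

Lemma pr_mulA : associative pr_mul.
Proof.
move=> x y z; rewrite -(pr_reprK x) -(pr_reprK y) -(pr_reprK z).
by rewrite !pr_mul_pi mulrA.
Qed.

Lemma pr_mul1l : left_id pr_one pr_mul.
Proof. by move=> x; rewrite -(pr_reprK x) pr_mul_pi mul1r. Qed.

Lemma pr_mul1r : right_id pr_one pr_mul.
Proof. by move=> x; rewrite -(pr_reprK x) pr_mul_pi mulr1. Qed.

Lemma pr_mulDl : left_distributive pr_mul +%R.
Proof.
move=> x y z; rewrite -(pr_reprK x) -(pr_reprK y) -(pr_reprK z) -raddfD.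
by rewrite !pr_mul_pi mulrDl raddfD.
Qed.

Lemma pr_mulDr : right_distributive pr_mul +%R.
Proof.
move=> x y z; rewrite -(pr_reprK x) -(pr_reprK y) -(pr_reprK z) -raddfD.
by rewrite !pr_mul_pi mulrDr raddfD.
Qed.

HB.instance Definition _ := GRing.Zmodule_isPzRing.Build presented_ring
  pr_mulA pr_mul1l pr_mul1r pr_mulDl pr_mulDr.

Lemma pr_pi_monoid_morphism : monoid_morphism pr_pi.
Proof. by split=> // x y; rewrite -pr_mul_pi. Qed.

HB.instance Definition _ := GRing.isMonoidMorphism.Build A presented_ring pr_pi
  pr_pi_monoid_morphism.

End PresentedRing.

Section Leavitt.
Variables (K : fieldType) (E : finite_graph).

(* v, alpha and alpha^*, in this order *)
Definition lgen : Type := (vert E + (edge E + edge E))%type.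
HB.instance Definition _ := Choice.on lgen.

Local Notation A := {malg K[{fmonom lgen}]}.

Definition lvtx (v : vert E) : A := << fmu (inl v : lgen) >>.
Definition ledge (e : edge E) : A := << fmu (inr (inl e) : lgen) >>.
Definition lghost (e : edge E) : A := << fmu (inr (inr e) : lgen) >>.

(* A is unital, so that the identity sum_v v of the Leavitt path algebra has
   to be identified with the empty word. *)
Inductive leavitt_rel : A -> A -> Prop :=
| lrel_unit : leavitt_rel (\sum_(v : vert E) lvtx v) 1
| lrel_vertex v w : leavitt_rel (lvtx v * lvtx w) (if v == w then lvtx v else 0)
| lrel_src e : leavitt_rel (lvtx (src e) * ledge e) (ledge e)
| lrel_rng e : leavitt_rel (ledge e * lvtx (rng e)) (ledge e)
| lrel_ghost_rng e : leavitt_rel (lvtx (rng e) * lghost e) (lghost e)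
| lrel_ghost_src e : leavitt_rel (lghost e * lvtx (src e)) (lghost e)
| lrel_CK1 e f : leavitt_rel (lghost e * ledge f) (if e == f then lvtx (rng e) else 0)
| lrel_CK2 v : (exists e : edge E, src e = v) ->
    leavitt_rel (\sum_(e : edge E | src e == v) ledge e * lghost e) (lvtx v).

Definition leavitt : pzRingType := presented_ring leavitt_rel.

Definition lgen_deg (g : lgen) : int :=
  match g with inl _ => 0 | inr (inl _) => 1 | inr (inr _) => -1 end.

Definition lword_deg (m : {fmonom lgen}) : int := \sum_(g <- m) lgen_deg g.

Definition leavitt_comp (n : int) (x : leavitt) : Prop :=
  exists2 a : A, homog lword_deg n a & x = pr_pi leavitt_rel a.

Lemma lword_degM m m' : lword_deg (mmul m m') = lword_deg m + lword_deg m'.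
Proof. by rewrite /lword_deg fmM big_cat. Qed.

Lemma homogM m n (a b : A) :
  homog lword_deg m a -> homog lword_deg n b -> homog lword_deg (m + n) (a * b).
Proof.
move=> am bn; rewrite malgME.
apply: homog_sum => p _; case: (eqVneq a@_p 0) => [ap0|/am <-].
  apply: homog_sum => q _; rewrite ap0 mul0r monalgU0; exact: homog0.
apply: homog_sum => q _; case: (eqVneq b@_q 0) => [bq0|/bn <-].
  by rewrite bq0 mulr0 monalgU0; apply: homog0.
have -> : << a@_p * b@_q *g mmul p q >>
        = (a@_p * b@_q) *: << mmul p q >> :> A.
  by apply/malgP => u; rewrite mcoeffZ !mcoeffU mulrnAr mulr1.
by rewrite -lword_degM; apply/homogZ/homogU.
Qed.

Lemma homog_lv v : homog lword_deg 0 (lvtx v).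
Proof.
have -> : 0 = lword_deg (fmu (inl v : lgen)) by rewrite /lword_deg fmU big_seq1.
exact: homogU.
Qed.

Lemma homog_le e : homog lword_deg 1 (ledge e).
Proof.
have -> : 1 = lword_deg (fmu (inr (inl e) : lgen)) by rewrite /lword_deg fmU big_seq1.
exact: homogU.
Qed.

Lemma homog_ls e : homog lword_deg (-1) (lghost e).
Proof.
have -> : -1 = lword_deg (fmu (inr (inr e) : lgen)) by rewrite /lword_deg fmU big_seq1.
exact: homogU.
Qed.

Lemma homog1 : homog lword_deg 0 (1 : A).
Proof.
have -> : 0 = lword_deg mone by rewrite /lword_deg fm1 big_nil.
exact: homogU.
Qed.

Lemma leavitt_rel_homog x y : leavitt_rel x y ->
  exists n, homog lword_deg n x /\ homog lword_deg n y.
Proof.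
case=> [|v w|e|e|e|e|e f|v _].
- exists 0; split; last exact: homog1.
  by apply: homog_sum => v _; apply: homog_lv.
- exists 0; split; first by apply: (@homogM 0 0); apply: homog_lv.
  by case: ifP => _; [apply: homog_lv|apply: homog0].
- exists 1; split; last exact: homog_le.
  by apply: (@homogM 0 1); [apply: homog_lv|apply: homog_le].
- exists 1; split; last exact: homog_le.
  by apply: (@homogM 1 0); [apply: homog_le|apply: homog_lv].
- exists (-1); split; last exact: homog_ls.
  by apply: (@homogM 0 (-1)); [apply: homog_lv|apply: homog_ls].
- exists (-1); split; last exact: homog_ls.
  by apply: (@homogM (-1) 0); [apply: homog_ls|apply: homog_lv].
- exists 0; split; last by case: ifP => _; [apply: homog_lv|apply: homog0].
  by apply: (@homogM (-1) 1); [apply: homog_ls|apply: homog_le].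
- exists 0; split; last exact: homog_lv.
  by apply: homog_sum => e _; apply: (@homogM 1 (-1)); [apply: homog_le|apply: homog_ls].
Qed.

Lemma homog_partMr n m (a r : A) : homog lword_deg m r ->
  homog_part lword_deg n (r * a) = r * homog_part lword_deg (n - m) a.
Proof.
move=> rm; rewrite (homog_decomp lword_deg a).
rewrite mulr_sumr !linear_sum /= mulr_sumr; apply: eq_bigr => k _.
move: (homog_part _ k a) (@homog_part_homog _ _ lword_deg k a) => b bk.
have brk := homogM rm bk; case: (eqVneq k (n - m)) => [kn|kn].
  rewrite -kn (homog_part_id bk); apply: homog_part_id.
  by rewrite -[n](subrK m) -kn addrC.
rewrite (homog_part_neq brk) ?(homog_part_neq bk kn) ?mulr0 //.
by apply: contra_neq kn => <-; rewrite addrAC subrr add0r.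
Qed.

Lemma rel_ideal_homog_part n (a : A) :
  rel_ideal leavitt_rel a -> rel_ideal leavitt_rel (homog_part lword_deg n a).
Proof.
elim=> [|x y _ Hx _ Hy|x r r' y rr']; first by rewrite linear0; constructor.
  by rewrite linearD; constructor.
have [m [rm rm']] := leavitt_rel_homog rr'; have rB := homogB rm rm'.
have hx := homog_decomp lword_deg x; set s := undup _ in hx.
rewrite {1}hx -mulrA mulr_suml linear_sum /=.
elim/big_rec: _ => [|k z _ Hz]; first by constructor.
constructor; last exact: Hz.
rewrite (homog_partMr _ _ (@homog_part_homog _ _ lword_deg k x)).
by rewrite (homog_partMr _ _ rB) mulrA; constructor.
Qed.

Lemma leavitt_grading : grading leavitt_comp.
Proof.
split.
- by move=> n; exists 0; [apply: homog0|rewrite raddf0].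
- move=> n _ _ [a an ->] [b bn ->]; exists (a - b); first exact: homogB.
  by rewrite raddfB.
- move=> x; pose a := pr_repr x.
  exists (undup [seq lword_deg t | t <- msupp a]).
  exists (fun n => pr_pi leavitt_rel (homog_part lword_deg n a)); split.
    by move=> n; exists (homog_part lword_deg n a) => //; apply: homog_part_homog.
  by rewrite -raddf_sum -homog_decomp; apply/esym/pr_reprK.
- move=> s c us cP c0 n ns.
  have /choice [d dP] k : exists a : A,
      homog lword_deg k a /\ c k = pr_pi leavitt_rel a.
    by have [a] := cP k; exists a.
  have : rel_ideal leavitt_rel (\sum_(k <- s) d k - 0).
    apply/pr_piP; rewrite raddf0 -c0 raddf_sum; apply: eq_bigr => k _.
    by have [_ ->] := dP k.
  rewrite subr0 => /(rel_ideal_homog_part n); rewrite linear_sum /=.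
  rewrite (bigD1_seq n) //= (homog_part_id (dP n).1) big1 ?addr0; last first.
    by move=> k kn; apply: homog_part_neq (dP k).1 kn.
  by move=> Id; rewrite (dP n).2 -(raddf0 (pr_pi leavitt_rel)); apply/pr_piP; rewrite subr0.
Qed.

Lemma leavitt_comp1 : leavitt_comp 0 1.
Proof. by exists 1; [apply: homog1|rewrite rmorph1]. Qed.

Lemma leavitt_compM m n (x y : leavitt) :
  leavitt_comp m x -> leavitt_comp n y -> leavitt_comp (m + n) (x * y).
Proof.
move=> [a am ->] [b bn ->]; exists (a * b); first exact: homogM.
by rewrite rmorphM.
Qed.

Definition leavitt_gralgebra : gradedRing :=
  GradedRing leavitt_grading leavitt_comp1 leavitt_compM.

End Leavitt.

(* Main.v *)
(* The closed modules are the graded right P(E)-modules M in which every family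
   of elements y_e of M r(e), one for each edge e, is of the form (x e)_e for a
   unique x in M.

   A module is sent to a closed one, functorially and up to Fdim, by the germs
   of functions on long paths; so the category Cl(E) of closed modules is the
   localisation QGr-P(E). If E has no sinks, then a module is closed exactly
   when ghost edges act on it subject to the Cuntz-Krieger relations, so Cl(E)
   is also equivalent to Gr-L(E). An equivalence of the categories QGr therefore
   gives an equivalence of Gr-L(E) and Gr-L(F), which preserves projective
   objects, finite generation and direct sums, hence the ordered K_0.

   Conversely, a graded finitely generated projective L(E)-module is free on
   finitely many generators x_i = x_i v_i of one common degree, and the x_i e
   with s(e) = v_i are free generators one degree higher. So the ordered K_0 is
   the direct limit of copies of Z^(E^0) along the adjacency matrix, with the
   standard cone. An isomorphism of two such ordered groups yields nonnegative
   integer matrices B_k and C_k such that B_k C_k and C_k B_(k+1) are powers of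
   the adjacency matrices of F and of E. Read as bipartite graphs, they allow one
   to factor paths of F as edges of B_k followed by edges of C_k, and paths of E
   as edges of C_k followed by edges of B_(k+1). Since a closed module is
   determined by its components in any sequence of degrees tending to infinity,
   the B_k turn closed modules over E into closed modules over F, and the C_k
   give the inverse. *)

From HB Require Import structures.
From mathcomp Require Import all_boot all_order all_algebra.
From mathcomp Require Import finmap.
From mathcomp Require Import monalg.
From mathcomp Require Import zify.
From mathcomp.classical Require Import boolp functions.
Require Import Defs.
Set Implicit Arguments.
Unset Strict Implicit.
Unset Printing Implicit Defensive.
Import Order.TTheory GRing.Theory Num.Theory.
Local Open Scope ring_scope.

(** * Equivalences of categories and reflective localisations *)

(** The isomorphism of the two groups K_0 is not assumed to respect the shift of degrees. So the
    matrices B_k and C_k may vary with k and the levels need not be evenly spaced, and a ladder with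
    varying rungs takes the place of a shift equivalence of two adjacency matrices. The matrix
    identities only count paths with given ends; any bijections between these paths and pairs of
    bipartite edges will do, because in a closed module the values along the paths of a fixed length
    can be prescribed freely, up to end vertices.

    This principle, existence and uniqueness of an element with given products by long paths, is
    used throughout. It makes closed modules the local objects for the morphisms inverted in QGr, so
    that no calculus of fractions is needed; it supplies the ghost edges; and it lets the transfer
    along a ladder be defined with paths alone.

    Equality in a direct limit is only eventual equality. Hence identities are first obtained after
    some further steps, and those steps are then absorbed into a matrix or a set of generators.
    Finite sums of bounds serve as common bounds. *)

(** The dependent form of [choice], needed because arrows live in types indexed by objects. *)
Lemma dep_choice (A : Type) (B : A -> Type) (P : forall a, B a -> Prop) :
  (forall a, exists b, P a b) -> exists f : forall a, B a, forall a, P a (f a).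
Proof.
by move=> h; exists (fun a => projT1 (cid (h a))) => a; apply: (projT2 (cid (h a))).
Qed.

Section NaturalIsomorphisms.

Lemma natiso_trans C D (F G H : functor C D) :
  naturally_isomorphic F G -> naturally_isomorphic G H -> naturally_isomorphic F H.
Proof.
move=> [s [sn si]] [t [tn ti]]; exists (fun a => ccomp (t a) (s a)); split.
  by move=> a b f; rewrite -ccompA sn ccompA tn ccompA.
move=> a; have [s' [s's ss']] := si a; have [t' [t't tt']] := ti a.
exists (ccomp s' t'); split.
  by rewrite -ccompA (ccompA t') t't ccomp1l.
by rewrite -ccompA (ccompA (s a)) ss' ccomp1l.
Qed.

Lemma natiso_sym C D (F G : functor C D) :
  naturally_isomorphic F G -> naturally_isomorphic G F.
Proof.
move=> [s [sn si]].
have [t tP] := dep_choice si.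
exists t; split=> [a b f|a]; last first.
  by exists (s a); have [-> ->] := tP a.
have [ta _] := tP b; have [_ tb] := tP a.
by rewrite -[LHS]ccomp1r -tb -ccompA (ccompA _ (s a)) -sn !ccompA ta ccomp1l.
Qed.

Lemma natiso_whiskerl C D E (H : functor D E) (F G : functor C D) :
  naturally_isomorphic F G ->
  naturally_isomorphic (functor_comp H F) (functor_comp H G).
Proof.
move=> [s [sn si]]; exists (fun a => fhom H (s a)); split=> [a b f|a] /=.
  by rewrite -!fhom_comp sn.
by have [t [ts st]] := si a; exists (fhom H t); rewrite -!fhom_comp ts st !fhom_id.
Qed.

Lemma natiso_whiskerr C D E (H : functor C D) (F G : functor D E) :
  naturally_isomorphic F G ->
  naturally_isomorphic (functor_comp F H) (functor_comp G H).
Proof.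
move=> [s [sn si]]; exists (fun a => s (H a)); split=> [a b f|a] /=.
  exact: sn.
exact: si.
Qed.

End NaturalIsomorphisms.

Section Equivalences.

Lemma equiv_sym C D : equivalent_categories C D -> equivalent_categories D C.
Proof. by move=> [F [G [h1 h2]]]; exists G, F. Qed.

Lemma equiv_trans C D E : equivalent_categories C D ->
  equivalent_categories D E -> equivalent_categories C E.
Proof.
move=> [F [G [h1 h2]]] [F' [G' [h3 h4]]].
exists (functor_comp F' F), (functor_comp G G'); split.
  apply: natiso_trans h1.
  exact: (natiso_whiskerl G (natiso_whiskerr F h3)).
apply: natiso_trans h4.
exact: (natiso_whiskerl F' (natiso_whiskerr G' h2)).
Qed.

(** As in a monoid, F is isomorphic to F G F', hence to F'; so G F is isomorphic to G F' and thus to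
    the identity. *)
Lemma equiv_of_left_right_inverse C D (F F' : functor C D) (G : functor D C) :
  naturally_isomorphic (functor_comp F G) (functor_id D) ->
  naturally_isomorphic (functor_comp G F') (functor_id C) ->
  equivalent_categories C D.
Proof.
move=> FG GF'; exists F, G; split=> //.
apply: natiso_trans (GF').
apply: (natiso_whiskerl G).
apply: natiso_trans (_ : naturally_isomorphic F (functor_comp (functor_comp F G) F')) _.
  exact: (natiso_sym (natiso_whiskerl F GF')).
exact: (natiso_whiskerr F' FG).
Qed.

Section FullyFaithful.
Variables (C D : category) (F : functor C D).
Hypothesis full : forall a b (g : hom (F a) (F b)), exists f, fhom F f = g.
Hypothesis faithful : forall a b (f g : hom a b), fhom F f = fhom F g -> f = g.
Hypothesis esurj : forall d, exists a, isomorphic (F a) d.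

Lemma equiv_of_fully_faithful : equivalent_categories C D.
Proof.
have [g0 g0P] := dep_choice esurj.
have [i iP] := dep_choice g0P.
have [j jP] := dep_choice iP.
pose pre a b (g : hom (F a) (F b)) : hom a b := projT1 (cid (full g)).
have preK a b (g : hom (F a) (F b)) : fhom F (pre a b g) = g.
  exact: projT2 (cid (full g)).
pose gh d d' (f : hom d d') := pre _ _ (ccomp (j d') (ccomp f (i d))).
have gh1 d : gh d d (idc d) = idc (g0 d).
  by apply: faithful; rewrite preK fhom_id ccomp1l (jP d).1.
have ghD a b c (g : hom b c) (f : hom a b) :
    gh _ _ (ccomp g f) = ccomp (gh _ _ g) (gh _ _ f).
  apply: faithful; rewrite fhom_comp !preK -!ccompA; congr ccomp.
  by rewrite (ccompA (i b)) (jP b).2 ccomp1l.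
exists F, (Functor gh1 ghD); split.
  exists (fun a => pre _ _ (i (F a))); split=> [a b f|a] /=.
    apply: faithful; rewrite !fhom_comp !preK.
    by rewrite ccompA (jP _).2 ccomp1l.
  exists (pre _ _ (j (F a))); split; apply: faithful;
    by rewrite fhom_comp !preK fhom_id ?(jP _).1 ?(jP _).2.
exists i; split=> [a b f|a] /=; last by exists (j a); have [] := jP a.
by rewrite preK ccompA (jP _).2 ccomp1l.
Qed.

End FullyFaithful.
End Equivalences.

Section FullSubcategory.
Variables (C : category) (P : C -> Prop).

Definition fullsub : category :=
  @Category {a : C | P a} (fun a b => hom (projT1 a) (projT1 b))
    (fun a => idc (projT1 a)) (fun a b c g f => ccomp g f)
    (fun a b => @ccomp1l C _ _) (fun a b => @ccomp1r C _ _)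
    (fun a b c d => @ccompA C _ _ _ _).

End FullSubcategory.

Section ReflectiveLocalisation.
Variables (C : category) (W : forall a b : C, hom a b -> Prop) (P : C -> Prop).
Hypothesis reflect_ex : forall a : C, exists a' (w : hom a a'), P a' /\ W w.
Hypothesis localP : forall (a a' b : C) (w : hom a a') (f : hom a b), W w -> P b ->
  exists g : hom a' b, ccomp g w = f /\ (forall g', ccomp g' w = f -> g' = g).

Let qp a b (p : zigzag W a b) : hom (C := localisation W) a b := qpi (@zz_eq _ _ a b) p.
Let J a b (f : hom a b) := qp (zz_fwd f (zz_nil W b)).

Let ext (a a' b : C) (w : hom a a') (Ww : W w) (Pb : P b) (f : hom a b) : hom a' b :=
  projT1 (cid (localP f Ww Pb)).

Let extK a a' b (w : hom a a') (Ww : W w) (Pb : P b) (f : hom a b) :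
  ccomp (ext Ww Pb f) w = f.
Proof. exact: (projT2 (cid (localP f Ww Pb))).1. Qed.

Let extU a a' b (w : hom a a') (Ww : W w) (Pb : P b) (f : hom a b) g :
  ccomp g w = f -> g = ext Ww Pb f.
Proof. exact: (projT2 (cid (localP f Ww Pb))).2. Qed.

(* Precomposition with a zigzag, contravariantly on the morphisms into a local
   object. *)
Let pull (b : C) (Pb : P b) :=
  fix pull a a' (p : zigzag W a a') : hom a' b -> hom a b :=
  match p in zigzag _ a a' return hom a' b -> hom a b with
  | zz_nil _ => fun f => f
  | zz_fwd _ _ _ g p => fun f => ccomp (pull _ _ p f) g
  | zz_bwd _ _ _ _ Ww p => fun f => ext Ww Pb (pull _ _ p f)
  end.

Let pull_eq b (Pb : P b) a a' (p q : zigzag W a a') :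
  zz_eq p q -> pull Pb p =1 pull Pb q.
Proof.
elim=> {a a' p q} //=.
- by move=> a a' p q _ IH f; rewrite IH.
- by move=> a a' p q r _ IH1 _ IH2 f; rewrite IH1.
- by move=> a a' c g p q _ IH f; rewrite IH.
- by move=> a a' c w Ww p q _ IH f; rewrite IH.
- by move=> a a' p f; rewrite ccomp1r.
- by move=> a a' c d f g p h; rewrite ccompA.
- by move=> a a' c w Ww p f; rewrite extK.
- by move=> a a' c w Ww p f; rewrite -(@extU _ _ _ _ Ww Pb _ (pull Pb p f)).
Qed.

Let pull_sound b (Pb : P b) a a' (p : zigzag W a a') (f : hom a' b) :
  ccomp (J f) (qp p) = J (pull Pb p f).
Proof.
rewrite /= lcomp_pi; apply/(qpi_eq (zz_eqP W _ _)).
elim: p f => /= [a1|a1 a2 a3 g p IH|a1 a2 a3 w Ww p IH] f.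
- exact: zz_refl.
- exact: zz_trans (zz_fwd_congr _ (IH f)) (zz_fwd_comp _ _ _).
- apply: zz_trans (zz_bwd_congr Ww (IH f)) _.
  (* Since [h] is [ext] after [w], the formal inverse of [w] cancels against [w]. *)
  set h := pull Pb p f; apply: zz_trans (_ : zz_eq _
    (zz_bwd Ww (zz_fwd w (zz_fwd (ext Ww Pb h) (zz_nil W b))))) _.
    apply: zz_bwd_congr; apply: zz_trans (zz_sym (zz_fwd_comp _ _ _)).
    by rewrite extK; apply: zz_refl.
  exact: zz_bwd_fwd.
Qed.

(** Morphisms into a local object extend uniquely along W, so zigzags act on them by [pull].
    Evaluating this action at an identity recovers a genuine morphism, which gives fullness and
    faithfulness; the reflections, inverted in the localisation, give essential surjectivity. *)
Lemma reflective_localisation :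
  equivalent_categories (localisation W) (fullsub P).
Proof.
apply: equiv_sym.
have J1 a : J (idc a) = idc (a : localisation W).
  exact/(qpi_eq (zz_eqP W _ _))/zz_fwd_id.
have JD a b c (g : hom b c) (f : hom a b) : J (ccomp g f) = ccomp (J g) (J f).
  rewrite /= lcomp_pi; apply/(qpi_eq (zz_eqP W _ _))/zz_sym/zz_fwd_comp.
pose F : functor (fullsub P) (localisation W) :=
  @Functor (fullsub P) (localisation W) (fun a => projT1 a) (fun a b f => J f)
    (fun a => J1 _) (fun a b c g f => JD _ _ _ g f).
apply: (@equiv_of_fully_faithful _ _ F) => [a b g|a b f g fg|d].
(* [pull_sound] at the identity says that the zigzag equals the image of its pulled back
   identity. *)
- exists (pull (projT2 b) (qrepr g) (idc (projT1 b))).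
  apply: etrans (esym (pull_sound _ _ _)) _.
  by rewrite J1 ccomp1l; apply: qreprK.
- have /(qpi_eq (zz_eqP W _ _)) h := fg.
  have := pull_eq (projT2 b) h (idc (projT1 b)) => /=.
  by rewrite !ccomp1l.
- have [a [w [Pa Ww]]] := reflect_ex d; exists (exist _ a Pa).
  exists (qp (zz_bwd Ww (zz_nil W d))), (J w); split.
    rewrite /= lcomp_pi; apply/(qpi_eq (zz_eqP W _ _)) => /=; exact: zz_bwd_fwd.
  rewrite /= lcomp_pi; apply/(qpi_eq (zz_eqP W _ _)) => /=; exact: zz_fwd_bwd.
Qed.

End ReflectiveLocalisation.

(** * Submodules and homogeneous components *)

Section QuotientModule.
Variables (R : pzRingType) (V : lmodType R).

Record submodule := Submodule {
  sm_pred :> V -> Prop;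
  sm0 : sm_pred 0;
  smP : forall a x y, sm_pred x -> sm_pred y -> sm_pred (a *: x + y) }.

Variable S : submodule.

Lemma smD x y : S x -> S y -> S (x + y).
Proof. by move=> Sx Sy; rewrite -[x]scale1r; apply: smP. Qed.

Lemma smZ a x : S x -> S (a *: x).
Proof. by move=> Sx; rewrite -[_ *: _]addr0; apply: smP => //; apply: sm0. Qed.

Lemma sm_sum (I : Type) (r : seq I) (P : pred I) (F : I -> V) :
  (forall i, P i -> S (F i)) -> S (\sum_(i <- r | P i) F i).
Proof. by move=> h; elim/big_rec: _ => [|i x Pi]; [apply: sm0|apply/smD/h]. Qed.

Definition smb : {pred V} := [pred x | `[< S x >]].

Lemma smb_closed : submod_closed smb.
Proof.
split=> [|a x y /asboolP Sx /asboolP Sy]; apply/asboolP; first exact: sm0.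
exact: smP.
Qed.

HB.instance Definition _ := GRing.isSubmodClosed.Build R V smb smb_closed.

Definition smsub : Type := {x | x \in smb}.
HB.instance Definition _ := [isSub of smsub for (@sval V (fun x => x \in smb))].
HB.instance Definition _ := [Choice of smsub by <:].
HB.instance Definition _ := [SubChoice_isSubLmodule of smsub by <:].

Lemma smsub_ex : exists (W : lmodType R) (i : {linear W -> V}),
  injective i /\ forall x, S x <-> exists z, i z = x.
Proof.
exists smsub, (\val : smsub -> V); split; first exact: val_inj.
move=> x; split=> [Sx|[z <-]]; last by apply/asboolP; exact: (valP z).
have xS : x \in smb by apply/asboolP.
by exists (exist (fun x => x \in smb) x xS).
Qed.

Definition smq : zmodClosed V := smb.
Definition smquot : Type := Quotient.quot smq.
HB.instance Definition _ := GRing.Zmodule.on smquot.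

Definition smpi (x : V) : smquot := (\pi_(Quotient.quot smq) x)%qT.
Definition smrepr (x : smquot) : V := repr (x : Quotient.quot smq).

Lemma smreprK : cancel smrepr smpi.
Proof. by move=> x; rewrite /smpi reprK. Qed.

Lemma smpiP x y : smpi x = smpi y <-> S (x - y).
Proof.
split=> [/eqP|h]; first by rewrite -Quotient.idealrBE => /asboolP.
by apply/eqP; rewrite -Quotient.idealrBE; apply/asboolP.
Qed.

Lemma smpiD x y : smpi (x + y) = smpi x + smpi y.
Proof. by rewrite /smpi raddfD. Qed.

Definition smscale (a : R) (x : smquot) : smquot := smpi (a *: smrepr x).

Lemma smscale_pi a x : smscale a (smpi x) = smpi (a *: x).
Proof. by apply/smpiP; rewrite -scalerBr; apply/smZ/smpiP; rewrite smreprK. Qed.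

Lemma smscaleA a b v : smscale a (smscale b v) = smscale (a * b) v.
Proof. by rewrite -(smreprK v) !smscale_pi scalerA. Qed.
Lemma smscale1 : left_id 1 smscale.
Proof. by move=> v; rewrite -(smreprK v) smscale_pi scale1r. Qed.
Lemma smscaleDr : right_distributive smscale +%R.
Proof.
move=> a u v; rewrite -(smreprK v) -(smreprK u) -smpiD !smscale_pi.
by rewrite scalerDr smpiD.
Qed.
Lemma smscaleDl v : {morph smscale^~ v: a b / a + b}.
Proof. by move=> a b; rewrite -(smreprK v) !smscale_pi scalerDl smpiD. Qed.

HB.instance Definition _ := GRing.Zmodule_isLmodule.Build R smquot
  smscaleA smscale1 smscaleDr smscaleDl.

Lemma smpi_linear : linear smpi.
Proof. by move=> a x y; rewrite smpiD -smscale_pi. Qed.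

HB.instance Definition _ := GRing.isLinear.Build R V smquot _ smpi smpi_linear.

Lemma smquot_ex : exists (W : lmodType R) (q : {linear V -> W}),
  (forall y, exists x, q x = y) /\ forall x, q x = 0 <-> S x.
Proof.
exists smquot, smpi; split=> [y|x]; first by exists (smrepr y); apply: smreprK.
by rewrite -(linear0 smpi); split=> [/smpiP|Sx]; [|apply/smpiP]; rewrite subr0.
Qed.

End QuotientModule.

Section GradedQuotient.
Variable R : gradedRing.

Definition grhom_of (M N : grmod R) (f : M -> N) (lf : linear f)
    (df : forall n x, gm_comp n x -> gm_comp n (f x)) : grhom M N :=
  let F : {linear M -> N} := HB.pack f (GRing.isLinear.Build _ _ _ _ f lf) in
  @GrHom R M N F df.

Record homogeneous_submodule (M : grmod R) := HomogeneousSubmodule {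
  hs_sub :> submodule M;
  hs_homog : forall (s : seq int) (c : int -> M), uniq s ->
      (forall n, gm_comp n (c n)) -> hs_sub (\sum_(n <- s) c n) ->
      forall n, n \in s -> hs_sub (c n) }.

Variables (M : grmod R) (N : homogeneous_submodule M).

Lemma grsub_ex : exists (S : grmod R) (i : grhom S M),
  [/\ injective i, forall x, N x <-> exists z, i z = x
    & forall n z, gm_comp n (i z) -> gm_comp n z].
Proof.
have [W [i [ij iN]]] := smsub_ex N.
pose C n (z : W) := gm_comp n (i z).
have Cg : grading C.
  split=> [n|n x y|x|s c us Cc c0 n ns].
  - by rewrite /C linear0; apply: grading0 (gm_grading M) _.
  - by rewrite /C linearB; apply: gradingB (gm_grading M) _ _ _.
  - have [s [c [us Cc c0 xc]]] := grading_sum_uniq (gm_grading M) (i x).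
    have Nc n : N (c n).
      have [ns|/c0 ->] := boolP (n \in s); last exact: sm0.
      by apply: hs_homog us Cc _ _ ns; rewrite -xc; apply/iN; exists x.
    have /choice [d dP] n : exists z, i z = c n by apply/iN.
    exists s, d; split=> [n|]; first by rewrite /C dP.
    by apply: ij; rewrite xc linear_sum; apply: eq_bigr => n _; rewrite dP.
  - apply: ij; rewrite linear0.
    apply: (grading_direct (gm_grading M) us Cc _ ns).
    by rewrite -linear_sum c0 linear0.
have CZ m n (x : W) (a : R) : C m x -> gr_comp n a -> C (m + n) ((a : R^c) *: x).
  by rewrite /C linearZ /=; apply: gm_compZ.
by exists (GrMod Cg CZ), (@GrHom R (GrMod Cg CZ) M i (fun n x h => h)).
Qed.

Lemma grquot_ex : exists (Q : grmod R) (q : grhom M Q),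
  (forall y, exists x, q x = y) /\ forall x, q x = 0 <-> N x.
Proof.
have [W [q [qs qN]]] := smquot_ex N.
pose C n (y : W) := exists2 x, gm_comp n x & y = q x.
have Cg : grading C.
  split=> [n|n _ _ [x xn ->] [y yn ->]|y|s c us Cc c0 n ns].
  - by exists 0; rewrite ?linear0 //; apply: grading0 (gm_grading M) _.
  - exists (x - y); last by rewrite linearB.
    exact: gradingB (gm_grading M) _ _ _ xn yn.
  - have [x <-] := qs y; have [s [c [Cc ->]]] := grading_sum (gm_grading M) x.
    exists s, (fun n => q (c n)); split; last exact: linear_sum.
    by move=> n; exists (c n).
  - have /choice [d dP] k : exists x, gm_comp k x /\ c k = q x.
      by have [x] := Cc k; exists x.
    have : N (\sum_(k <- s) d k).
      apply/qN; apply: etrans c0; rewrite linear_sum.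
      by apply: eq_bigr => k _; rewrite (dP k).2.
    move=> /(hs_homog us (fun k => (dP k).1)) /(_ _ ns) /qN.
    by rewrite (dP n).2.
have CZ m n (x : W) (a : R) : C m x -> gr_comp n a -> C (m + n) ((a : R^c) *: x).
  move=> [y ym ->] an; exists ((a : R^c) *: y); last by rewrite linearZ.
  exact: gm_compZ.
exists (GrMod Cg CZ), (@GrHom R M (GrMod Cg CZ) q (fun n x h => ex_intro2 _ _ x h erefl)).
by split.
Qed.

End GradedQuotient.

Section HomogeneousComponents.
Variables (V : zmodType) (C : int -> V -> Prop).
Hypothesis CP : grading C.

Let dec x := cid (grading_sum_uniq CP x).
(** The decomposition is chosen arbitrarily; [hcomp_unique] shows that the components do not depend
    on the choice. *)
Definition hsupp x : seq int := projT1 (dec x).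
Definition hcomp n x : V := projT1 (cid (projT2 (dec x))) n.

Let decP x := projT2 (cid (projT2 (dec x))).

Lemma hsupp_uniq x : uniq (hsupp x).
Proof. by have [] := decP x. Qed.
Lemma hcompC n x : C n (hcomp n x).
Proof. by have [_ h _ _] := decP x; apply: h. Qed.
Lemma hcomp_out n x : n \notin hsupp x -> hcomp n x = 0.
Proof. by have [_ _ h _] := decP x; apply: h. Qed.
Lemma hcomp_sum x : x = \sum_(n <- hsupp x) hcomp n x.
Proof. by have [_ _ _ h] := decP x. Qed.

Lemma hcomp_sumw x t : uniq t -> {subset hsupp x <= t} ->
  x = \sum_(n <- t) hcomp n x.
Proof.
move=> ut st; rewrite {1}[x]hcomp_sum; apply/esym/big_int_subset => //.
  exact: hsupp_uniq.
by move=> n; apply: hcomp_out.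
Qed.

Lemma hcomp_unique x s (c : int -> V) : uniq s -> (forall n, C n (c n)) ->
  (forall n, n \notin s -> c n = 0) -> x = \sum_(n <- s) c n ->
  forall n, hcomp n x = c n.
Proof.
move=> us Cc c0 xc n.
(* [n] is added so that directness applies at [n] even if it lies in neither list. *)
pose t := undup (n :: s ++ hsupp x); have ut : uniq t by apply: undup_uniq.
have e1 : x = \sum_(n <- t) c n.
  rewrite xc; apply/esym/big_int_subset => // k ks.
  by rewrite mem_undup inE mem_cat ks orbT.
have e2 : x = \sum_(n <- t) hcomp n x.
  by apply: hcomp_sumw => // k ks; rewrite mem_undup inE mem_cat ks !orbT.
have : \sum_(k <- t) (hcomp k x - c k) = 0.
  by rewrite sumrB -e1 -e2 subrr.
move/(grading_direct CP ut (fun k => gradingB CP (@hcompC k x) (Cc k))).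
by move=> /(_ n); rewrite mem_undup inE eqxx => /(_ isT) /eqP; rewrite subr_eq0 => /eqP.
Qed.

Lemma hcomp_id n x : C n x -> hcomp n x = x.
Proof.
move=> Cx; rewrite (@hcomp_unique x [:: n] (fun k => if k == n then x else 0)) ?eqxx //.
- by move=> k; case: eqP => [->//|_]; apply: grading0 CP k.
- by move=> k; rewrite inE => /negPf ->.
- by rewrite big_seq1 eqxx.
Qed.

Lemma hcomp_neq m n x : C m x -> m != n -> hcomp n x = 0.
Proof.
move=> Cx mn; rewrite (@hcomp_unique x [:: m] (fun k => if k == m then x else 0)).
- by rewrite eq_sym (negPf mn).
- by [].
- by move=> k; case: eqP => [->//|_]; apply: grading0 CP k.
- by move=> k; rewrite inE => /negPf ->.
- by rewrite big_seq1 eqxx.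
Qed.

Lemma hcomp_eq0P x : (forall n, hcomp n x = 0) -> x = 0.
Proof. by move=> h; rewrite [x]hcomp_sum big1. Qed.

Lemma hcomp_homog n x : (forall k, k != n -> hcomp k x = 0) -> C n x.
Proof.
move=> h; rewrite [x]hcomp_sum; apply: (grading_bigsum CP) => k _.
by case: (eqVneq k n) => [->|/h ->]; [apply: hcompC|apply: grading0].
Qed.

Lemma hcompB n x y : hcomp n (x - y) = hcomp n x - hcomp n y.
Proof.
pose t := undup (hsupp x ++ hsupp y).
apply: (@hcomp_unique _ t (fun k => hcomp k x - hcomp k y)).
- exact: undup_uniq.
- by move=> k; exact: (gradingB CP (@hcompC k x) (@hcompC k y)).
- move=> k; rewrite mem_undup mem_cat negb_or => /andP[/hcomp_out -> /hcomp_out ->].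
  by rewrite subrr.
- rewrite sumrB -!hcomp_sumw ?undup_uniq // => k ks;
  by rewrite mem_undup mem_cat ks ?orbT.
Qed.

Lemma hcomp0 n : hcomp n 0 = 0.
Proof. by have := hcompB n 0 0; rewrite !subrr. Qed.

Lemma hcompD n x y : hcomp n (x + y) = hcomp n x + hcomp n y.
Proof.
have hN : hcomp n (- y) = - hcomp n y by rewrite -sub0r hcompB hcomp0 sub0r.
by rewrite -{1}[y]opprK hcompB hN opprK.
Qed.

Lemma grading_ind (P : V -> Prop) : P 0 -> (forall x y, P x -> P y -> P (x + y)) ->
  (forall n x, C n x -> P x) -> forall x, P x.
Proof.
move=> P0 PD PC x; rewrite [x]hcomp_sum; elim/big_rec: _ => // n y _ Py.
by apply: PD => //; apply: (PC n); apply: hcompC.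
Qed.

End HomogeneousComponents.

Arguments hcomp_id {V C} CP {n x} _.
Arguments hcomp_neq {V C} CP {m n x} _ _.
Arguments hcomp_unique {V C} CP {x s c} _ _ _ _ n.
Arguments hcomp_eq0P {V C} CP {x} _.
Arguments hcomp_homog {V C} CP {n x} _.
Arguments hcomp_sum {V C} CP x.
Arguments hcompD {V C} CP n x y.
Arguments hcomp0 {V C} CP n.
Arguments hcompB {V C} CP n x y.
Arguments grading_ind {V C} CP P _ _ _ x.

(** Only additivity and the degree [d] matter, so that one statement serves homomorphisms, scalars,
    edges, words and orbit maps of a homogeneous element. *)
Lemma hcomp_morph (V W : zmodType) (C : int -> V -> Prop) (D : int -> W -> Prop)
    (CP : grading C) (DP : grading D) (g : V -> W) (d : int) :
    {morph g : x y / x + y} ->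
    (forall n x, C n x -> D (n + d) (g x)) ->
  forall n x, hcomp DP (n + d) (g x) = g (hcomp CP n x).
Proof.
move=> gD gC n; have g0 : g 0 = 0 by apply: (addrI (g 0)); rewrite -gD !addr0.
elim/(@grading_ind _ _ CP) => [|x y IHx IHy|m x Cx].
- by rewrite hcomp0 g0 hcomp0.
- by rewrite gD !hcompD IHx IHy gD.
have [<-|mn] := eqVneq m n; first by rewrite !hcomp_id //; apply: gC.
rewrite (hcomp_neq CP Cx mn) g0; apply: hcomp_neq (gC _ _ Cx) _.
by apply: contra_neq mn => /addIr.
Qed.

(** * Closed modules *)

Section OperatorModules.
Variables (K : fieldType) (E : finite_graph).

(* A graded right module over the path algebra, given by the action of the
   scalars, the vertices and the edges. *)
Record opmod := OpMod {
  op_sp :> lmodType K;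
  op_comp : int -> op_sp -> Prop;
  op_v : vert E -> op_sp -> op_sp;
  op_e : edge E -> op_sp -> op_sp;
  op_gr : grading op_comp;
  op_compZ : forall n c x, op_comp n x -> op_comp n (c *: x);
  op_vlin : forall v, linear (op_v v);
  op_elin : forall e, linear (op_e e);
  op_vcomp : forall n v x, op_comp n x -> op_comp n (op_v v x);
  op_ecomp : forall n e x, op_comp n x -> op_comp (n + 1) (op_e e x);
  op_vv : forall v w x, op_v w (op_v v x) = if v == w then op_v v x else 0;
  op_v1 : forall x, \sum_v op_v v x = x;
  op_se : forall e x, op_e e (op_v (src e) x) = op_e e x;
  op_re : forall e x, op_v (rng e) (op_e e x) = op_e e x }.

Arguments op_comp {M} _ _ : rename.
Arguments op_v {M} _ _ : rename.
Arguments op_e {M} _ _ : rename.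

HB.instance Definition _ (M : opmod) v :=
  GRing.isLinear.Build K M M *:%R (@op_v M v) (@op_vlin M v).
HB.instance Definition _ (M : opmod) e :=
  GRing.isLinear.Build K M M *:%R (@op_e M e) (@op_elin M e).

Record ophom (M N : opmod) := OpHom {
  oh_fun :> M -> N;
  oh_lin : linear oh_fun;
  oh_comp : forall n x, op_comp n x -> op_comp n (oh_fun x);
  oh_v : forall v x, oh_fun (op_v v x) = op_v v (oh_fun x);
  oh_e : forall e x, oh_fun (op_e e x) = op_e e (oh_fun x) }.

HB.instance Definition _ (M N : opmod) (f : ophom M N) :=
  GRing.isLinear.Build K M N *:%R f (oh_lin f).

Lemma ophom_eq (M N : opmod) (f g : ophom M N) : f =1 g -> f = g.
Proof.
case: f g => [f f1 f2 f3 f4] [g g1 g2 g3 g4] /= /funext fg.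
move: f1 f2 f3 f4; rewrite fg => f1 f2 f3 f4.
by congr OpHom; apply: Prop_irrelevance.
Qed.

Definition ophom_id (M : opmod) : ophom M M.
Proof. by exists id. Defined.

Definition ophom_comp (M N P : opmod) (g : ophom N P) (f : ophom M N) : ophom M P.
Proof.
exists (g \o f) => [a x y|n x h|v x|e x] /=.
- by rewrite !linearP.
- exact/oh_comp/oh_comp.
- by rewrite !oh_v.
- by rewrite !oh_e.
Defined.

Lemma ophom_comp1l M N (f : ophom M N) : ophom_comp (ophom_id N) f = f.
Proof. exact: ophom_eq. Qed.
Lemma ophom_comp1r M N (f : ophom M N) : ophom_comp f (ophom_id M) = f.
Proof. exact: ophom_eq. Qed.
Lemma ophom_compA M N P Q (h : ophom P Q) (g : ophom N P) (f : ophom M N) :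
  ophom_comp h (ophom_comp g f) = ophom_comp (ophom_comp h g) f.
Proof. exact: ophom_eq. Qed.

Definition OpCat : category := Category ophom_comp1l ophom_comp1r ophom_compA.

(** The inverse respects degrees because [f] commutes with taking components and is injective: a
    stray component of [g y] would be seen in [y]. *)
Lemma ophom_iso (M N : opmod) (f : ophom M N) : injective f ->
  (forall y, exists x, f x = y) -> @is_iso OpCat M N f.
Proof.
move=> fi /choice [g fg].
have gf x : g (f x) = x by apply: fi; rewrite fg.
have glin : linear g by move=> a x y; apply: fi; rewrite fg (oh_lin f) !fg.
have gcomp n y : op_comp n y -> op_comp n (g y).
  move=> yn; apply: (hcomp_homog (op_gr M)) => k kn; apply: fi.
  have fc := @oh_comp _ _ f.
  have := @hcomp_morph M N _ _ (op_gr M) (op_gr N) f 0 (linearD f).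
  move=> /(_ _ k (g y)); rewrite addr0 fg => <-; last first.
    by move=> n' x; rewrite addr0; apply: fc.
  by rewrite (hcomp_neq (op_gr N) yn) ?linear0 // eq_sym.
have gv v x : g (op_v v x) = op_v v (g x) by apply: fi; rewrite oh_v !fg.
have ge e x : g (op_e e x) = op_e e (g x) by apply: fi; rewrite oh_e !fg.
exists (OpHom glin gcomp gv ge).
by split; apply: ophom_eq => x /=; rewrite ?gf ?fg.
Qed.

Section Words.
Variable M : opmod.
Implicit Types (x : M) (s : seq (edge E)).

Definition wact s x : M := foldl (fun x e => op_e e x) x s.

Arguments wact : simpl never.

Lemma wact_cons e s x : wact (e :: s) x = wact s (op_e e x). Proof. by []. Qed.

Lemma wact_linear s : linear (wact s).
Proof. by elim: s => //= e s IH a x y; rewrite !wact_cons linearP IH. Qed.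

HB.instance Definition _ s := GRing.isLinear.Build K M M *:%R (wact s) (wact_linear s).

Lemma op_eZ e c x : op_e e (c *: x) = c *: op_e e x. Proof. exact: linearZ. Qed.
Lemma op_vZ v c x : op_v v (c *: x) = c *: op_v v x. Proof. exact: linearZ. Qed.
Lemma op_e_sum e (I : Type) (r : seq I) (P : pred I) (F : I -> M) :
  op_e e (\sum_(i <- r | P i) F i) = \sum_(i <- r | P i) op_e e (F i).
Proof. exact: linear_sum. Qed.
Lemma op_v_sum v (I : Type) (r : seq I) (P : pred I) (F : I -> M) :
  op_v v (\sum_(i <- r | P i) F i) = \sum_(i <- r | P i) op_v v (F i).
Proof. exact: linear_sum. Qed.
Lemma wact0 s : wact s 0 = 0. Proof. exact: linear0. Qed.
Lemma wactD s x y : wact s (x + y) = wact s x + wact s y. Proof. exact: linearD. Qed.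
Lemma wactZ s c x : wact s (c *: x) = c *: wact s x. Proof. exact: linearZ. Qed.

Lemma wact_cat s t x : wact (s ++ t) x = wact t (wact s x).
Proof. by rewrite /wact foldl_cat. Qed.

Lemma wact_rcons s e x : wact (rcons s e) x = op_e e (wact s x).
Proof. by rewrite /wact foldl_rcons. Qed.

Lemma wact_comp n s x : op_comp n x -> op_comp (n + (size s)%:Z) (wact s x).
Proof.
elim: s n x => [|e s IH] n x xn; first by rewrite addr0.
rewrite wact_cons /=.
by have := IH _ _ (op_ecomp e xn); rewrite -addrA.
Qed.

Lemma op_ev v e x : op_e e (op_v v x) = if v == src e then op_e e x else 0.
Proof. by rewrite -op_se op_vv; case: eqP => [->|_]; rewrite ?op_se ?linear0. Qed.

Lemma wact_v v e s x :
  wact (e :: s) (op_v v x) = if v == src e then wact (e :: s) x else 0.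
Proof. by rewrite !wact_cons op_ev; case: ifP => // _; rewrite linear0. Qed.

Lemma wact_not_path v s x : ~~ is_path v s -> wact s (op_v v x) = 0.
Proof.
elim: s v x => //= e s IH v x; rewrite wact_cons op_ev eq_sym.
case: eqP => [_|_] /=; last by rewrite linear0.
by move=> h; rewrite -op_re IH.
Qed.

Lemma wact_end v s x : is_path v s ->
  op_v (last v (map rng s)) (wact s (op_v v x)) = wact s (op_v v x).
Proof.
elim: s v x => /= [|e s IH] v x; first by rewrite op_vv eqxx.
rewrite wact_cons => /andP[/eqP sv pe]; by rewrite op_ev sv eqxx -op_re IH.
Qed.

End Words.

Arguments wact : simpl never.

Section HomTheory.
Variables (M N : opmod) (f : ophom M N).
Lemma oh0 : f 0 = 0. Proof. exact: linear0. Qed.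
Lemma ohD x y : f (x + y) = f x + f y. Proof. exact: linearD. Qed.
Lemma ohB x y : f (x - y) = f x - f y. Proof. exact: linearB. Qed.
Lemma ohZ c x : f (c *: x) = c *: f x. Proof. exact: linearZ. Qed.
Lemma oh_sum (I : Type) (r : seq I) (P : pred I) (F : I -> M) :
  f (\sum_(i <- r | P i) F i) = \sum_(i <- r | P i) f (F i).
Proof. exact: linear_sum. Qed.
End HomTheory.

Lemma oh_wact (M N : opmod) (f : ophom M N) s x : f (wact s x) = wact s (f x).
Proof. by elim: s x => //= e s IH x; rewrite !wact_cons IH oh_e. Qed.

Definition closed (M : opmod) : Prop := forall y : edge E -> M,
  (forall e, op_v (rng e) (y e) = y e) ->
  exists x : M, (forall e, op_e e x = y e) /\
    forall x', (forall e, op_e e x' = y e) -> x' = x.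

Definition Cl : category := fullsub (C := OpCat) closed.

Section Closed.
Variable M : opmod.
Hypothesis Mc : closed M.

Lemma closed_inj (x : M) : (forall e, op_e e x = 0) -> x = 0.
Proof.
move=> x0; have [z [zP zU]] := Mc (fun e => linear0 (op_v (rng e))).
by rewrite (zU x) // [RHS](zU 0) // => e; rewrite linear0.
Qed.

Lemma closed_inj_words k (x : M) : (forall s, size s = k -> wact s x = 0) -> x = 0.
Proof.
elim: k x => [|k IH] x h; first exact: (h [::]).
by apply: closed_inj => e; apply: IH => s sk; apply: (h (e :: s)); rewrite /= sk.
Qed.

(** Closedness itself mentions no degrees. A component of [x] in another degree is killed by every
    edge, hence zero. *)
Lemma closed_homog n (x : M) : (forall e, op_comp (n + 1) (op_e e x)) -> op_comp n x.
Proof.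
move=> h; apply: (hcomp_homog (op_gr M)) => k kn; apply: closed_inj => e.
rewrite -(hcomp_morph (op_gr M) (op_gr M) (linearD (op_e e)) (fun n => @op_ecomp M n e)).
by apply: hcomp_neq (h e) _; rewrite eq_sym; apply: contra_neq kn => /addIr.
Qed.

Lemma closed_homog_words k n (x : M) :
  (forall s, size s = k -> op_comp (n + k%:Z) (wact s x)) -> op_comp n x.
Proof.
elim: k n x => [|k IH] n x h; first by have := h [::] erefl; rewrite addr0.
apply: closed_homog => e; apply: IH => s sk.
by rewrite -addrA -PoszD add1n; apply: (h (e :: s)); rewrite /= sk.
Qed.

Definition composable (s : seq (edge E)) : bool :=
  if s is e :: _ then is_path (src e) s else true.

(** Closedness iterated [k] times. The two hypotheses are the evident constraints on the family of
    products of one element with all words: it vanishes on words that are not paths, and each value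
    lies at the range of the last edge. *)
Lemma closed_words k (y : seq (edge E) -> M) :
  (forall s, size s = k -> ~~ composable s -> y s = 0) ->
  (forall s e, (size s).+1 = k -> op_v (rng e) (y (rcons s e)) = y (rcons s e)) ->
  exists x : M, forall s, size s = k -> wact s x = y s.
Proof.
elim: k y => [|k IH] y y0 yr; first by exists (y [::]) => s /size0nil ->.
have /choice [z zP] e : exists x : M, forall s, size s = k -> wact s x = y (e :: s).
  apply: IH => [s sk sN|s f sk].
    apply: y0; rewrite /= ?sk //; case: s sN {sk} => //= f s.
    by rewrite !eqxx /= => /negPf ->; rewrite andbF.
  by rewrite -rcons_cons yr //= sk.
have zr e : op_v (rng e) (z e) = z e.
  apply/eqP; rewrite -subr_eq0; apply/eqP; apply: (@closed_inj_words k) => s sk.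
  rewrite linearB /=; case: s sk => [|f s] sk.
    have := zP e [::] sk; rewrite /wact /= => ->.
    by have /= := yr [::] e; rewrite -sk => /(_ erefl) ->; rewrite subrr.
  (* If [f] does not start at the range of [e], the first term vanishes, and so does the second
     since [e :: f :: s] is not composable. *)
  rewrite wact_v zP //; case: eqP => [_|rs]; first by rewrite subrr.
  rewrite y0 ?subrr //=; first by congr S.
  have /negPf -> : src f != rng e by rewrite eq_sym; apply/eqP.
  by rewrite andbF.
have [x [xP _]] := Mc zr; exists x => -[|e s] //= [sk].
by rewrite wact_cons xP zP.
Qed.

End Closed.
End OperatorModules.

Arguments wact : simpl never.

Arguments op_comp {K E M} _ _ : rename.
Arguments op_v {K E M} _ _ : rename.
Arguments op_e {K E M} _ _ : rename.

(** * Modules assembled from their homogeneous components *)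

Section Families.
Variables (K : fieldType) (E : finite_graph).

(* A graded module given by its components [fam_W n], all realised inside a
   single vector space. *)
Record fam := Fam {
  fam_sp : lmodType K;
  fam_W : int -> fam_sp -> Prop;
  fam_v : vert E -> fam_sp -> fam_sp;
  fam_e : int -> edge E -> fam_sp -> fam_sp;
  fam_0 : forall n, fam_W n 0;
  fam_P : forall n a x y, fam_W n x -> fam_W n y -> fam_W n (a *: x + y);
  fam_vlin : forall v, linear (fam_v v);
  fam_elin : forall n e, linear (fam_e n e);
  fam_vW : forall n v x, fam_W n x -> fam_W n (fam_v v x);
  fam_eW : forall n e x, fam_W n x -> fam_W (n + 1) (fam_e n e x);
  fam_vv : forall n v w x, fam_W n x ->
    fam_v w (fam_v v x) = if v == w then fam_v v x else 0;
  fam_v1 : forall n x, fam_W n x -> \sum_v fam_v v x = x;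
  fam_se : forall n e x, fam_W n x -> fam_e n e (fam_v (src e) x) = fam_e n e x;
  fam_re : forall n e x, fam_W n x -> fam_v (rng e) (fam_e n e x) = fam_e n e x }.

Variable F : fam.
Local Notation W := (fam_W (f := F)).

HB.instance Definition _ v := GRing.isLinear.Build K (fam_sp F) (fam_sp F) *:%R
  (@fam_v F v) (@fam_vlin F v).
HB.instance Definition _ n e := GRing.isLinear.Build K (fam_sp F) (fam_sp F) *:%R
  (@fam_e F n e) (@fam_elin F n e).

Definition fin_fam (x : int -> fam_sp F) : Prop :=
  (exists s : seq int, forall n, n \notin s -> x n = 0) /\ forall n, W n (x n).

Lemma fin_fam0 : fin_fam 0.
Proof. by split=> [|n]; [exists [::]|apply: fam_0]. Qed.

Lemma fin_famP a x y : fin_fam x -> fin_fam y -> fin_fam (a *: x + y).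
Proof.
move=> [[s sx] Wx] [[t ty] Wy]; split=> [|n]; last exact: fam_P.
exists (s ++ t) => n; rewrite mem_cat negb_or => /andP[/sx xn /ty yn].
by rewrite -[LHS]/(a *: x n + y n) xn yn scaler0 addr0.
Qed.

Definition fam_sm : submodule (int -> fam_sp F : lmodType K) :=
  Submodule fin_fam0 fin_famP.

Definition fam_car : Type := smsub fam_sm.
HB.instance Definition _ := GRing.Lmodule.on fam_car.

Definition fproj (x : fam_car) : int -> fam_sp F := \val x.

Lemma fprojP x : fin_fam (fproj x).
Proof. by apply/asboolP; exact: (valP x). Qed.

Definition fmk x (h : fin_fam x) : fam_car :=
  exist (fun x => x \in smb fam_sm) x (introT (asboolP _) h).

Lemma fmkK x (h : fin_fam x) : fproj (fmk h) = x.
Proof. by []. Qed.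

Lemma fproj_inj x y : (forall n, fproj x n = fproj y n) -> x = y.
Proof. by move=> /funext h; apply: val_inj. Qed.

Lemma fprojD x y n : fproj (x + y) n = fproj x n + fproj y n.
Proof. by []. Qed.
Lemma fprojZ a x n : fproj (a *: x) n = a *: fproj x n.
Proof. by []. Qed.
Lemma fproj0 n : fproj 0 n = 0.
Proof. by []. Qed.

Lemma fproj_sum (I : Type) (r : seq I) (P : pred I) (f : I -> fam_car) n :
  fproj (\sum_(i <- r | P i) f i) n = \sum_(i <- r | P i) fproj (f i) n.
Proof. by elim/big_rec2: _ => // i y1 y2 _ <-. Qed.

Lemma fv_fin v (x : fam_car) : fin_fam (fun n => fam_v v (fproj x n)).
Proof.
have [[s sx] Wx] := fprojP x; split=> [|n]; last exact: fam_vW.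
by exists s => n /sx ->; rewrite linear0.
Qed.

Lemma fe_fin e (x : fam_car) :
  fin_fam (fun n => fam_e (n - 1) e (fproj x (n - 1))).
Proof.
have [[s sx] Wx] := fprojP x; split=> [|n]; last first.
  by rewrite -[n in W n](subrK 1); apply: fam_eW.
exists [seq n + 1 | n <- s] => n ns; rewrite sx ?linear0 //.
by apply: contraNN ns => h; apply/mapP; exists (n - 1); rewrite ?subrK.
Qed.

Definition fcar_v v x : fam_car := fmk (fv_fin v x).
Definition fcar_e e x : fam_car := fmk (fe_fin e x).
Definition fcar_comp n (x : fam_car) : Prop := forall k, k != n -> fproj x k = 0.

Lemma fin1_fin n w : W n w -> fin_fam (fun k => if k == n then w else 0).
Proof.
move=> h; split=> [|k]; last by case: eqP => [->|_] //; apply: fam_0.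
by exists [:: n] => k; rewrite inE => /negPf ->.
Qed.

Definition fin1 n w (h : W n w) : fam_car := fmk (fin1_fin h).

Lemma fcar_grading : grading fcar_comp.
Proof.
split=> [n k _|n x y hx hy k kn|x|s c us Cc c0 n ns].
- by [].
- by rewrite -scaleN1r fprojD fprojZ hx // hy // scaler0 addr0.
- have [[s sx] Wx] := fprojP x.
  exists (undup s), (fun n => fin1 (Wx n)); split.
    by move=> n k kn; rewrite fmkK (negPf kn).
  apply: fproj_inj => k; rewrite fproj_sum.
  under eq_bigr do rewrite fmkK.
  have [ks|ks] := boolP (k \in s); last first.
    rewrite sx // big1_seq // => i; rewrite mem_undup => /= is_.
    by case: eqP => // ki; rewrite ki is_ in ks.
  rewrite (bigD1_seq k) ?undup_uniq ?mem_undup //= eqxx big1 ?addr0 // => i ik.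
  by rewrite eq_sym (negPf ik).
- apply: fproj_inj => k; have [->|kn] := eqVneq k n; last by rewrite Cc.
  have := congr1 (fun x => fproj x n) c0; rewrite fproj_sum fproj0.
  by rewrite (bigD1_seq n) //= big1 ?addr0 // => i ni; rewrite Cc // eq_sym.
Qed.

Definition fam_op : opmod K E.
Proof.
apply: (@OpMod K E fam_car fcar_comp fcar_v fcar_e fcar_grading).
- by move=> n c x hx k kn; rewrite fprojZ hx // scaler0.
- by move=> v a x y; apply: fproj_inj => n; rewrite fprojD fprojZ !fmkK linearP.
- by move=> e a x y; apply: fproj_inj => n; rewrite fprojD fprojZ !fmkK linearP.
- by move=> n v x hx k kn; rewrite fmkK hx // linear0.
- move=> n e x hx k kn; rewrite fmkK hx ?linear0 //.
  by apply: contra_neq kn => <-; rewrite subrK.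
- move=> v w x; apply: fproj_inj => n; rewrite !fmkK.
  by rewrite (fam_vv _ _ ((fprojP x).2 n)); case: ifP.
- move=> x; apply: fproj_inj => n; rewrite fproj_sum.
  by under eq_bigr do rewrite fmkK; apply: fam_v1 ((fprojP x).2 n).
- by move=> e x; apply: fproj_inj => n; rewrite !fmkK (fam_se _ ((fprojP x).2 _)).
- by move=> e x; apply: fproj_inj => n; rewrite !fmkK (fam_re _ ((fprojP x).2 _)).
Defined.

Lemma fproj_e (x : fam_op) e n :
  fproj (op_e e x : fam_car) (n + 1) = fam_e n e (fproj (x : fam_car) n).
Proof.
by rewrite -[LHS]/(fam_e (n + 1 - 1) e (fproj (x : fam_car) (n + 1 - 1))) addrK.
Qed.

Lemma fproj_v (x : fam_op) v n :
  fproj (op_v v x : fam_car) n = fam_v v (fproj (x : fam_car) n).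
Proof. by []. Qed.

(** Degreewise solutions form a finitely supported family because there are finitely many edges:
    outside the supports of the [y e], lowered by one, uniqueness forces the solution 0. *)
Lemma fam_op_closed :
  (forall n (y : edge E -> fam_sp F), (forall e, W (n + 1) (y e)) ->
    (forall e, fam_v (rng e) (y e) = y e) ->
    exists x, [/\ W n x, forall e, fam_e n e x = y e &
      forall x', W n x' -> (forall e, fam_e n e x' = y e) -> x' = x]) ->
  closed fam_op.
Proof.
move=> h y yr.
have yr' n e : fam_v (rng e) (fproj (y e) n) = fproj (y e) n.
  exact: (congr1 (fun z => fproj z n) (yr e)).
have /choice [x xP] n := h n _ (fun e => (fprojP (y e)).2 (n + 1)) (yr' (n + 1)).
have /choice [s sP] e : exists s : seq int, forall n, n \notin s -> fproj (y e) n = 0.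
  by have [[s]] := fprojP (y e); exists s.
have xf : fin_fam x.
  split=> [|n]; last by have [] := xP n.
  exists [seq n - 1 | n <- flatten [seq s e | e <- enum (edge E)]] => n ns.
  have [_ _ xU] := xP n; apply/esym/xU => [|e]; first exact: fam_0.
  rewrite linear0 sP //; apply: contraNN ns => ns.
  apply/mapP; exists (n + 1); last by rewrite addrK.
  by apply/flatten_mapP; exists e; rewrite ?mem_enum.
exists (fmk xf); split=> [e|x' x'P]; apply: fproj_inj => n; rewrite !fmkK.
  by have [_ -> _] := xP (n - 1); rewrite subrK.
have [_ _ xU] := xP n; apply: xU => [|e]; first exact: (fprojP x').2.
by have := congr1 (fun z => fproj z (n + 1)) (x'P e); rewrite fmkK addrK.
Qed.

End Families.

Section FamilyMap.
Variables (K : fieldType) (E : finite_graph) (F G : fam K E).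
Variable g : fam_sp F -> fam_sp G.
Hypothesis glin : linear g.
Hypothesis gW : forall n x, fam_W n x -> fam_W n (g x).
Hypothesis gv : forall n v x, fam_W n x -> g (fam_v v x) = fam_v v (g x).
Hypothesis ge : forall n e x, fam_W n x -> g (fam_e n e x) = fam_e n e (g x).

Let g0 : g 0 = 0.
Proof. by have := glin (-1) 0 0; rewrite !scaleN1r !addNr. Qed.

Let gfin (x : fam_op F) : fin_fam (fun n => g (fproj x n)).
Proof.
have [[s sx] Wx] := fprojP x; split=> [|n]; last exact: gW.
by exists s => n /sx ->.
Qed.

Definition fam_map : ophom (fam_op F) (fam_op G).
Proof.
apply: (@OpHom _ _ (fam_op F) (fam_op G) (fun x => fmk (gfin x))).
- by move=> a x y; apply: fproj_inj => n; rewrite fprojD fprojZ !fmkK -glin.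
- by move=> n x hx k kn; rewrite fmkK hx.
- move=> v x; apply: fproj_inj => n; rewrite !fmkK.
  exact: gv ((fprojP x).2 n).
- move=> e x; apply: fproj_inj => n; rewrite !fmkK.
  exact: ge ((fprojP x).2 _).
Defined.

Lemma fproj_map x n : fproj (fam_map x : fam_op G) n = g (fproj x n).
Proof. by []. Qed.

End FamilyMap.

(** * Graded modules over the path algebra *)

Section RightAction.
Variables (R : gradedRing) (M : grmod R).
Implicit Types (x y : M) (a b : R).

Definition ract x a : M := (a : R^c) *: x.

Lemma ractA x a b : ract (ract x a) b = ract x (a * b).
Proof. by rewrite /ract scalerA. Qed.
Lemma ract1 x : ract x 1 = x. Proof. exact: scale1r. Qed.
Lemma ract0 x : ract x 0 = 0. Proof. exact: scale0r. Qed.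
Lemma ract0l a : ract 0 a = 0. Proof. exact: scaler0. Qed.
Lemma ractDl x y a : ract (x + y) a = ract x a + ract y a.
Proof. exact: scalerDr. Qed.
Lemma ractDr x a b : ract x (a + b) = ract x a + ract x b.
Proof. exact: scalerDl. Qed.
Lemma ract_suml (I : Type) (r : seq I) (P : pred I) (F : I -> M) a :
  ract (\sum_(i <- r | P i) F i) a = \sum_(i <- r | P i) ract (F i) a.
Proof. exact: scaler_sumr. Qed.
Lemma ract_sumr (I : Type) (r : seq I) (P : pred I) (F : I -> R) x :
  ract x (\sum_(i <- r | P i) F i) = \sum_(i <- r | P i) ract x (F i).
Proof. exact: scaler_suml. Qed.
Lemma ract_comp m n x a : gm_comp m x -> gr_comp n a -> gm_comp (m + n) (ract x a).
Proof. exact: gm_compZ. Qed.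

End RightAction.

Lemma grhom_ract (R : gradedRing) (M N : grmod R) (f : grhom M N) x a :
  f (ract x a) = ract (f x) a.
Proof. exact: linearZ. Qed.

Section PathAlgebraGenerators.
Variables (K : fieldType) (E : finite_graph).
Local Notation P := (path_algebra K E).

Lemma epath_proof (e : edge E) : is_path (src e) [:: e].
Proof. by rewrite /= eqxx. Qed.

Definition epath (e : edge E) : gpath E :=
  exist (fun p => is_path p.1 p.2) (src e, [:: e]) (epath_proof e).

Definition pK (c : K) : P := c *: (1 : P).
Definition pV (v : vert E) : P := << vpath v >>.
Definition pE (e : edge E) : P := << epath e >>.
Definition pP (p : gpath E) : P := << p >>.

Lemma pK_l c (a : P) : pK c * a = c *: a.
Proof. by apply: etrans (pa_mulZl c _ a) _; congr (_ *: _); exact: pa_mul1l. Qed.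
Lemma pK_r c (a : P) : a * pK c = c *: a.
Proof. by apply: etrans (pa_mulZr c a _) _; congr (_ *: _); exact: pa_mul1r. Qed.

Lemma pa_scaleAl c (a b : P) : c *: (a * b) = (c *: a) * b.
Proof. by rewrite -!pK_l mulrA. Qed.
Lemma pa_scaleAr c (a b : P) : c *: (a * b) = a * (c *: b).
Proof. by rewrite -!pK_r mulrA. Qed.

Lemma pP_mul p q : pP p * pP q = if prng p == psrc q then pP (pconcat p q) else 0.
Proof. exact: path_algebraU. Qed.

Lemma pP_mul1 p q : prng p = psrc q -> pP p * pP q = pP (pconcat p q).
Proof. by move=> h; apply: etrans (pP_mul p q) _; case: eqP. Qed.

Lemma pP_mul0 p q : prng p <> psrc q -> pP p * pP q = 0.
Proof. by move=> h; apply: etrans (pP_mul p q) _; case: eqP. Qed.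

Lemma pV_mul v w : pV v * pV w = if v == w then pV v else 0.
Proof.
case: (v =P w) => [<-|vw]; last exact: (@pP_mul0 (vpath v) (vpath w)).
apply: etrans (@pP_mul1 (vpath v) (vpath v) erefl) _.
apply: congr1; exact: (pconcat1p (vpath v)).
Qed.

Lemma pV_path p : pV (psrc p) * pP p = pP p.
Proof.
apply: etrans (@pP_mul1 (vpath (psrc p)) p erefl) _.
by apply: congr1; apply: pconcat1p.
Qed.

Lemma pV_pE e : pV (src e) * pE e = pE e.
Proof. exact: (pV_path (epath e)). Qed.

Lemma pE_pV e : pE e * pV (rng e) = pE e.
Proof.
apply: etrans (@pP_mul1 (epath e) (vpath (rng e)) erefl) _.
by apply: congr1; apply: (pconcatp1 (epath e)).
Qed.

Lemma pP_cons (p : gpath E) e s (h : pedges p = e :: s) :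
  exists q : gpath E, [/\ psrc q = rng e, pedges q = s, src e = psrc p & pP p = pE e * pP q].
Proof.
case: p h => [[v t] pt] /= h; rewrite /pedges /= in h; subst t.
have /andP[/eqP sv ps] := pt.
pose q : gpath E := exist (fun p => is_path p.1 p.2) (rng e, s) ps.
exists q; split=> //; apply/esym; apply: etrans (@pP_mul1 (epath e) q erefl) _.
apply: congr1; apply: val_inj; rewrite val_pconcat //.
by rewrite /psrc /pedges /= sv.
Qed.

Lemma pP_nil (p : gpath E) : pedges p = [::] -> pP p = pV (psrc p).
Proof.
case: p => [[v s] ps]; rewrite /pedges /= => h; subst s.
by congr pP; apply: val_inj.
Qed.

Lemma pE_comp e : gr_comp (g := path_gralgebra K E) 1 (pE e).
Proof. exact: (@homogU K _ (@plength E) (epath e)). Qed.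
Lemma pV_comp v : gr_comp (g := path_gralgebra K E) 0 (pV v).
Proof. exact: (@homogU K _ (@plength E) (vpath v)). Qed.
Lemma pK_comp c : gr_comp (g := path_gralgebra K E) 0 (pK c).
Proof. by apply: homogZ; apply: pa_comp1. Qed.

End PathAlgebraGenerators.

Lemma wact_v_cons (K : fieldType) (E : finite_graph) (O : opmod K E) e s (x : O) :
  wact (e :: s) (op_v (src e) x) = wact s (op_v (rng e) (op_e e x)).
Proof. by rewrite wact_cons op_se op_re. Qed.

Lemma oh_pathact (K : fieldType) (E : finite_graph) (M N : opmod K E)
  (f : ophom M N) s v x : f (wact s (op_v v x)) = wact s (op_v v (f x)).
Proof. by rewrite oh_wact oh_v. Qed.

Section PathModules.
Variables (K : fieldType) (E : finite_graph).
Local Notation P := (path_gralgebra K E).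

Section Underlying.
Variable M : grmod P.

Definition ucar : Type := M.
HB.instance Definition _ := GRing.Zmodule.on ucar.

Definition uscale (c : K) (x : ucar) : ucar := ract (x : M) (pK E c : P).

Lemma uscaleA a b v : uscale a (uscale b v) = uscale (a * b) v.
Proof.
rewrite /uscale ractA; congr ract.
by apply: etrans (pK_l _ _) _; rewrite scalerA mulrC.
Qed.
Lemma uscale1 : left_id 1 uscale.
Proof. by move=> x; rewrite /uscale /pK scale1r ract1. Qed.
Lemma uscaleDr : right_distributive uscale +%R.
Proof. by move=> a x y; apply: ractDl. Qed.
Lemma uscaleDl v : {morph uscale^~ v: a b / a + b}.
Proof. by move=> a b; rewrite -[RHS]ractDr /uscale /pK scalerDl. Qed.

HB.instance Definition _ := GRing.Zmodule_isLmodule.Build K ucar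
  uscaleA uscale1 uscaleDr uscaleDl.

Definition pop : opmod K E.
Proof.
apply: (@OpMod K E ucar (fun n x => gm_comp n (x : M))
  (fun v x => ract (x : M) (pV K v : P)) (fun e x => ract (x : M) (pE K e : P))).
- exact: (gm_grading M).
- by move=> n c x xn; have := @ract_comp _ M n 0 x _ xn (@pK_comp K E c); rewrite addr0.
- move=> v a x y; rewrite ractDl; congr (_ + _).
  apply: etrans (ractA _ _ _) _; apply: etrans (esym (ractA _ _ _)); congr ract.
  exact: etrans (pK_l _ _) (esym (pK_r _ _)).
- move=> e a x y; rewrite ractDl; congr (_ + _).
  apply: etrans (ractA _ _ _) _; apply: etrans (esym (ractA _ _ _)); congr ract.
  exact: etrans (pK_l _ _) (esym (pK_r _ _)).
- by move=> n v x xn; have := @ract_comp _ M n 0 x _ xn (@pV_comp K E v); rewrite addr0.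
- by move=> n e x xn; exact: (@ract_comp _ M n 1 x _ xn (@pE_comp K E e)).
- move=> v w x; rewrite ractA; apply: etrans (congr1 (ract (x : M)) (pV_mul K v w)) _.
  by case: ifP => // _; apply: ract0.
- move=> x; apply: etrans (esym (ract_sumr _ _ _ _)) _; exact: ract1.
- by move=> e x; rewrite ractA; apply: congr1; apply: pV_pE.
- by move=> e x; rewrite ractA; apply: congr1; apply: pE_pV.
Defined.

Lemma pop_path (x : pop) (p : gpath E) :
  ract (x : M) (pP K p : P) = wact (pedges p) (op_v (psrc p) x).
Proof.
move: {2}(pedges p) (erefl (pedges p)) => s; elim: s p x => [|e s IH] p x ps.
  by rewrite ps; exact: (congr1 (ract (x : M)) (pP_nil K ps)).
have [q [qr qs sp pq]] := pP_cons K ps.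
apply: etrans (congr1 (ract (x : M)) pq) _; apply: etrans (esym (ractA _ _ _)) _.
apply: etrans (IH q _ qs) _; rewrite qs qr ps -sp.
exact: (esym (@wact_v_cons K E pop e s x)).
Qed.

End Underlying.

Definition pop_hom (M N : grmod P) (f : grhom M N) : ophom (pop M) (pop N).
Proof.
apply: (@OpHom _ _ (pop M) (pop N) (f : M -> N)).
- by move=> a x y; rewrite linearD; congr (_ + _); apply: grhom_ract.
- exact: grhom_deg.
- by move=> v x; apply: grhom_ract.
- by move=> e x; apply: grhom_ract.
Defined.

Lemma pop_hom_id (M : grmod P) : pop_hom (grhom_id M) = ophom_id (pop M).
Proof. exact: ophom_eq. Qed.

Lemma pop_hom_comp (M N Q : grmod P) (g : grhom N Q) (f : grhom M N) :
  pop_hom (grhom_comp g f) = ophom_comp (pop_hom g) (pop_hom f).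
Proof. exact: ophom_eq. Qed.

(** Paths are products of a vertex and edges, so commuting with scalars, vertices and edges gives
    commutation with all of the path algebra. *)
Lemma pop_full (M N : grmod P) (f : ophom (pop M) (pop N)) :
  exists g : grhom M N, forall x, g x = f x.
Proof.
have fa (a : path_algebra K E) (x : pop M) :
    f (ract (x : M) (a : P)) = ract (f x : N) (a : P).
  elim/malg_ind: a => [|a b IHa IHb|c p].
  - by apply: etrans (congr1 f (ract0 _)) _; rewrite linear0; apply/esym/ract0.
  - apply: etrans (congr1 f (ractDr _ _ _)) _; apply: etrans (linearD f _ _) _.
    exact: etrans (f_equal2 +%R IHa IHb) (esym (ractDr _ _ _)).
  - have e (Q : grmod P) (y : Q) : ract y (c *: << p >> : P)
    = ract (ract y (pP K p : P)) (pK E c : P).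
      by rewrite ractA; apply: congr1; apply/esym/pK_r.
    apply: etrans (congr1 f (e M x)) _; apply: etrans (esym (e N (f x))).
    apply: etrans (ohZ f c (ract (x : M) (pP K p : P) : pop M)) _.
    apply: (congr1 (fun z : pop N => c *: z)).
    apply: etrans (congr1 f (pop_path x p)) _.
    exact: etrans (oh_pathact f _ _ x) (esym (pop_path (f x) p)).
have fl : linear (f : M -> N).
  move=> a x y; apply: etrans (linearD f _ _) _; congr (_ + _); exact: fa.
by exists (grhom_of fl (@oh_comp _ _ _ _ f)).
Qed.

Section Realisation.
Variable O : opmod K E.

Definition rcar : Type := O.
HB.instance Definition _ := GRing.Zmodule.on rcar.

Definition pathact (x : O) (p : gpath E) : O := wact (pedges p) (op_v (psrc p) x).

Definition rscale (a : P^c) (x : rcar) : rcar :=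
  lin_ext (pathact x) (a : {malg K[gpath E]}).

Lemma pathact_mul x p q : rscale (pP K q : P) (pathact x p : rcar)
  = rscale (pP K p * pP K q : P) x.
Proof.
rewrite /rscale; apply: etrans (lin_extU _ q) _.
have [pq|pq] := eqVneq (prng p) (psrc q).
  apply: esym; apply: etrans (congr1 (lin_ext _) (pP_mul1 K pq)) _.
  apply: etrans (lin_extU _ _) _; rewrite /pathact psrc_pconcat //.
  rewrite {1}/pedges val_pconcat //= wact_cat -pq.
  by rewrite wact_end //; case: (p).
apply: esym; apply: etrans (congr1 (lin_ext _) (pP_mul0 K (elimN eqP pq))) _.
rewrite linear0 /pathact -(wact_end x (valP p)) -/(prng p) op_vv (negPf pq).
by rewrite linear0.
Qed.

Lemma rscaleDr : right_distributive rscale +%R.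
Proof.
move=> a x y; rewrite /rscale -[RHS]lin_extD; apply: lin_ext_eqr => p.
by rewrite /pathact !linearD.
Qed.

Lemma rscaleZr c a (x : rcar) : rscale a (c *: (x : O)) = c *: (rscale a x : O).
Proof.
rewrite /rscale -[RHS]lin_extZ; apply: lin_ext_eqr => p.
by rewrite /pathact !linearZ.
Qed.

Lemma rscale1 : left_id 1 rscale.
Proof.
move=> x; rewrite /rscale; apply: etrans (linear_sum _ _ _ _) _.
apply: etrans (op_v1 x); apply: eq_bigr => v _; exact: lin_extU.
Qed.

Lemma rscaleDl v : {morph rscale^~ v: a b / a + b}.
Proof. by move=> a b; apply: linearD. Qed.

Lemma rscaleZl c (z : path_algebra K E) (y : rcar) :
  rscale (c *: z : P) y = c *: (rscale (z : P) y : O).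
Proof. by apply: linearZ. Qed.

Lemma rscaleA (a b : P^c) v : rscale a (rscale b v) = rscale (a * b) v.
Proof.
(* The product of the converse ring is the product of the path algebra in the other order. *)
rewrite -[(a * b : P^c)]/((b : P) * (a : P)).
move: a b => b a; elim/malg_ind: (a : path_algebra K E) => [|a1 a2 h1 h2|c p].
- rewrite mul0r /rscale !linear0.
  by apply: etrans (lin_ext_eqr (h' := fun=> 0) _ _) _ => [p|]; rewrite ?/pathact ?linear0 //
    unlock big1 // => t _; rewrite scaler0.
- apply: etrans (congr1 (rscale b) (rscaleDl v a1 a2)) _.
  rewrite mulrDl; apply: etrans (rscaleDr _ _ _) _.
  exact: etrans (f_equal2 +%R h1 h2) (esym (rscaleDl v _ _)).
elim/malg_ind: (b : path_algebra K E) => [|b1 b2 h1 h2|d q].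
- by rewrite mulr0 /rscale !linear0.
- rewrite mulrDr; apply: etrans (rscaleDl _ b1 b2) _.
  exact: etrans (f_equal2 +%R h1 h2) (esym (rscaleDl v _ _)).
have rZ := rscaleZl.
have e1 : rscale (c *: << p >> : P) v = c *: (pathact v p).
  exact: etrans (rZ c << p >> v) (congr1 (fun z : O => c *: z) (lin_extU _ p)).
have e2 : (c *: << p >> : path_algebra K E) * (d *: << q >>)
   = d *: (c *: (pP K p * pP K q)) :> path_algebra K E.
  apply: etrans (esym (pa_scaleAr _ _ _)) _; congr (_ *: _).
  exact: esym (pa_scaleAl _ _ _).
apply: etrans (congr1 (rscale (d *: << q >> : P)) e1) _.
apply: etrans (congr1 (fun z : path_algebra K E => rscale (z : P) v) (esym e2)).
apply: etrans (rscaleZr _ _ _) _.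
apply: etrans (congr1 (fun z : O => c *: z) (etrans (rZ d (pP K q) (pathact v p))
  (congr1 (fun z : O => d *: z) (pathact_mul v p q)))) _.
apply: etrans (esym (rZ d _ v)).
apply: etrans (congr1 (fun z : O => d *: z) (esym (rZ c _ v))).
have gen (x : O) : c *: (d *: x) = d *: (c *: x) by rewrite !scalerA mulrC.
exact: gen.
Qed.

HB.instance Definition _ := GRing.Zmodule_isLmodule.Build P^c rcar
  rscaleA rscale1 rscaleDr rscaleDl.

Lemma rcompZ m n (x : rcar) (a : P) :
  op_comp m (x : O) -> gr_comp n a -> op_comp (m + n) (((a : P^c) *: x : rcar) : O).
Proof.
move=> xm an; rewrite -[(a : P^c) *: x]/(rscale a x) /rscale unlock.
apply: (grading_bigsum (op_gr O)) => p _.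
have [->|/an <-] := eqVneq (a : {malg K[gpath E]})@_p 0.
  by rewrite scale0r; apply: grading0 (op_gr O) _.
by apply/op_compZ/wact_comp/op_vcomp.
Qed.

Definition rmod : grmod P := @GrMod P rcar (@op_comp K E O) (op_gr O) rcompZ.

Definition rmod_hom : ophom (pop rmod) O.
Proof.
apply: (@OpHom _ _ (pop rmod) O (fun x => x)).
- move=> c x y; congr (_ + _).
  apply: etrans (_ : c *: (rscale 1 (x : rcar) : O) = _); last first.
    exact: (congr1 (fun z : O => c *: z) (rscale1 x)).
  exact: rscaleZl.
- by [].
- by move=> v x; apply: lin_extU.
- move=> e x; apply: etrans (lin_extU (pathact x) (epath e)) _.
  exact: (op_se e (x : O)).
Defined.

Lemma rmod_iso : @isomorphic (OpCat K E) (pop rmod) O.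
Proof.
by exists rmod_hom; apply: (@ophom_iso _ _ (pop rmod) O rmod_hom) => [x y|y] //; exists y.
Qed.

End Realisation.

Lemma closed_iso (M N : opmod K E) :
  @isomorphic (OpCat K E) M N -> closed M -> closed N.
Proof.
move=> [f [g [gf fg]]] Mc y yr.
have gfK x : (g : ophom N M) ((f : ophom M N) x) = x.
  by have := congr1 (fun h : ophom M M => h x) gf.
have fgK x : (f : ophom M N) ((g : ophom N M) x) = x.
  by have := congr1 (fun h : ophom N N => h x) fg.
have [e|x [xP xU]] := Mc (fun e => (g : ophom N M) (y e)).
  by rewrite -oh_v yr.
exists ((f : ophom M N) x); split=> [e|x' x'P]; first by rewrite -oh_e xP fgK.
by rewrite -[x']fgK (xU ((g : ophom N M) x')) // => e; rewrite -oh_e x'P.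
Qed.

Definition closedP (M : Gr P) : Prop := closed (pop M).

Lemma closedP_equiv : equivalent_categories (fullsub closedP) (Cl K E).
Proof.
pose F : functor (fullsub closedP) (Cl K E) :=
  @Functor (fullsub closedP) (Cl K E)
    (fun a => exist _ (pop (projT1 a)) (projT2 a))
    (fun a b f => @pop_hom (projT1 a) (projT1 b) f)
    (fun a => pop_hom_id _) (fun a b c g f => pop_hom_comp _ _).
apply: (@equiv_of_fully_faithful _ _ F) => [a b g|a b f g fg|d].
- have [f fP] := pop_full g; exists f; exact: ophom_eq.
- apply: grhom_eq => x.
  exact: (congr1 (fun h : ophom (pop (projT1 a)) (pop (projT1 b)) => h x) fg).
- have cl : closedP (rmod (projT1 d)).
    have [f fi] := rmod_iso (projT1 d); apply: closed_iso (projT2 d).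
    by have [g gi] := fi; exists g, f; case: gi.
  exists (exist _ (rmod (projT1 d)) cl).
  have [f [g fg]] := rmod_iso (projT1 d); exists f, g; exact: fg.
Qed.

End PathModules.

(** * The quotient category by Fdim *)

Section Torsion.
Variables (K : fieldType) (E : finite_graph).

(** The elementwise form of membership in [Fdim], by [Fdim_tors] and [tors_Fdim]. *)
Definition tors (M : opmod K E) (x : M) : Prop :=
  exists k, forall s, size s = k -> wact s x = 0.

Lemma tors_le (M : opmod K E) (x : M) k l : (k <= l)%N ->
  (forall s, size s = k -> wact s x = 0) -> forall s, size s = l -> wact s x = 0.
Proof.
move=> kl h s sl; rewrite -(cat_take_drop k s) wact_cat h ?linear0 //.
by rewrite size_takel // sl.
Qed.

Lemma torsD (M : opmod K E) (x y : M) : tors x -> tors y -> tors (x + y).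
Proof.
move=> [k xk] [l yl]; exists (k + l)%N => s sk.
rewrite linearD /= (tors_le (leq_addr l k) xk sk).
by rewrite (tors_le (leq_addl k l) yl sk) addr0.
Qed.

Lemma tors0 (M : opmod K E) : tors (0 : M).
Proof. by exists 0%N => s _; rewrite linear0. Qed.

Lemma closed_tors (M : opmod K E) (x : M) : closed M -> tors x -> x = 0.
Proof. by move=> Mc [k]; apply: closed_inj_words. Qed.

Lemma tors_sum (M : opmod K E) (I : Type) (r : seq I) (f : I -> M) :
  (forall i, tors (f i)) -> tors (\sum_(i <- r) f i).
Proof. by move=> h; elim/big_rec: _ => [|i x _]; [apply: tors0|apply: torsD]. Qed.

Lemma tors_hcomp (M : opmod K E) (x : M) :
  (forall n, tors (hcomp (op_gr M) n x)) -> tors x.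
Proof. by move=> h; rewrite [x](hcomp_sum (op_gr M)); apply: tors_sum. Qed.

Lemma seq_int_bound (s : seq int) : exists d : nat, forall n, n \in s -> `|n| <= d%:Z.
Proof.
elim: s => [|m s [d dP]]; first by exists 0%N.
exists (`|m| + d)%N => n; rewrite inE => /orP[/eqP ->|/dP nd].
  by rewrite PoszD abszE lerDl.
by apply: le_trans nd _; rewrite PoszD lerDr.
Qed.

Lemma all_words k : exists L : seq (seq (edge E)), forall s, (size s < k)%N -> s \in L.
Proof.
elim: k => [|k [L LP]]; first by exists [::].
exists ([::] :: [seq e :: s | e <- enum (edge E), s <- L]) => -[|e s] sk.
  by rewrite inE.
by rewrite inE; apply/orP; right; apply: allpairs_f; rewrite ?mem_enum ?LP.
Qed.

Local Notation P := (path_gralgebra K E).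

(** A finite-dimensional submodule is bounded above in degree, and words raise degrees while staying
    inside it; so long words annihilate its elements. *)
Lemma Fdim_tors (M : grmod P) : Fdim M -> forall x : M, tors (x : pop M).
Proof.
move=> MF x; have [s [-> sP]] := MF x; rewrite big_seq.
elim/big_rec: _ => [|y z /sP [N [Ns [r [b [bN NP]]] Ny]] tz]; first exact: tors0.
apply: torsD tz; pose Mg := op_gr (pop M).
(* The spanning vectors need not be homogeneous; [d] bounds the degrees of all their components. *)
have [d dP] : exists d : nat, forall i k, d%:Z < k -> hcomp Mg k (b i : pop M) = 0.
  have [d dP] := seq_int_bound (flatten [seq hsupp Mg (b i : pop M) | i <- enum 'I_r]).
  exists d => i k dk; apply: hcomp_out; apply: contraTN dk => ki.
  rewrite -leNgt; apply: le_trans (ler_norm k) _; apply: dP.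
  by apply/flatten_mapP; exists i; rewrite ?mem_enum.
have NPd z' : N z' -> forall k, d%:Z < k -> hcomp Mg k (z' : pop M) = 0.
  move=> /NP [c ->] k dk.
  have -> : \sum_(i < r) ((c i *: (1 : path_algebra K E)) : P^c) *: b i
          = \sum_(i < r) c i *: (b i : pop M) by [].
  elim/big_rec: _ => [|i u _ IH]; first exact: hcomp0.
  rewrite hcompD IH addr0.
  have := @hcomp_morph _ _ _ _ Mg Mg ( *:%R (c i)) 0 (scalerDr (c i)).
  move=> /(_ _ k (b i : pop M)); rewrite addr0 dP // scaler0; apply.
  by move=> n u'; rewrite addr0; apply: op_compZ.
have Nw t (z' : pop M) : N z' -> N (wact t z').
  elim: t z' => //= e t IH z' Nz'; rewrite wact_cons; apply: IH.
  exact: gsubZ Ns _ _ Nz'.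
have [l lP] := seq_int_bound (hsupp Mg (y : pop M)).
(* The components of [y] sit in degrees at least [- l], so a word of this length moves all of them
   beyond [d]. *)
exists (d + l).+1 => t tk; apply: (hcomp_eq0P Mg) => k.
have wm := @hcomp_morph _ _ _ _ Mg Mg (@wact _ _ (pop M) t) (size t)%:Z (linearD _).
have := wm _ (k - (size t)%:Z) (y : pop M); rewrite subrK => -> => [|n u]; last first.
  exact: wact_comp.
have [ks|ks] := boolP (k - (size t)%:Z \in hsupp Mg (y : pop M)); last first.
  by rewrite hcomp_out ?linear0.
have kd : d%:Z < k.
  have := lP _ ks; rewrite ler_norml => /andP[h _].
  rewrite -(subrK (size t)%:Z k); apply: lt_le_trans (_ : - l%:Z + (size t)%:Z <= _); last first.
    by rewrite lerD2r.
  by rewrite tk; lia.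
have := wm _ (k - (size t)%:Z) (y : pop M); rewrite subrK => <- => [|n u]; last first.
  exact: wact_comp.
exact: NPd (Nw _ _ Ny) _ kd.
Qed.

End Torsion.

Section KernelImage.
Variables (R : gradedRing) (M N : grmod R) (f : grhom M N).

Let ker0 : f 0 = 0. Proof. exact: linear0. Qed.
Let kerP (a : R^c) x y : f x = 0 -> f y = 0 -> f (a *: x + y) = 0.
Proof. by move=> fx fy; rewrite linearP fx fy scaler0 addr0. Qed.
Let im0 : exists x, f x = 0. Proof. by exists 0; rewrite linear0. Qed.
Let imP (a : R^c) x y : (exists x', f x' = x) -> (exists y', f y' = y) ->
  exists z, f z = a *: x + y.
Proof. by move=> [x' <-] [y' <-]; exists (a *: x' + y'); rewrite linearP. Qed.

Let ker_homog (s : seq int) (c : int -> M) : uniq s ->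
  (forall n, gm_comp n (c n)) -> f (\sum_(n <- s) c n) = 0 ->
  forall n, n \in s -> f (c n) = 0.
Proof.
move=> us cc c0 n ns.
apply: (grading_direct (gm_grading N) us (fun n => grhom_deg f (cc n)) _ ns).
by rewrite -linear_sum.
Qed.

Lemma hcomp_unique_seq (s : seq int) (c : int -> N) : uniq s ->
  (forall n, gm_comp n (c n)) -> forall n, n \in s ->
  hcomp (gm_grading N) n (\sum_(n <- s) c n) = c n.
Proof.
move=> us cc n ns.
rewrite (@hcomp_unique _ _ (gm_grading N) _ s
  (fun k => if k \in s then c k else 0)) ?ns // => [k|k /negPf ->//|].
  by case: ifP => // _; apply: grading0 (gm_grading N) _.
by apply: eq_big_seq => k ->.
Qed.

Let im_homog (s : seq int) (c : int -> N) : uniq s ->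
  (forall n, gm_comp n (c n)) -> (exists x, f x = \sum_(n <- s) c n) ->
  forall n, n \in s -> exists x, f x = c n.
Proof.
move=> us cc [x xc] n ns; exists (hcomp (gm_grading M) n x).
have := @hcomp_morph M N _ _ (gm_grading M) (gm_grading N) f 0 (linearD f).
move=> /(_ _ n x); rewrite addr0 xc => <-; last first.
  by move=> m z; rewrite addr0; apply: grhom_deg.
exact: hcomp_unique_seq.
Qed.

Definition gr_ker : homogeneous_submodule M :=
  @HomogeneousSubmodule _ M (Submodule ker0 kerP) ker_homog.
Definition gr_im : homogeneous_submodule N :=
  @HomogeneousSubmodule _ N (Submodule im0 imP) im_homog.

End KernelImage.

Section FdimIso.
Variables (K : fieldType) (E : finite_graph).
Local Notation P := (path_gralgebra K E).

Section Cyclic.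
Variables (M : grmod P) (n : int) (y : M).
Hypothesis yn : gm_comp n y.

Definition cyclic (z : M) : Prop := exists a : P, z = ract y a.

Lemma cyclic_graded : graded_submodule cyclic.
Proof.
split.
- by exists 0; rewrite ract0.
- by move=> _ _ [a ->] [b ->]; exists (a + b); rewrite ractDr.
- by move=> b _ [a ->]; exists (a * (b : P)); rewrite -ractA.
- move=> s c us cc [a sa] m ms.
  have <- : hcomp (gm_grading M) m (ract y a) = c m.
    by rewrite -sa hcomp_unique_seq.
  exists (hcomp (gr_grading P) (m - n) a).
  rewrite -(@hcomp_morph P M _ _ (gr_grading P) (gm_grading M) (ract y) n).
  - by rewrite subrK.
  - exact: ractDr.
  - by move=> k b bk; rewrite addrC; apply: ract_comp.
Qed.

(** Only the paths shorter than [k] contribute to the span, and a finite graph has finitely many of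
    them. *)
Lemma cyclic_fd : tors (y : pop M) -> finite_dimensional cyclic.
Proof.
move=> [k yk]; have [L LP] := all_words E k.
(* Pairs that are not paths may stay in the list: they contribute zero vectors. *)
pose I := [seq (v, s) | v <- enum (vert E), s <- L].
pose b (i : 'I_(size I)) : pop M :=
  let p := tnth (in_tuple I) i in wact p.2 (op_v p.1 (y : pop M)).
exists (size I), b; split=> [i|_ [a ->]].
  rewrite /b; case: (tnth _ i) => v s /=.
  elim/last_ind: s => [|s e [a sa]]; first by exists (pV K v).
  by rewrite wact_rcons sa; exists (a * pE K e : P); rewrite -ractA.
suff: exists c : 'I_(size I) -> K, (ract y a : pop M) = \sum_i c i *: b i by [].
elim/malg_ind: (a : path_algebra K E) => [|a1 a2 [c1 h1] [c2 h2]|c p].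
- exists (fun=> 0); rewrite big1 => [|i _]; last by rewrite scale0r.
  exact: (@ract0 P M y).
- exists (fun i => c1 i + c2 i); apply: etrans (@ractDr P M y a1 a2) _.
  apply: etrans (f_equal2 +%R h1 h2) _; rewrite -big_split /=.
  by apply: eq_bigr => i _; rewrite scalerDl.
have -> : (ract y (c *: << p >> : P) : pop M)
        = c *: wact (pedges p) (op_v (psrc p) (y : pop M)).
  rewrite -pop_path; apply: etrans (esym (@ractA P M _ _ _)).
  by apply: congr1; apply/esym/pK_r.
have [pk|pk] := ltnP (size (pedges p)) k.
  have /(nthP (psrc p, pedges p)) [i iI ip] : (psrc p, pedges p) \in I.
    by apply: allpairs_f; rewrite ?mem_enum ?LP.
  exists (fun j => if j == Ordinal iI then c else 0).
  rewrite (bigD1 (Ordinal iI)) //= eqxx big1 ?addr0 => [|j /negPf ->]; last first.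
    by rewrite scale0r.
  by rewrite /b (tnth_nth (psrc p, pedges p)) /= ip.
exists (fun=> 0); rewrite big1 => [|i _]; last by rewrite scale0r.
suff -> : wact (pedges p) (op_v (psrc p) (y : pop M)) = 0 by rewrite scaler0.
case Ep : (pedges p) pk => [|e s] pk; last first.
  by rewrite wact_v; case: ifP => // _; apply: (tors_le pk yk).
(* An empty path of length at least [k] means [k = 0], so the empty word already kills [y]. *)
suff -> : (y : pop M) = 0 by rewrite !linear0.
exact: (@tors_le _ _ _ _ _ _ pk yk [::] erefl).
Qed.

End Cyclic.

(** An element is split into homogeneous components since these generate graded cyclic
    submodules. *)
Lemma tors_Fdim (M : grmod P) : (forall x : M, tors (x : pop M)) -> Fdim M.
Proof.
move=> Mt x; pose Mg := gm_grading M.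
exists [seq hcomp Mg n x | n <- hsupp Mg x]; split.
  by rewrite big_map; apply: hcomp_sum.
move=> _ /mapP [n _ ->]; exists (cyclic (hcomp Mg n x)); split.
- exact: (cyclic_graded (@hcompC _ _ Mg n x)).
- exact/cyclic_fd/Mt.
- by exists 1; rewrite ract1.
Qed.

(** Kernel and cokernel are torsion, with the second condition phrased without forming the
    cokernel. *)
Definition tors_iso (M N : opmod K E) (f : ophom M N) : Prop :=
  (forall x, f x = 0 -> tors x) /\
  (forall y, exists k, forall s, size s = k -> exists x, f x = wact s y).

Lemma Fdim_isoP (M N : grmod P) (f : grhom M N) :
  Fdim_iso f <-> tors_iso (pop_hom f).
Proof.
split=> [[X [i [Y [q [ij ki kq qs [XF YF]]]]]]|[fk fc]].
  split=> [x /ki [z <-]|y].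
    have [k zk] := Fdim_tors XF z; exists k => s sk.
    by rewrite -[i z]/(pop_hom i z) -oh_wact zk ?oh0.
  have [k qk] := Fdim_tors YF (q y); exists k => s sk.
  apply/kq; rewrite -[LHS]/(pop_hom q _) oh_wact; exact: qk.
have [X [i [ij iX _]]] := grsub_ex (gr_ker f); have [Y [q [qs qY]]] := grquot_ex (gr_im f).
exists X, i, Y, q; split; [exact: ij|exact: iX|exact: qY|exact: qs|].
split; apply: tors_Fdim; [move=> z|move=> w].
  have [k zk] : tors (i z : pop M) by apply: fk; apply/iX; exists z.
  exists k => s sk; apply: ij; rewrite linear0.
  by apply: etrans (zk s sk); apply: (oh_wact (pop_hom i)).
have [y <-] := qs w; have [k yk] := fc y; exists k => s sk.
apply: etrans (esym (oh_wact (pop_hom q) s y)) _; apply/qY.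
exact: yk.
Qed.

End FdimIso.

(** * Closed modules are local for isomorphisms modulo torsion *)

Section Locality.
Variables (K : fieldType) (E : finite_graph) (M M' N : opmod K E).
Variables (w : ophom M M') (f : ophom M N).
Hypothesis wt : tors_iso w.
Hypothesis Nc : closed N.

(* [eventually y x]: along all long words, [y] comes from [M] and [f] sends it
   to the corresponding translate of [x]. *)
Let ev_at k (y : M') (x : N) :=
  forall s, size s = k -> exists z, w z = wact s y /\ f z = wact s x.
Let eventually y x := exists k, ev_at k y x.

Let ev_le k l y x : (k <= l)%N -> ev_at k y x -> ev_at l y x.
Proof.
move=> kl h s sl; have [|z [wz fz]] := h (take k s); first by rewrite size_takel ?sl.
exists (wact (drop k s) z); rewrite !oh_wact wz fz -!wact_cat.
by rewrite cat_take_drop.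
Qed.

Let fker z z' : w z = w z' -> f z = f z'.
Proof.
move=> wz; apply/eqP; rewrite -subr_eq0 -ohB; apply/eqP.
have [k zk] : tors (z - z') by apply: wt.1; rewrite ohB wz subrr.
by apply: (closed_tors Nc); exists k => s sk; rewrite -oh_wact zk ?oh0.
Qed.

Let evP a y x y' x' : eventually y x -> eventually y' x' ->
  eventually (a *: y + y') (a *: x + x').
Proof.
move=> [k h] [k' h']; exists (k + k')%N => s sk.
have [z [wz fz]] := ev_le (leq_addr k' k) h sk.
have [z' [wz' fz']] := ev_le (leq_addl k k') h' sk.
by exists (a *: z + z'); rewrite !oh_lin linearP wz wz' fz fz' linearP.
Qed.

Let evU y x x' : eventually y x -> eventually y x' -> x = x'.
Proof.
move=> h h'; apply/eqP; rewrite -subr_eq0; apply/eqP.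
have [k hk] := evP (-1) h' h; apply: (closed_tors Nc); exists k => s sk.
have [z [wz fz]] := hk s sk; rewrite addrC -scaleN1r -fz.
rewrite -(oh0 f); apply: fker; rewrite wz oh0.
by rewrite scaleN1r addNr linear0.
Qed.

Let ev_v v y x : eventually y x -> eventually (op_v v y) (op_v v x).
Proof.
move=> [k h]; exists k.+1 => -[//|e s] [sk]; rewrite !wact_v.
case: ifP => _; last by exists 0; rewrite !oh0.
by apply: (ev_le (leqnSn k) h); rewrite /= sk.
Qed.

Let ev_e e y x : eventually y x -> eventually (op_e e y) (op_e e x).
Proof.
move=> [k h]; exists k => s sk; rewrite -!wact_cons.
by apply: (ev_le (leqnSn k) h); rewrite /= sk.
Qed.

(** Induction on the length: images found for the products of [y] with all edges are glued to one
    element by closedness of [N]. *)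
Let ev_ex_words k y : (forall s, size s = k -> exists z, w z = wact s y) ->
  exists x, eventually y x.
Proof.
elim: k y => [|k IH] y h.
  have [z wz] := h [::] erefl; exists (f z), 0%N => s /size0nil ->.
  by exists z.
have /choice [x xP] e : exists x, eventually (op_e e y) x.
  by apply: IH => s sk; rewrite -wact_cons; apply: h; rewrite /= sk.
(* The [x e] found need not lie at the vertex [rng e]; projecting them there is harmless, as
   [op_e e y] is fixed by that vertex. *)
have [e|x' [x'P _]] := Nc (y := fun e => op_v (rng e) (x e)).
  by rewrite op_vv eqxx.
have /choice [l lP] e : exists k, ev_at k (op_e e y) (op_v (rng e) (x e)).
  by rewrite -op_re; apply: ev_v.
exists x', (\sum_e l e).+1 => -[//|e s] [sk]; rewrite !wact_cons x'P.
by apply: ev_le (lP e) _ sk; rewrite (bigD1 e) //= leq_addr.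
Qed.

Let ev_ex y : exists x, eventually y x.
Proof. by have [k h] := wt.2 y; apply: ev_ex_words h. Qed.

(** Along long words an element of [M'] comes from [M], where [f] dictates the value. Torsion in the
    kernel of [w] makes this unambiguous, because the closed module [N] has no torsion. *)
Lemma tors_iso_ext : exists g : ophom M' N,
  (forall x, g (w x) = f x) /\
  forall g' : ophom M' N, (forall x, g' (w x) = f x) -> g' = g.
Proof.
have /choice [g gP] := ev_ex.
have ge y x : eventually y x -> g y = x by move=> h; apply: evU (gP y) h.
have gcomp n y : op_comp n y -> op_comp n (g y).
  move=> yn; have [k h] := gP y; apply: (closed_homog_words Nc (k := k)) => s sk.
  have [z [wz <-]] := h s sk.
  (* The preimage [z] may be inhomogeneous, but its component of the right degree has the same image
     under [w], hence under [f]. *)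
  rewrite (fker (z' := hcomp (op_gr M) (n + k%:Z) z)).
    exact: (oh_comp f (@hcompC _ _ (op_gr M) _ z)).
  have := @hcomp_morph _ _ _ _ (op_gr M) (op_gr M') w 0 (ohD w).
  move=> /(_ _ (n + k%:Z) z); rewrite addr0 => <-; last first.
    by move=> m x; rewrite addr0; apply: oh_comp.
  by rewrite hcomp_id // wz -sk; apply: wact_comp.
have glin : linear g by move=> a y y'; apply/ge/evP.
have gv v y : g (op_v v y) = op_v v (g y) by apply/ge/ev_v.
have gE e y : g (op_e e y) = op_e e (g y) by apply/ge/ev_e.
exists (OpHom glin gcomp gv gE); split=> [x|g' g'P] /=.
  by apply: ge; exists 0%N => s _; exists (wact s x); rewrite !oh_wact.
apply: ophom_eq => y /=; apply/esym/ge; have [k h] := wt.2 y; exists k => s sk.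
by have [z wz] := h s sk; exists z; rewrite -g'P wz oh_wact.
Qed.

End Locality.

Section QuotientMap.
Variables (R : pzRingType) (V : lmodType R) (S : submodule V) (g : V -> V).
Hypothesis glin : linear g.
Hypothesis gS : forall x, S x -> S (g x).

Definition smmap (y : smquot S) : smquot S := smpi S (g (smrepr y)).

Let gB x y : g (x - y) = g x - g y.
Proof. by rewrite -scaleN1r addrC glin scaleN1r addrC. Qed.

Lemma smmap_pi x : smmap (smpi S x) = smpi S (g x).
Proof. by apply/smpiP; rewrite -gB; apply/gS/smpiP; rewrite smreprK. Qed.

Lemma smmap_linear : linear smmap.
Proof.
move=> a x y; rewrite -(smreprK x) -(smreprK y) -linearP !smmap_pi glin.
by rewrite linearP.
Qed.

End QuotientMap.

(** * The closed module of germs of functions on long words *)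

Section Reflection.
Variables (K : fieldType) (E : finite_graph) (O : opmod K E).

Local Notation V := (seq (edge E) -> O : lmodType K).

Definition vanish (x : V) : Prop :=
  exists k, forall s, (k <= size s)%N -> x s = 0.

Lemma vanish0 : vanish 0.
Proof. by exists 0%N. Qed.

Lemma vanishP a (x y : V) : vanish x -> vanish y -> vanish (a *: x + y).
Proof.
move=> [k xk] [l yl]; exists (k + l)%N => s sk.
rewrite -[LHS]/(a *: x s + y s) xk ?yl ?scaler0 ?addr0 //.
  exact: leq_trans (leq_addl k l) sk.
exact: leq_trans (leq_addr l k) sk.
Qed.

Definition vsm : submodule V := Submodule vanish0 vanishP.
Local Notation germ := (smpi vsm).

Lemma germP (x y : V) : germ x = germ y <->
  exists k, forall s, (k <= size s)%N -> x s = y s.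
Proof.
split=> [/smpiP [k h]|[k h]]; last first.
  apply/smpiP; exists k => s sk.
  by rewrite -[LHS]/(x s - y s) h // subrr.
exists k => s sk; apply/eqP; rewrite -subr_eq0; apply/eqP; exact: h.
Qed.

(** The value on the empty word is immaterial, since germs forget short words. *)
Definition germ_v v (x : V) : V :=
  fun s => if s is e :: _ then if src e == v then x s else 0 else 0.
Definition germ_e e (x : V) : V := fun s => x (e :: s).

Lemma germ_vlin v : linear (germ_v v).
Proof.
move=> a x y; apply/funext => -[|e s]; rewrite -[RHS]/(a *: germ_v v x _ + germ_v v y _) /=.
  by rewrite scaler0 addr0.
by case: eqP => // _; rewrite scaler0 addr0.
Qed.

Lemma germ_elin e : linear (germ_e e). Proof. by []. Qed.

Lemma germ_vS v x : vsm x -> vsm (germ_v v x).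
Proof. by move=> [k h]; exists k => -[|e s] sk //=; rewrite h // if_same. Qed.

Lemma germ_eS e x : vsm x -> vsm (germ_e e x).
Proof. by move=> [k h]; exists k => s sk; apply: h; apply: leqW. Qed.

(** From length [k] on, [x] behaves like the map sending each word to its product with a single
    element of degree [n]. *)
Definition section_from k n (x : V) : Prop := forall s, (k <= size s)%N ->
  [/\ op_comp (n + (size s)%:Z) (x s), (~~ composable s -> x s = 0)
    & forall e, x (rcons s e) = op_e e (x s)].

Definition germ_W n (y : smquot vsm) : Prop :=
  exists x k, germ x = y /\ section_from k n x.

Lemma section_le k l n x : (k <= l)%N -> section_from k n x -> section_from l n x.
Proof. by move=> kl h s sl; apply: h; apply: leq_trans sl. Qed.

Lemma germ_W0 n : germ_W n 0.
Proof.
exists 0, 0%N; split=> [|s _]; first exact: linear0.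
split=> [|//|e]; first exact: (grading0 (op_gr O)).
exact/esym/(linear0 (op_e e)).
Qed.

Lemma germ_WP n a x y : germ_W n x -> germ_W n y -> germ_W n (a *: x + y).
Proof.
move=> [x' [k [<- hx]]] [y' [l [<- hy]]].
exists (a *: x' + y'), (k + l)%N; split=> [|s sk]; first by rewrite linearP.
have [x1 x2 x3] := section_le (leq_addr l k) hx sk.
have [y1 y2 y3] := section_le (leq_addl k l) hy sk.
rewrite -[(a *: x' + y') s]/(a *: x' s + y' s); split=> [|cs|e].
- by apply: (gradingD (op_gr O)) => //; apply: op_compZ.
- by rewrite x2 // y2 // scaler0 addr0.
- by rewrite linearP /= -x3 -y3.
Qed.

Lemma germ_vW n v x : germ_W n x -> germ_W n (smmap (S := vsm) (germ_v v) x).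
Proof.
move=> [x' [k [<- hx]]]; exists (germ_v v x'), k.+1.
split; first by rewrite (smmap_pi (germ_vlin v) (@germ_vS v)).
move=> -[|f s] // sk; have [x1 x2 x3] := hx (f :: s) (ltnW sk).
rewrite /germ_v /=; case: eqP => _; first by split.
by split=> [|//|e]; [apply: (grading0 (op_gr O))|rewrite linear0].
Qed.

Lemma germ_eW n e x : germ_W n x -> germ_W (n + 1) (smmap (S := vsm) (germ_e e) x).
Proof.
move=> [x' [k [<- hx]]]; exists (germ_e e x'), k.
split; first by rewrite (smmap_pi (germ_elin e) (@germ_eS e)).
move=> s sk; have [x1 x2 x3] := hx (e :: s) (leqW sk).
rewrite /germ_e; split=> [|cs|f]; last by rewrite -rcons_cons x3.
  by move: x1; rewrite /= -addrA.
apply: x2; move: cs; case: s {sk x1 x3} => //= f s.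
by rewrite !eqxx /= => /negPf ->; rewrite andbF.
Qed.

Lemma germ_vv n v w x : germ_W n x ->
  smmap (S := vsm) (germ_v w) (smmap (germ_v v) x)
  = if v == w then smmap (germ_v v) x else 0.
Proof.
move=> _; rewrite -(smreprK x); move: (smrepr x) => {}x.
rewrite (smmap_pi (germ_vlin v) (@germ_vS v) x) (smmap_pi (germ_vlin w) (@germ_vS w)).
rewrite -[0](linear0 germ); case: eqP => [->|vw]; apply/germP; exists 0%N => -[|e s] _ //=.
  by case: eqP.
case: (src e =P w) => // ew; case: (src e =P v) => // ev.
by case: vw; rewrite -ev.
Qed.

Lemma germ_v1 n x : germ_W n x -> \sum_v smmap (S := vsm) (germ_v v) x = x.
Proof.
move=> _; rewrite -(smreprK x); move: (smrepr x) => {}x.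
under eq_bigr do rewrite (smmap_pi (germ_vlin _) (@germ_vS _)).
rewrite -linear_sum; apply/germP; exists 1%N => -[|e s] // _.
rewrite fct_sumE (bigD1 (src e)) //= eqxx big1 ?addr0 // => v /negPf.
by rewrite eq_sym => ->.
Qed.

Lemma germ_se n e x : germ_W n x ->
  smmap (S := vsm) (germ_e e) (smmap (germ_v (src e)) x) = smmap (germ_e e) x.
Proof.
move=> _; rewrite -(smreprK x); move: (smrepr x) => {}x.
rewrite (smmap_pi (germ_vlin _) (@germ_vS _) x).
rewrite !(smmap_pi (germ_elin _) (@germ_eS _)).
by apply/germP; exists 0%N => s _; rewrite /germ_e /= eqxx.
Qed.

Lemma germ_re n e x : germ_W n x ->
  smmap (S := vsm) (germ_v (rng e)) (smmap (germ_e e) x) = smmap (germ_e e) x.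
Proof.
move=> [x' [k [<- hx]]]; rewrite (smmap_pi (germ_elin _) (@germ_eS _) x').
rewrite (smmap_pi (germ_vlin _) (@germ_vS _)).
apply/germP; exists k.+1 => -[|f s] // sk; rewrite /germ_v /germ_e.
case: eqP => // fr; have [_ -> //] := hx [:: e, f & s] (leqW (ltnW sk)).
by rewrite /= eqxx /=; case: eqP.
Qed.

Definition germ_fam : fam K E :=
  @Fam K E (smquot vsm) germ_W (fun v => smmap (germ_v v)) (fun n e => smmap (germ_e e))
    germ_W0 germ_WP
    (fun v => smmap_linear (germ_vlin v) (@germ_vS v))
    (fun n e => smmap_linear (germ_elin e) (@germ_eS e))
    germ_vW germ_eW germ_vv germ_v1 germ_se germ_re.

Definition reflection : opmod K E := fam_op germ_fam.

(** Germs [h e], one for each edge, are glued to the function whose value on [e :: s] is [h e s]; as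
    there are finitely many edges, the length bounds can be made common. *)
Lemma reflection_closed : closed reflection.
Proof.
apply: fam_op_closed => n y yW yr.
have /choice [h hP] e : exists h : V, germ h = y e /\ exists k, section_from k (n + 1) h.
  by have [h [k [hy hs]]] := yW e; exists h; split; last exists k.
have /choice [k kP] e : exists k, section_from k (n + 1) (h e) /\
    forall s, (k <= size s)%N -> germ_v (rng e) (h e) s = h e s.
  have [he [k hk]] := hP e.
  (* That [y e] lies at [rng e] means that [h e] eventually vanishes on words starting elsewhere. *)
  have /germP [l hl] : germ (germ_v (rng e) (h e)) = germ (h e).
    by rewrite he -[RHS]yr -he; apply/esym/(smmap_pi (germ_vlin _) (@germ_vS _)).
  exists (k + l)%N; split; first exact: section_le (leq_addr l k) hk.
  by move=> s sk; apply: hl; apply: leq_trans (leq_addl k l) sk.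
pose m := (\sum_e k e)%N.
have km e : (k e <= m)%N by rewrite /m (bigD1 e) //= leq_addr.
pose x : V := fun s => if s is e :: s' then h e s' else 0.
exists (germ x); split=> [|e|x' _ x'P].
(* Two letters are needed to see whether [e] and [f] compose, and [f :: s] must still be at least as
   long as every [k e]. *)
- exists x, m.+2; split=> // -[|e [|f s]] // sk.
  have [hs hv] := kP e; have kl : (k e <= size (f :: s))%N.
    by move: (km e) sk => /=; lia.
  have [h1 h2 h3] := hs _ kl; split=> [|cs|g]; last exact: h3.
    by move: h1; rewrite /= -addrA.
  rewrite /x; have [fc|fc] := boolP (composable (f :: s)); last exact: h2.
  rewrite -(hv _ kl) /germ_v; case: eqP => // fr; case/negP: cs.
  by move: fc; rewrite /= !eqxx fr eqxx.
- rewrite -(hP e).1; exact: (smmap_pi (germ_elin _) (@germ_eS _)).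
- move: (smreprK x') x'P => <- x'P.
  have /choice [l lP] e : exists l, forall s, (l <= size s)%N ->
      smrepr x' (e :: s) = h e s.
    by apply/germP; rewrite (hP e).1 -x'P; apply/esym/(smmap_pi (germ_elin _) (@germ_eS _)).
  apply/germP; exists (\sum_e l e).+1 => -[|e s] // sk.
  by apply: lP; move: sk; rewrite ltnS; apply: leq_trans; rewrite (bigD1 e) //= leq_addr.
Qed.

Lemma wact_not_composable s (x : O) : ~~ composable s -> wact s x = 0.
Proof.
case: s => // e s h; rewrite wact_cons -op_se -wact_cons.
exact: wact_not_path.
Qed.

Lemma unit_W n (x : O) : op_comp n x -> germ_W n (germ (fun s => wact s x)).
Proof.
move=> xn; exists (fun s => wact s x), 0%N; split=> // s _.
split=> [|cs|e]; first exact: (wact_comp s xn).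
  exact: wact_not_composable.
exact: wact_rcons.
Qed.

Lemma unit_fin (x : O) : fin_fam (F := germ_fam)
  (fun n => germ (fun s => wact s (hcomp (op_gr O) n x))).
Proof.
split=> [|n]; last exact: (unit_W (@hcompC _ _ (op_gr O) n x)).
exists (hsupp (op_gr O) x) => n /hcomp_out ->.
rewrite -[RHS](linear0 germ); apply/germP; exists 0%N => s _.
exact: linear0.
Qed.

Definition reflection_unit : ophom O reflection.
Proof.
apply: (@OpHom _ _ O reflection (fun x => fmk (unit_fin x))).
- move=> a x y; apply: fproj_inj => n; rewrite fprojD fprojZ !fmkK.
  rewrite -linearP; congr smpi; apply/funext => s.
  rewrite hcompD linearD; congr (_ + _).
  rewrite -[RHS]/(a *: wact s _) -linearZ; congr wact.
  have := @hcomp_morph _ _ _ _ (op_gr O) (op_gr O) ( *:%R a) 0 (scalerDr a).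
  move=> /(_ _ n x); rewrite addr0; apply.
  by move=> m z; rewrite addr0; apply: op_compZ.
- move=> n x xn k kn; rewrite fmkK -[RHS](linear0 germ); apply/germP.
  exists 0%N => s _; rewrite (hcomp_neq _ xn) ?linear0 // eq_sym.
  exact: kn.
- move=> v x; apply: fproj_inj => n; rewrite !fmkK /=.
  rewrite (smmap_pi (germ_vlin _) (@germ_vS _)).
  apply/germP; exists 1%N => -[|e s] // _; rewrite /germ_v.
  have := @hcomp_morph _ _ _ _ (op_gr O) (op_gr O) (op_v v) 0 (linearD _).
  move=> /(_ _ n x); rewrite addr0 => ->; last first.
    by move=> m z; rewrite addr0; apply: op_vcomp.
  by rewrite wact_v eq_sym.
- move=> e x; apply: fproj_inj => n; rewrite !fmkK /=.
  rewrite (smmap_pi (germ_elin _) (@germ_eS _)).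
  apply/germP; exists 0%N => s _; rewrite /germ_e wact_cons; congr wact.
  have := @hcomp_morph _ _ _ _ (op_gr O) (op_gr O) (op_e e) 1 (linearD _).
  move=> /(_ _ (n - 1) x); rewrite subrK; apply.
  by move=> m z; apply: op_ecomp.
Defined.

Lemma fproj_wact (y : reflection) s n (h : V) : fproj (y : fam_car germ_fam) n = germ h ->
  fproj (wact s y : fam_car germ_fam) (n + (size s)%:Z) = germ (fun t => h (s ++ t)).
Proof.
elim: s y n h => [|e s IH] y n h yh; first by rewrite addr0.
rewrite wact_cons -[(size (e :: s))%:Z]/(1 + (size s)%:Z) addrA.
apply: (IH (op_e e y) (n + 1) (germ_e e h)).
rewrite fproj_e yh; exact: (smmap_pi (germ_elin _) (@germ_eS _)).
Qed.

(** A vanishing germ means that long words kill the components of [x]. Conversely, once a word [s]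
    is long enough for a section [h], the section condition makes [h] along the extensions of [s]
    the orbit of the single element [h s], which is then a preimage. *)
Lemma reflection_unit_iso : tors_iso reflection_unit.
Proof.
split=> [x x0|y].
  apply: tors_hcomp => n.
  have : fproj (reflection_unit x : fam_car germ_fam) n = 0 by rewrite x0.
  rewrite fmkK -(linear0 germ) => /germP [k h].
  by exists k => s sk; apply: (h s); rewrite sk.
elim/(@grading_ind _ _ (op_gr reflection)) : y => [|y y' [k h] [k' h']|n y yn].
- by exists 0%N => s _; exists 0; rewrite oh0 linear0.
- exists (k + k')%N => s sk.
  have [x xP] : exists x, reflection_unit x = wact s y.
    have [|x xP] := h (take k s); first by rewrite size_takel ?sk // leq_addr.
    exists (wact (drop k s) x); rewrite oh_wact xP -wact_cat.
    by rewrite cat_take_drop.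
  have [x' xP'] : exists x, reflection_unit x = wact s y'.
    have [|x' xP'] := h' (take k' s); first by rewrite size_takel ?sk // leq_addl.
    exists (wact (drop k' s) x'); rewrite oh_wact xP' -wact_cat.
    by rewrite cat_take_drop.
  by exists (x + x'); rewrite ohD xP xP' linearD.
have [h [k [hy hs]]] := (fprojP (y : fam_car germ_fam)).2 n.
exists k => s sk; exists (h s); have [hc _ _] := hs s (eq_leq (esym sk)).
have ws := wact_comp s yn; have us := oh_comp reflection_unit hc.
apply: fproj_inj => m; have [->|mn] := eqVneq m (n + (size s)%:Z); last first.
  by rewrite (ws m mn) (us m mn).
rewrite (fproj_wact s (esym hy)) fmkK hcomp_id //; apply/germP; exists 0%N => t _.
elim/last_ind: t => [|t e IH]; first by rewrite cats0.
rewrite wact_rcons IH -rcons_cat; have [|_ _ -> //] := hs (s ++ t).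
by rewrite size_cat sk leq_addr.
Qed.

End Reflection.

Section QGrClosed.
Variables (K : fieldType) (E : finite_graph).

Lemma QGr_equiv_Cl : equivalent_categories (QGr K E) (Cl K E).
Proof.
apply: equiv_trans (closedP_equiv K E).
apply: reflective_localisation => [M|M M' N w f /Fdim_isoP wt Nc].
  pose Q := rmod (reflection (pop M)); pose u := reflection_unit (pop M).
  have [r [r' [r'r rr']]] := rmod_iso (reflection (pop M)).
  pose i : ophom (pop Q) (reflection (pop M)) := r.
  pose j : ophom (reflection (pop M)) (pop Q) := r'.
  have ijK x : j (i x) = x by apply: (congr1 (fun h : ophom _ _ => h x) r'r).
  have jiK x : i (j x) = x by apply: (congr1 (fun h : ophom _ _ => h x) rr').
  have [w wP] := pop_full (ophom_comp j u); exists Q, w; split.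
    by apply: closed_iso (@reflection_closed _ _ (pop M)); exists r', r.
  have wE x : pop_hom w x = j (u x) by apply: wP.
  apply/Fdim_isoP; have [uk uc] := reflection_unit_iso (pop M); split=> [x|y].
    by rewrite wE => h; apply: uk; rewrite -(jiK (u x)) h oh0.
  have [k h] := uc (i y); exists k => s sk; have [x xP] := h s sk; exists x.
  by rewrite wE /u xP oh_wact ijK.
have [g [gw gU]] := tors_iso_ext (pop_hom f) wt Nc.
have [g' g'P] := pop_full g; exists g'; split.
  by apply: grhom_eq => x; rewrite /= g'P gw.
move=> g2 g2w; apply: grhom_eq => x; rewrite g'P.
have <- // : pop_hom g2 = g.
by apply: gU => z; rewrite -g2w.
Qed.

End QGrClosed.

(** * Graded modules over the Leavitt path algebra *)

Section FreeAlgebra.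
Variables (K : fieldType) (I : choiceType).
Local Notation A := {malg K[{fmonom I}]}.

Lemma malg_cMr c (a : A) : a * (c *: 1) = c *: a.
Proof.
have U k d : d *: << k >> = << d *g k >> :> A.
  apply/malgP => u; rewrite mcoeffZ !mcoeffU mulrnAr.
  congr (_ *+ _); exact: mulr1.
apply: etrans (congr1 (fun z : A => a * z) (U mone c)) _.
rewrite malgM_def fgmulgU [in RHS](monalgE a) scaler_sumr.
apply: eq_bigr => m _; rewrite mulm1; apply: etrans (esym (U _ _)) _.
by rewrite [_ * c]mulrC -scalerA; congr (_ *: _); apply: U.
Qed.

Lemma malg_cMl c (a : A) : (c *: 1) * a = c *: a.
Proof. by rewrite -scalerAl mul1r. Qed.

Lemma malg_scaleAr c (a b : A) : c *: (a * b) = a * (c *: b).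
Proof. by rewrite -(malg_cMr c b) mulrA malg_cMr. Qed.

Lemma malg_UM (m m' : {fmonom I}) : << m >> * << m' >> = << mmul m m' >> :> A.
Proof. by rewrite malgM_def fgmulUU mulr1. Qed.

Lemma fmonom_ind (Q : {fmonom I} -> Prop) :
  Q mone -> (forall i m, Q m -> Q (mmul (fmu i) m)) -> forall m, Q m.
Proof.
move=> Q1 QM [s]; elim: s => [|i s IH].
  suff -> : FMonom [::] = mone :> {fmonom I} by [].
  by apply: val_inj; rewrite /= fm1.
suff -> : FMonom (i :: s) = mmul (fmu i) (FMonom s) by apply: QM.
by apply: val_inj; rewrite /= fmM fmU.
Qed.

End FreeAlgebra.

Section LeavittGenerators.
Variables (K : fieldType) (E : finite_graph).
Local Notation A := {malg K[{fmonom lgen E}]}.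
Local Notation L := (leavitt K E).

Definition lpi (a : A) : L := pr_pi (@leavitt_rel K E) a.
Definition lK (c : K) : L := lpi (c *: 1).
Definition lV (v : vert E) : L := lpi (lvtx K v).
Definition lE (e : edge E) : L := lpi (ledge K e).
Definition lG (e : edge E) : L := lpi (lghost K e).

Lemma lpi_rel a b : leavitt_rel a b -> lpi a = lpi b.
Proof.
move=> r; apply/pr_piP; rewrite -[a - b]mul1r -[1 * _]mulr1.
exact: rel_ideal_gen.
Qed.

Lemma lpiM a b : lpi (a * b) = lpi a * lpi b.
Proof. exact: rmorphM. Qed.
Lemma lpiD a b : lpi (a + b) = lpi a + lpi b.
Proof. exact: raddfD. Qed.
Lemma lpi0 : lpi 0 = 0.
Proof. exact: raddf0. Qed.
Lemma lpi1 : lpi 1 = 1.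
Proof. exact: rmorph1. Qed.
Lemma lpi_sum (J : Type) (r : seq J) (P : pred J) (F : J -> A) :
  lpi (\sum_(i <- r | P i) F i) = \sum_(i <- r | P i) lpi (F i).
Proof. exact: raddf_sum. Qed.

Lemma lpi_surj (x : L) : exists a, lpi a = x.
Proof. by exists (pr_repr x); apply: pr_reprK. Qed.

Lemma lKZ c a : lpi (c *: a) = lpi a * lK c.
Proof. by rewrite -lpiM malg_cMr. Qed.

Lemma lK_comm c x : lK c * x = x * lK c.
Proof. by have [a <-] := lpi_surj x; rewrite -!lpiM malg_cMr malg_cMl. Qed.

Lemma lKM c d : lK c * lK d = lK (c * d).
Proof. by rewrite -lpiM malg_cMl scalerA. Qed.
Lemma lKD c d : lK (c + d) = lK c + lK d.
Proof. by rewrite -lpiD -scalerDl. Qed.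
Lemma lK1 : lK 1 = 1.
Proof. by rewrite /lK scale1r lpi1. Qed.

Lemma lV_sum : \sum_v lV v = 1.
Proof. by rewrite -lpi_sum -lpi1; apply/lpi_rel/lrel_unit. Qed.
Lemma lV_mul v w : lV v * lV w = if v == w then lV v else 0.
Proof.
rewrite -lpiM (lpi_rel (lrel_vertex K v w)).
by case: ifP => // _; apply: lpi0.
Qed.
Lemma lV_lE e : lV (src e) * lE e = lE e.
Proof. by rewrite -lpiM; apply/lpi_rel/lrel_src. Qed.
Lemma lE_lV e : lE e * lV (rng e) = lE e.
Proof. by rewrite -lpiM; apply/lpi_rel/lrel_rng. Qed.
Lemma lG_lV e : lG e * lV (src e) = lG e.
Proof. by rewrite -lpiM; apply/lpi_rel/lrel_ghost_src. Qed.
Lemma lG_lE e f : lG e * lE f = if e == f then lV (rng e) else 0.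
Proof.
rewrite -lpiM (lpi_rel (lrel_CK1 K e f)).
by case: ifP => // _; apply: lpi0.
Qed.
Lemma lE_lG v : ~ sink v -> \sum_(e | src e == v) lE e * lG e = lV v.
Proof.
move=> vs; have h : exists e : edge E, src e = v.
  by apply: contrapT => h; apply: vs => e ev; apply: h; exists e.
apply: etrans (lpi_rel (lrel_CK2 K h)); rewrite lpi_sum.
by apply: eq_bigr => e _; rewrite lpiM.
Qed.

Lemma leavitt_ind (Q : L -> Prop) : (forall x y, Q x -> Q y -> Q (x + y)) ->
  (forall c, Q (lK c)) -> (forall g x, Q x -> Q (lpi << fmu g >> * x)) -> forall x, Q x.
Proof.
move=> QD QK QM x; have [a <-] := lpi_surj x.
elim/malg_ind: a => [|a b Ha Hb|c m].
- by rewrite -(scale0r (1 : A)); apply: QK.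
- by rewrite lpiD; apply: QD.
rewrite lKZ; elim/fmonom_ind: m => [|g m Hm].
  by rewrite [lpi _](_ : _ = 1) ?mul1r //; apply: lpi1.
by rewrite -malg_UM lpiM -mulrA; apply: QM.
Qed.

Lemma lpi_comp n a : homog (@lword_deg E) n a ->
  gr_comp (g := leavitt_gralgebra K E) n (lpi a).
Proof. by move=> h; exists a. Qed.

Lemma lK_comp c : gr_comp (g := leavitt_gralgebra K E) 0 (lK c).
Proof. by apply/lpi_comp/homogZ/homog1. Qed.
Lemma lV_comp v : gr_comp (g := leavitt_gralgebra K E) 0 (lV v).
Proof. exact/lpi_comp/homog_lv. Qed.
Lemma lE_comp e : gr_comp (g := leavitt_gralgebra K E) 1 (lE e).
Proof. exact/lpi_comp/homog_le. Qed.
Lemma lG_comp e : gr_comp (g := leavitt_gralgebra K E) (-1) (lG e).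
Proof. exact/lpi_comp/homog_ls. Qed.

End LeavittGenerators.

Arguments lpi : simpl never.

Section LeavittModules.
Variables (K : fieldType) (E : finite_graph).
Hypothesis Ens : no_sinks E.
Local Notation L := (leavitt_gralgebra K E).
Local Notation lV := (@lV K E : _ -> L).
Local Notation lE := (@lE K E : _ -> L).
Local Notation lG := (@lG K E : _ -> L).
Local Notation lK := (@lK K E : _ -> L).

Section Underlying.
Variable M : grmod L.

Definition lcar : Type := M.
HB.instance Definition _ := GRing.Zmodule.on lcar.

Definition lopscale (c : K) (x : lcar) : lcar := ract (x : M) (lK c).

Lemma lopscaleA a b v : lopscale a (lopscale b v) = lopscale (a * b) v.
Proof. by rewrite /lopscale ractA; congr ract; rewrite lKM mulrC. Qed.
Lemma lopscale1 : left_id 1 lopscale.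
Proof. by move=> x; rewrite /lopscale lK1 ract1. Qed.
Lemma lopscaleDr : right_distributive lopscale +%R.
Proof. by move=> a x y; apply: ractDl. Qed.
Lemma lopscaleDl v : {morph lopscale^~ v: a b / a + b}.
Proof. by move=> a b; rewrite -[RHS]ractDr /lopscale lKD. Qed.

HB.instance Definition _ := GRing.Zmodule_isLmodule.Build K lcar
  lopscaleA lopscale1 lopscaleDr lopscaleDl.

Lemma ract_lK (x : M) a c : ract (ract x (lK c)) a = ract (ract x a) (lK c).
Proof. by rewrite !ractA lK_comm. Qed.

Definition lop : opmod K E.
Proof.
apply: (@OpMod K E lcar (fun n x => gm_comp n (x : M))
  (fun v x => ract (x : M) (lV v)) (fun e x => ract (x : M) (lE e))).
- exact: (gm_grading M).
- by move=> n c x xn; have := @ract_comp _ M n 0 x _ xn (@lK_comp K E c); rewrite addr0.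
- by move=> v a x y; rewrite ractDl; congr (_ + _); apply: ract_lK.
- by move=> e a x y; rewrite ractDl; congr (_ + _); apply: ract_lK.
- by move=> n v x xn; have := @ract_comp _ M n 0 x _ xn (@lV_comp K E v); rewrite addr0.
- by move=> n e x xn; exact: (@ract_comp _ M n 1 x _ xn (@lE_comp K E e)).
- move=> v w x; rewrite ractA lV_mul.
  by case: ifP => // _; apply: ract0.
- by move=> x; rewrite -ract_sumr lV_sum ract1.
- by move=> e x; rewrite ractA lV_lE.
- by move=> e x; rewrite ractA lE_lV.
Defined.

(** Without sinks the second Cuntz-Krieger relation holds at every vertex; the sum over all vertices
    is 1. *)
Lemma ract_lE_lG (x : M) : \sum_e ract (ract x (lE e)) (lG e) = x.
Proof.
under eq_bigr do rewrite ractA.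
rewrite -ract_sumr -[RHS]ract1 -lV_sum; congr ract.
rewrite (partition_big (@src E) xpredT) //=; apply: eq_bigr => v _.
exact: lE_lG.
Qed.

(** The solution is the sum of the y_e e^*: the first Cuntz-Krieger relation shows that it is one,
    the second that it is the only one. *)
Lemma lop_closed : closed lop.
Proof.
move=> y yr; exists (\sum_e ract (y e : M) (lG e)); split=> [f|x' x'P].
  rewrite -[LHS]/(ract _ (lE f)) ract_suml (bigD1 f) //= ractA lG_lE eqxx.
  rewrite -[ract _ _]/(op_v (rng f) (y f)) yr big1 ?addr0 // => e /negPf ef.
  by rewrite ractA lG_lE ef ract0.
by rewrite -[LHS]ract_lE_lG; apply: eq_bigr => e _; rewrite -x'P.
Qed.

End Underlying.

Definition lop_hom (M N : grmod L) (f : grhom M N) : ophom (lop M) (lop N).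
Proof.
apply: (@OpHom _ _ (lop M) (lop N) (f : M -> N)).
- by move=> a x y; rewrite linearD; congr (_ + _); apply: grhom_ract.
- exact: grhom_deg.
- by move=> v x; apply: grhom_ract.
- by move=> e x; apply: grhom_ract.
Defined.

Lemma lop_hom_id (M : grmod L) : lop_hom (grhom_id M) = ophom_id (lop M).
Proof. exact: ophom_eq. Qed.

Lemma lop_hom_comp (M N Q : grmod L) (g : grhom N Q) (f : grhom M N) :
  lop_hom (grhom_comp g f) = ophom_comp (lop_hom g) (lop_hom f).
Proof. exact: ophom_eq. Qed.

(** Compatibility with ghost edges is automatic: the two candidates for the image of x e^* have
    equal products with all edges, and the target is closed. *)
Lemma lop_full (M N : grmod L) (f : ophom (lop M) (lop N)) :
  exists g : grhom M N, forall x, g x = f x.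
Proof.
have fG e (x : M) : f (ract x (lG e)) = ract (f x : N) (lG e).
  apply/eqP; rewrite -subr_eq0; apply/eqP; apply: (closed_inj (@lop_closed N)) => e'.
  apply: etrans (linearB (op_e (M := lop N) e') _ _) _.
  apply/eqP; rewrite subr_eq0; apply/eqP.
  apply: etrans (esym (oh_e f e' (ract x (lG e) : lop M))) _.
  apply: etrans (congr1 f (ractA x (lG e) (lE e'))) _.
  apply: etrans (esym (ractA (f x : N) (lG e) (lE e'))); rewrite lG_lE.
  case: ifP => _; last by rewrite !ract0 oh0.
  exact: (oh_v f).
have fa (a : L) (x : M) : f (ract x a) = ract (f x : N) a.
  elim/leavitt_ind: a x => [a b Ha Hb x|c x|g a Ha x].
  - by rewrite !ractDr ohD Ha Hb.
  - exact: (ohZ f).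
  rewrite -ractA Ha -[in RHS]ractA; congr ract.
  case: g => [v|[e|e]]; [exact: (oh_v f)|exact: (oh_e f)|exact: fG].
have fl : linear (f : M -> N).
  move=> a x y; apply: etrans (ohD f _ _) _; congr (_ + _); exact: fa.
by exists (grhom_of fl (@oh_comp _ _ _ _ f)).
Qed.

End LeavittModules.

Section LeavittRealisation.
Variables (K : fieldType) (E : finite_graph).
Hypothesis Ens : no_sinks E.
Local Notation L := (leavitt_gralgebra K E).

Section Realisation.
Variable O : opmod K E.
Hypothesis Oc : closed O.

(** The first Cuntz-Krieger relation prescribes the products of x e^* with all edges; closedness
    turns this into a definition. *)
Lemma ghost_ex (e : edge E) (x : O) : exists z : O,
  (forall f, op_e f z = if f == e then op_v (rng e) x else 0) /\
  forall z', (forall f, op_e f z' = if f == e then op_v (rng e) x else 0) -> z' = z.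
Proof.
by apply: Oc => f; case: eqP => [->|_]; rewrite ?linear0 // op_vv eqxx.
Qed.

Definition ghost e x : O := projT1 (cid (ghost_ex e x)).

Lemma op_ghost e f x : op_e f (ghost e x) = if f == e then op_v (rng e) x else 0.
Proof. exact: (projT2 (cid (ghost_ex e x))).1. Qed.

Lemma ghostU e x z :
  (forall f, op_e f z = if f == e then op_v (rng e) x else 0) -> z = ghost e x.
Proof. exact: (projT2 (cid (ghost_ex e x))).2. Qed.

Lemma ghost_linear e : linear (ghost e).
Proof.
move=> a x y; apply/esym/ghostU => f; rewrite linearP /= !op_ghost.
by case: eqP => _; rewrite ?linearP // scaler0 addr0.
Qed.

HB.instance Definition _ e := GRing.isLinear.Build K O O *:%R (ghost e) (ghost_linear e).

Lemma ghost_comp n e x : op_comp n x -> op_comp (n - 1) (ghost e x).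
Proof.
move=> xn; apply: (closed_homog Oc) => f; rewrite subrK op_ghost.
by case: ifP => _; [apply: op_vcomp|apply: grading0 (op_gr O) _].
Qed.

Definition genact (g : lgen E) (x : O) : O :=
  match g with inl v => op_v v x | inr (inl e) => op_e e x | inr (inr e) => ghost e x end.

Lemma genact_linear g : linear (genact g).
Proof. by case: g => [v|[e|e]] a x y /=; rewrite linearP. Qed.

Lemma genact_comp n g x : op_comp n x -> op_comp (n + lgen_deg g) (genact g x).
Proof.
case: g => [v|[e|e]] xn /=; first by rewrite addr0; apply: op_vcomp.
  exact: op_ecomp.
exact: ghost_comp.
Qed.

Definition wordact (m : {fmonom lgen E}) (x : O) : O :=
  foldl (fun x g => genact g x) x m.

Lemma wordact_linear m : linear (wordact m).
Proof.
case: m => s; rewrite /wordact /=; elim: s => //= g s IH a x y.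
by rewrite genact_linear IH.
Qed.

Lemma wordact_comp n m x : op_comp n x -> op_comp (n + lword_deg m) (wordact m x).
Proof.
case: m => s; rewrite /wordact /lword_deg /=; elim: s n x => [|g s IH] n x xn.
  by rewrite big_nil addr0.
by rewrite big_cons addrA; apply/IH/genact_comp.
Qed.

Lemma wordactM m m' x : wordact (mmul m m') x = wordact m' (wordact m x).
Proof. by rewrite /wordact fmM foldl_cat. Qed.

Local Notation A := {malg K[{fmonom lgen E}]}.

Definition aact (a : A) (x : O) : O := lin_ext (wordact^~ x) a.

Lemma aactDl a b x : aact (a + b) x = aact a x + aact b x.
Proof. exact: linearD. Qed.
Lemma aactZl c a x : aact (c *: a) x = c *: aact a x.
Proof. by apply: linearZ. Qed.
Lemma aact0 x : aact 0 x = 0.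
Proof. exact: linear0. Qed.
Lemma aactBl a b x : aact (a - b) x = aact a x - aact b x.
Proof. exact: linearB. Qed.
Lemma aact_sum (J : Type) (r : seq J) (P : pred J) (F : J -> A) x :
  aact (\sum_(i <- r | P i) F i) x = \sum_(i <- r | P i) aact (F i) x.
Proof. exact: linear_sum. Qed.
Lemma aactU m x : aact << m >> x = wordact m x.
Proof. exact: lin_extU. Qed.

Lemma aactP a c x y : aact a (c *: x + y) = c *: aact a x + aact a y.
Proof.
rewrite /aact -lin_extZ -lin_extD; apply: lin_ext_eqr => m.
exact: wordact_linear.
Qed.

Lemma aactDr a x y : aact a (x + y) = aact a x + aact a y.
Proof. by have := aactP a 1 x y; rewrite !scale1r. Qed.
Lemma aact0r a : aact a 0 = 0.
Proof. by have := aactP a (-1) 0 0; rewrite !scaleN1r !addNr. Qed.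
Lemma aactZr a c x : aact a (c *: x) = c *: aact a x.
Proof. by have := aactP a c x 0; rewrite !addr0 aact0r addr0. Qed.

Lemma aactM a b x : aact (a * b) x = aact b (aact a x).
Proof.
elim/malg_ind: a => [|a1 a2 h1 h2|c m].
- by rewrite mul0r aact0 aact0r.
- apply: etrans (congr1 (aact^~ x) (mulrDl a1 a2 b)) _.
  apply: etrans (aactDl _ _ _) _; apply: etrans (f_equal2 +%R h1 h2) _.
  apply: etrans (esym (aactDr _ _ _)) _; congr aact; exact: (esym (aactDl _ _ _)).
apply: etrans (congr1 (aact^~ x) (esym (scalerAl c _ b))) _.
apply: etrans (aactZl _ _ _) _.
apply: etrans (congr1 (aact b) (esym (aactZl _ _ _))).
apply: etrans (esym (aactZr _ _ _)); congr (_ *: _).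
elim/malg_ind: b => [|b1 b2 h1 h2|d m'].
- by rewrite mulr0 !aact0.
- apply: etrans (congr1 (aact^~ x) (mulrDr _ b1 b2)) _.
  apply: etrans (aactDl _ _ _) _; apply: etrans (f_equal2 +%R h1 h2) _;
    exact: (esym (aactDl _ _ _)).
apply: etrans (congr1 (aact^~ x) (esym (malg_scaleAr d _ _))) _.
apply: etrans (aactZl _ _ _) _; apply: etrans (esym (aactZl _ _ _)); congr (_ *: _).
apply: etrans (congr1 (aact^~ x) (malg_UM K m m')) _.
apply: etrans (aactU _ _) _; apply: etrans (esym (aactU _ _)).
by rewrite wordactM (aactU m x).
Qed.

Lemma aact1 x : aact 1 x = x.
Proof. by apply: etrans (aactU mone x) _; rewrite /wordact fm1. Qed.

Lemma aact_gen g x : aact << fmu g >> x = genact g x.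
Proof. by rewrite aactU /wordact fmU. Qed.

Lemma aact_rel a b x : leavitt_rel a b -> aact a x = aact b x.
Proof.
case=> [|v w|e|e|e|e|e f|v _].
- rewrite aact_sum aact1 -[RHS]op_v1.
  by apply: eq_bigr => v _; apply: aact_gen.
- rewrite aactM !aact_gen /= op_vv; case: ifP => _; last by rewrite aact0.
  by rewrite aact_gen.
- by rewrite aactM !aact_gen /= op_se.
- by rewrite aactM !aact_gen /= op_re.
- rewrite aactM !aact_gen /=; apply: ghostU => f; rewrite op_ghost op_vv eqxx.
  by [].
- rewrite aactM !aact_gen /=; apply: ghostU => f; rewrite op_ev op_ghost.
  by have [->|fe] := eqVneq f e; [rewrite eqxx|rewrite if_same].
- rewrite aactM !aact_gen /= op_ghost eq_sym; case: ifP => _; last by rewrite aact0.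
  by rewrite aact_gen.
- rewrite aact_sum aact_gen /=.
  (* Both sides of the second Cuntz-Krieger relation have the same products with all edges, so
     uniqueness in closedness identifies them. *)
  have Y f : op_v (rng f) (op_e f (op_v v x)) = op_e f (op_v v x) by rewrite op_re.
  have [z [zP zU]] := Oc Y; rewrite [RHS](zU (op_v v x)) //; apply: zU => f.
  rewrite linear_sum /= op_ev eq_sym.
  under eq_bigr do rewrite aactM !aact_gen /= op_ghost.
  case: ifP => fv; last first.
    rewrite big1 // => e /eqP ev; case: eqP => // fe.
    by rewrite fe ev eqxx in fv.
  rewrite (bigD1 f) //= eqxx op_re big1 ?addr0 // => e /andP[_ /negPf].
  by rewrite eq_sym => ->.
Qed.

Lemma aact_ideal a x : rel_ideal (@leavitt_rel K E) a -> aact a x = 0.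
Proof.
move=> Ia; elim: Ia x => [|a1 a2 _ h1 _ h2|a' b b' c r] x.
- exact: aact0.
- by rewrite aactDl h1 h2 addr0.
- by rewrite !aactM aactBl (aact_rel _ r) subrr aact0r.
Qed.

Definition lrcar : Type := O.
HB.instance Definition _ := GRing.Zmodule.on lrcar.

Definition lrscale (a : L^c) (x : lrcar) : lrcar := aact (pr_repr (a : leavitt K E)) x.

Lemma lrscaleE a x : lrscale (lpi a) x = aact a x.
Proof.
apply/eqP; rewrite -subr_eq0 -aactBl; apply/eqP/aact_ideal.
by apply/pr_piP; apply: pr_reprK.
Qed.

Lemma lrscaleA a b v : lrscale a (lrscale b v) = lrscale (a * b) v.
Proof.
rewrite -[a * b]/((b : leavitt K E) * (a : leavitt K E)).
have [a' <-] := lpi_surj (a : leavitt K E); have [b' <-] := lpi_surj (b : leavitt K E).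
by rewrite -lpiM !lrscaleE aactM.
Qed.
Lemma lrscale1 : left_id 1 lrscale.
Proof. by move=> v; apply: etrans (lrscaleE 1 v) _; apply: aact1. Qed.
Lemma lrscaleDr : right_distributive lrscale +%R.
Proof. by move=> a x y; apply: aactDr. Qed.
Lemma lrscaleDl v : {morph lrscale^~ v: a b / a + b}.
Proof.
move=> a b; have [a' <-] := lpi_surj (a : leavitt K E).
have [b' <-] := lpi_surj (b : leavitt K E).
by apply: etrans (congr1 (lrscale^~ v) (esym (lpiD a' b'))) _; rewrite !lrscaleE aactDl.
Qed.

HB.instance Definition _ := GRing.Zmodule_isLmodule.Build L^c lrcar
  lrscaleA lrscale1 lrscaleDr lrscaleDl.

Lemma lrcompZ m n (x : lrcar) (a : L) :
  op_comp m (x : O) -> gr_comp n a -> op_comp (m + n) (((a : L^c) *: x : lrcar) : O).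
Proof.
move=> xm [a' an ->]; rewrite -[_ *: x]/(lrscale (lpi a') x) lrscaleE /aact unlock.
apply: (grading_bigsum (op_gr O)) => p _.
have [->|/an <-] := eqVneq a'@_p 0.
  by rewrite scale0r; apply: grading0 (op_gr O) _.
exact/op_compZ/wordact_comp.
Qed.

Definition lrmod : grmod L := @GrMod L lrcar (@op_comp K E O) (op_gr O) lrcompZ.

Definition lrmod_hom : ophom (lop lrmod) O.
Proof.
apply: (@OpHom _ _ (lop lrmod) O (fun x => x)).
- move=> c x y; congr (_ + _).
  apply: etrans (lrscaleE (c *: 1) x) _.
  by rewrite aactZl aact1.
- by [].
- by move=> v x; apply: etrans (lrscaleE _ x) _; apply: aact_gen.
- by move=> e x; apply: etrans (lrscaleE _ x) _; apply: aact_gen.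
Defined.

Lemma lrmod_iso : @isomorphic (OpCat K E) (lop lrmod) O.
Proof.
by exists lrmod_hom; apply: (@ophom_iso _ _ (lop lrmod) O lrmod_hom) => [x y|y] //; exists y.
Qed.

End Realisation.

Lemma Gr_equiv_Cl : equivalent_categories (Gr L) (Cl K E).
Proof.
pose F : functor (Gr L) (Cl K E) :=
  @Functor (Gr L) (Cl K E) (fun a => exist _ (lop a) (@lop_closed K E Ens a))
    (fun a b f => @lop_hom K E a b f)
    (fun a => lop_hom_id _) (fun a b c g f => lop_hom_comp _ _).
apply: (@equiv_of_fully_faithful _ _ F) => [a b g|a b f g fg|d].
- have [f fP] := lop_full Ens g; exists f; exact: ophom_eq.
- apply: grhom_eq => x.
  exact: (congr1 (fun h : ophom (lop a) (lop b) => h x) fg).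
- exists (lrmod (projT2 d)); have [f [g fg]] := lrmod_iso (projT2 d).
  by exists f, g; exact: fg.
Qed.

End LeavittRealisation.

(** * Graded K_0 as a categorical invariant *)

Section CategoricalFiniteness.
Variable C : category.

Definition jointly_epi (J : Type) (p : C) (a : J -> C) (f : forall j, hom (a j) p) : Prop :=
  forall x (g h : hom p x), (forall j, ccomp g (f j) = ccomp h (f j)) -> g = h.

Definition epi (a b : C) (q : hom a b) : Prop :=
  forall x (g h : hom b x), ccomp g q = ccomp h q -> g = h.

Definition cat_proj (p : C) : Prop := forall a b (q : hom a b) (f : hom p b),
  epi q -> exists g, ccomp q g = f.

(** Finite generation without elements, as a compactness condition on jointly epimorphic families;
    [gr_cat_fg] is the comparison. *)
Definition cat_fg (p : C) : Prop :=
  forall (J : Type) (a : J -> C) (f : forall j, hom (a j) p), jointly_epi f ->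
  exists (T : finType) (t : T -> J), jointly_epi (fun k => f (t k)).

End CategoricalFiniteness.

Section EquivalencePreserves.
Variables (C D : category) (F : functor C D).
Hypothesis full : forall a b (g : hom (F a) (F b)), exists f, fhom F f = g.
Hypothesis faithful : forall a b (f g : hom a b), fhom F f = fhom F g -> f = g.
Hypothesis esurj : forall d, exists a, isomorphic (F a) d.

Lemma functor_iso a b : isomorphic a b -> isomorphic (F a) (F b).
Proof.
move=> [f [g [gf fg]]]; exists (fhom F f), (fhom F g).
by rewrite -!fhom_comp gf fg !fhom_id.
Qed.

Let epi_cancel (a b c : D) (i : hom a b) (g h : hom b c) :
  is_iso i -> ccomp g i = ccomp h i -> g = h.
Proof. by move=> [j [_ ij]] e; rewrite -[g]ccomp1r -[h]ccomp1r -ij !ccompA e. Qed.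

Let mono_cancel (a b c : D) (i : hom b c) (g h : hom a b) :
  is_iso i -> ccomp i g = ccomp i h -> g = h.
Proof. by move=> [j [ji _]] e; rewrite -[g]ccomp1l -[h]ccomp1l -ji -!ccompA e. Qed.

Lemma equiv_cat_proj p : cat_proj p -> cat_proj (F p).
Proof.
move=> pp a' b' q' f' eq'.
have [a [i ii]] := esurj a'; have [b [j jj]] := esurj b'.
have [j' [j'j jj']] := jj.
have [q Fq] := full (ccomp j' (ccomp q' i)); have [f Ff] := full (ccomp j' f').
have [x g h e|g gf] := pp _ _ q f.
  apply: faithful; apply: (@epi_cancel _ _ _ j'); first by exists j.
  apply: eq'; apply: (epi_cancel ii).
  by rewrite -!ccompA -Fq -!fhom_comp e.
exists (ccomp i (fhom F g)); apply: (@mono_cancel _ _ _ j'); first by exists j.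
by rewrite -Ff -gf fhom_comp Fq -!ccompA.
Qed.

Lemma equiv_cat_fg p : cat_fg p -> cat_fg (F p).
Proof.
move=> pf J a' f' ej.
have [a aP] := dep_choice (fun j => esurj (a' j)).
have [i iP] := dep_choice aP.
have [f fP] := dep_choice (fun j => full (ccomp (f' j) (i j))).
have [x g h e|T [t tP]] := pf J a f.
  apply: faithful; apply: ej => j; apply: (epi_cancel (iP j)).
  by rewrite -!ccompA -fP -!fhom_comp e.
exists T, t => x' g' h' e'; have [x [k kk]] := esurj x'; have [k' [k'k kk']] := kk.
have [g Fg] := full (ccomp k' g'); have [h Fh] := full (ccomp k' h').
apply: (@mono_cancel _ _ _ k'); first by exists k.
rewrite -Fg -Fh; congr fhom; apply: tP => j; apply: faithful.
by rewrite !fhom_comp Fg Fh fP !ccompA -!(ccompA k') e'.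
Qed.

End EquivalencePreserves.

Section EquivalenceFullyFaithful.

Lemma natiso_id_faithful (C D : category) (F : functor C D) (G : functor D C) :
  naturally_isomorphic (functor_comp G F) (functor_id C) ->
  forall a b (f g : hom a b), fhom F f = fhom F g -> f = g.
Proof.
move=> [t [tn ti]] a b f g fg; have [t' [_ tt']] := ti a.
rewrite -[f]ccomp1r -[g]ccomp1r -tt' !ccompA; congr ccomp.
have nf := tn _ _ f; have ng := tn _ _ g.
by rewrite -[LHS]nf -[RHS]ng /= fg.
Qed.

Lemma natiso_id_full (C D : category) (F : functor C D) (G : functor D C) :
  naturally_isomorphic (functor_comp G F) (functor_id C) ->
  naturally_isomorphic (functor_comp F G) (functor_id D) ->
  forall a b (g : hom (F a) (F b)), exists f, fhom F f = g.
Proof.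
move=> GF FG a b g; have [t [tn ti]] := GF.
have [ta' [ta't tta']] := ti a; have [tb' [tb't ttb']] := ti b.
(* [G] is faithful as well, so it suffices to compare the images under [G], which naturality of [t]
   computes. *)
exists (ccomp (t b) (ccomp (fhom G g) ta')).
apply: (natiso_id_faithful FG).
set f := ccomp (t b) _; have nf : ccomp (t b) (fhom G (fhom F f)) = ccomp f (t a) := tn _ _ f.
rewrite -[LHS]ccomp1l -[RHS]ccomp1l -tb't -!ccompA nf /f -!ccompA ta't.
by rewrite ccomp1r.
Qed.

Lemma natiso_id_esurj (C D : category) (F : functor C D) (G : functor D C) :
  naturally_isomorphic (functor_comp F G) (functor_id D) ->
  forall d, exists a, isomorphic (F a) d.
Proof. by move=> [t [_ ti]] d; exists (G d), (t d); apply: ti. Qed.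

End EquivalenceFullyFaithful.

Section GroupCompletionIso.
Variables (M N : cmonoid) (h : M -> N).
Hypothesis hb : bijective h.
Hypothesis hD : forall x y, h (cmD x y) = cmD (h x) (h y).

Lemma group_completion_iso :
  ordered_isomorphic (group_completion M) (group_completion N).
Proof.
have [k hk kh] := hb; have hi := can_inj hk.
have h0 : h (cm0 M) = cm0 N.
  by rewrite -[LHS](cm0D) cmDC -[cm0 N]kh -hD cm0D.
pose gM x := qpi (@gc_eq M) x; pose gN x := qpi (@gc_eq N) x.
pose f (x : gc_sort M) : gc_sort N := gN (h (qrepr x).1, h (qrepr x).2).
have fE a b : f (gM (a, b)) = gN (h a, h b).
  have [e /= eab] := qreprP (gc_eqP M) (a, b).
  by apply/(qpi_eq (gc_eqP N)); exists (h e); rewrite /= -!hD eab.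
exists f; split.
- exists (fun y => gM (k (qrepr y).1, k (qrepr y).2)) => [x|y].
    rewrite -(qreprK x); case: (qrepr x) => a b; rewrite -/(gM _) fE.
    have [e /= eab] := qreprP (gc_eqP N) (h a, h b).
    apply/(qpi_eq (gc_eqP M)); exists (k e) => /=; apply: hi.
    by rewrite !hD !kh.
  rewrite fE !kh -[RHS](qreprK y); congr gN; by case: (qrepr y).
- move=> x y; rewrite -(qreprK x) -(qreprK y).
  case: (qrepr x) (qrepr y) => [a b] [c d].
  rewrite [pgD _ _]gcD_pi -/(gM _) -/(gM (a, b)) -/(gM (c, d)) !fE.
  by rewrite [RHS]gcD_pi !hD.
- move=> y; split=> [[a ->]|[x [a ->] <-]].
    exists (gM (k a, cm0 M)); first by exists (k a).
    by rewrite fE kh h0.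
  by exists (h a); rewrite -/(gM _) fE h0.
Qed.

End GroupCompletionIso.

Section RegularModule.
Variables (R : gradedRing) (n : int).

Definition regcar : Type := R.
HB.instance Definition _ := GRing.Zmodule.on regcar.

Definition regscale (a : R^c) (x : regcar) : regcar := (x : R) * (a : R).

Lemma regscaleA a b v : regscale a (regscale b v) = regscale (a * b) v.
Proof. by rewrite /regscale -mulrA. Qed.
Lemma regscale1 : left_id 1 regscale.
Proof. by move=> v; apply: mulr1. Qed.
Lemma regscaleDr : right_distributive regscale +%R.
Proof. by move=> a x y; apply: mulrDl. Qed.
Lemma regscaleDl v : {morph regscale^~ v: a b / a + b}.
Proof. by move=> a b; apply: mulrDr. Qed.

HB.instance Definition _ := GRing.Zmodule_isLmodule.Build R^c regcar
  regscaleA regscale1 regscaleDr regscaleDl.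

(* The shift R(-n) of the regular module: its generator has degree n. *)
Definition regcomp k (x : regcar) : Prop := gr_comp (k - n) (x : R).

Lemma reg_grading : grading regcomp.
Proof.
have G := gr_grading R; split.
- by move=> k; apply: grading0 G _.
- by move=> k x y; apply: gradingB G _ _ _.
- move=> x; have [s [c [Cc xc]]] := grading_sum G (x : R).
  exists [seq k + n | k <- s], (fun k => c (k - n)); split=> [k|]; first exact: Cc.
  by rewrite big_map xc; apply: eq_bigr => k _; rewrite addrK.
- move=> s c us Cc c0 k ks.
  have := @grading_direct _ _ G [seq k - n | k <- s] (fun k => c (k + n)).
  rewrite map_inj_uniq ?us => [h|]; last exact: addIr.
  have h2 k' : gr_comp k' (c (k' + n) : R) by have := Cc (k' + n); rewrite /regcomp addrK.
  have h3 : \sum_(k' <- [seq k - n | k <- s]) (c (k' + n) : R) = 0.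
    by rewrite big_map -[RHS]c0; apply: eq_bigr => k' _; rewrite subrK.
  by have := h isT h2 h3 (k - n) (map_f _ ks); rewrite subrK.
Qed.

Lemma regcompZ k m (x : regcar) (a : R) :
  regcomp k x -> gr_comp m a -> regcomp (k + m) ((a : R^c) *: x).
Proof. by rewrite /regcomp addrAC; apply: gr_compM. Qed.

Definition regmod : grmod R := GrMod reg_grading regcompZ.

End RegularModule.

Section IdempotentProjectives.
Variables (R : gradedRing) (n : int) (e : R).
Hypothesis e0 : gr_comp 0 e.
Hypothesis ee : e * e = e.

Let idem (x : regmod R n) : Prop := e * (x : R) = x.
Let idem0 : idem 0. Proof. exact: mulr0. Qed.
Let idemP (a : R^c) x y : idem x -> idem y -> idem (a *: x + y).
Proof.
rewrite /idem => hx hy; apply: etrans (mulrDr _ _ _) _; rewrite hy.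
by congr (_ + _); apply: etrans (mulrA _ _ _) _; rewrite hx.
Qed.

Let idem_homog (s : seq int) (c : int -> regmod R n) : uniq s ->
  (forall k, gm_comp k (c k)) -> idem (\sum_(k <- s) c k) ->
  forall k, k \in s -> idem (c k).
Proof.
move=> us Cc es k ks; have G := gr_grading R.
have h : \sum_(k <- s) (e * (c k : R) - c k : regcar R) = 0.
  rewrite sumrB; apply/eqP; rewrite subr_eq0; apply/eqP.
  by rewrite -[RHS]es; apply/esym/mulr_sumr.
apply/eqP; rewrite -subr_eq0; apply/eqP.
have Z k' : @regcomp R n k' (e * (c k' : R) - c k' : regcar R).
  apply: (gradingB (reg_grading R n)) (Cc k').
  by rewrite /regcomp -[k' - n]add0r; apply: gr_compM e0 (Cc k').
exact: (grading_direct (reg_grading R n) us Z h ks).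
Qed.

Let idem_hs : homogeneous_submodule (regmod R n) :=
  @HomogeneousSubmodule _ (regmod R n) (Submodule idem0 idemP) idem_homog.

(** [Q] is the right ideal e R, shifted so that its generator e has degree [n]; homomorphisms out of
    it are elements of M e. The last clause, on the annihilator of the generator, is what detects
    nonzero coefficients in [free_lindep]. *)
Lemma idempotent_projective : exists (Q : grmod R) (g : Q),
  [/\ gm_comp n g, ract g e = g, (forall x, exists a, x = ract g a),
      (forall (M : grmod R) (y : M), gm_comp n y -> ract y e = y ->
         exists f : grhom Q M, f g = y)
    & (forall a, ract g a = 0 -> e * a = 0)].
Proof.
have [Q [i [ij iQ ic]]] := grsub_ex idem_hs.
have [g gE] : exists g, i g = (e : regmod R n) by apply/iQ.
have iract x a : i (ract x a) = (i x : R) * a :> R by exact: (grhom_ract i x a).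
exists Q, g; split.
- by apply: ic; rewrite gE /= /regcomp subrr.
- by apply: ij; apply: etrans (iract _ _) _; rewrite gE.
- move=> x; exists (i x : R); apply: ij; apply: esym; apply: etrans (iract _ _) _.
  by rewrite gE; apply/(iQ (i x)); exists x.
- move=> M y yn ye.
  have fl : linear (fun x : Q => ract y (i x : R)).
    move=> a x z; rewrite linearP; apply: etrans (ractDr _ _ _) _; congr (_ + _).
    by apply: etrans (esym (ractA _ _ _)) _.
  have fd k x : gm_comp k x -> gm_comp k (ract y (i x : R)).
    by move=> /(grhom_deg i) h; have := ract_comp yn h; rewrite addrC subrK.
  by exists (grhom_of fl fd); rewrite /= gE.
- move=> a ga; have := congr1 i ga; rewrite linear0 => h.
  by apply: etrans _ h; apply: esym; apply: etrans (iract _ _) _; rewrite gE.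
Qed.

End IdempotentProjectives.

Section Epimorphisms.
Variable R : gradedRing.

Lemma gr_epi (M N : grmod R) (q : grhom M N) :
  @epi (Gr R) M N q <-> forall y, exists x, q x = y.
Proof.
split=> [eq y|qs X g h gh]; last first.
  apply: grhom_eq => y; have [x <-] := qs y.
  exact: (congr1 (fun k : grhom M X => k x) gh).
have [Q [p [_ pN]]] := grquot_ex (gr_im q); apply/pN.
have h : ccomp (C := Gr R) (p : hom (C := Gr R) N Q) q = ccomp (C := Gr R) (grnull N Q) q.
  by apply: grhom_eq => x /=; apply/pN; exists x.
by rewrite (eq Q p (grnull N Q) h).
Qed.

Lemma gr_cat_proj (P : grmod R) : graded_projective P <-> @cat_proj (Gr R) P.
Proof.
split=> h M N q f.
  move=> /gr_epi qs; have [g gP] := h M N q f qs.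
  by exists g; apply: grhom_eq.
move=> qs; have [g gP] := h M N q f ((gr_epi q).2 qs).
by exists g => x; rewrite -gP.
Qed.

Section SumOfImages.
Variables (J : Type) (M : grmod R) (A : J -> grmod R) (f : forall j, grhom (A j) M).

Definition sum_images (x : M) : Prop :=
  exists l : seq {j & A j}, x = \sum_(p <- l) f (tag p) (tagged p).

Let si0 : sum_images 0. Proof. by exists [::]; rewrite big_nil. Qed.
Let siP (a : R^c) x y : sum_images x -> sum_images y -> sum_images (a *: x + y).
Proof.
move=> [l ->] [l' ->].
exists ([seq Tagged (fun j => A j) (a *: (tagged p : A (tag p))) | p : {j & A j} <- l]
        ++ l').
rewrite big_cat big_map scaler_sumr; congr (_ + _).
by apply: eq_bigr => p _ /=; rewrite linearZ.
Qed.

Let si_homog (s : seq int) (c : int -> M) : uniq s ->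
  (forall n, gm_comp n (c n)) -> sum_images (\sum_(n <- s) c n) ->
  forall n, n \in s -> sum_images (c n).
Proof.
move=> us Cc [l cl] n ns.
exists [seq Tagged (fun j => A j) (hcomp (gm_grading (A (tag p))) n (tagged p))
       | p : {j & A j} <- l].
rewrite big_map /= -(hcomp_unique_seq us Cc ns) cl.
elim/big_rec2: _ => [|p x y _ IH]; first exact: hcomp0.
rewrite hcompD IH; congr (_ + _).
have := @hcomp_morph _ _ _ _ (gm_grading (A (tag p))) (gm_grading M) (f (tag p)) 0 (linearD _).
move=> /(_ _ n (tagged p)); rewrite addr0; apply.
by move=> k z zk; rewrite addr0; apply: grhom_deg.
Qed.

Definition sum_images_hs : homogeneous_submodule M :=
  @HomogeneousSubmodule _ M (Submodule si0 siP) si_homog.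

Lemma jointly_epi_sum : @jointly_epi (Gr R) J M A f <-> forall x, sum_images x.
Proof.
split=> [ej x|si X g h gh].
  have [Q [p [_ pN]]] := grquot_ex sum_images_hs; apply/(pN x).
  suff -> : p = grnull M Q by [].
  apply: ej => j; apply: grhom_eq => a /=; apply/pN; exists [:: Tagged (fun j => A j) a].
  by rewrite big_seq1.
apply: grhom_eq => x; have [l ->] := si x; rewrite !linear_sum.
apply: eq_bigr => p _.
exact: (congr1 (fun k : grhom (A (tag p)) X => k (tagged p)) (gh (tag p))).
Qed.

End SumOfImages.

Lemma gr_cat_fg (P : grmod R) : finitely_generated P <-> @cat_fg (Gr R) P.
Proof.
split=> [[n [g gP]] J A f /jointly_epi_sum si|h].
  have /choice [l lP] i : sum_images f (g i) by apply: si.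
  exists {i : 'I_n & 'I_(size (l i))},
    (fun k => tag (tnth (in_tuple (l (tag k))) (tagged k))).
  move=> X u v uv; apply: grhom_eq => x; have [a ->] := gP x.
  rewrite !linear_sum; apply: eq_bigr => i _; rewrite !linearZ /=; congr (_ *: _).
  rewrite [g i]lP !linear_sum [LHS]big_tnth [RHS]big_tnth; apply: eq_bigr => k _ /=.
  have := uv (Tagged (fun i => 'I_(size (l i))) k).
  exact: (congr1 (fun w : grhom _ X => w (tagged (tnth (in_tuple (l i)) k)))).
(* Every homogeneous element of [P] is hit by the generator of a shifted regular module, the case e
   = 1; a finite jointly epimorphic subfamily then names finitely many generators. *)
pose J := {n : int & {x : P | gm_comp n x}}.
pose jx (j : J) : P := proj1_sig (tagged j).
have [Q QP] := dep_choice (fun j : J =>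
  @idempotent_projective R (tag j) 1 (gr_comp1 R) (mulr1 1)).
have [g {}QP] := dep_choice QP.
have [f fP] := dep_choice (fun j : J => let: And5 _ _ _ m _ := QP j in
  m P (jx j) (proj2_sig (tagged j)) (ract1 _)).
have [|T [t tP]] := h J Q f.
  apply/jointly_epi_sum => x; rewrite [x](hcomp_sum (gm_grading P)).
  exists [seq Tagged Q (g (Tagged (fun n => {x : P | gm_comp n x})
    (exist (fun x => gm_comp n x) _ (@hcompC _ _ (gm_grading P) n x))))
    | n <- hsupp (gm_grading P) x].
  by rewrite big_map; apply: eq_bigr => n _ /=; rewrite fP.
have {}tP := (jointly_epi_sum _).1 tP.
exists #|T|, (fun i => jx (t (enum_val i))) => x.
suff [a ->] : exists a : T -> R, x = \sum_k ract (jx (t k)) (a k).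
  exists (fun i => a (enum_val i)); rewrite (reindex_onto (@enum_val T predT) enum_rank) /=.
    by apply: eq_bigl => i; rewrite enum_valK eqxx.
  by move=> k _; rewrite enum_rankK.
have [l ->] := tP x; elim: l => [|[k z] l [a IH]].
  exists (fun=> 0); rewrite big_nil big1 // => k _; exact: ract0.
have [b ->] : exists b, z = ract (g (t k)) b by have [_ _ + _ _] := QP (t k); apply.
rewrite big_cons IH /= grhom_ract fP.
exists (fun k' => (if k' == k then b else 0) + a k').
rewrite (eq_bigr _ (fun k' _ => ractDr _ _ _)) big_split; congr (_ + _).
rewrite (bigD1 k) //= eqxx big1 ?addr0 // => k' /negPf ->; exact: ract0.
Qed.

End Epimorphisms.

Section GradedEquivalence.
Variables (R S : gradedRing) (F : functor (Gr R) (Gr S)).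
Hypothesis full : forall a b (g : hom (F a) (F b)), exists f, fhom F f = g.
Hypothesis faithful : forall a b (f g : hom a b), fhom F f = fhom F g -> f = g.
Hypothesis esurj : forall d, exists a, isomorphic (F a) d.

Lemma equiv_graded_projective (P : grmod R) : graded_projective P -> graded_projective (F P).
Proof. by move=> /gr_cat_proj h; apply/gr_cat_proj/equiv_cat_proj. Qed.

Lemma equiv_finitely_generated (P : grmod R) : finitely_generated P -> finitely_generated (F P).
Proof. by move=> /gr_cat_fg h; apply/gr_cat_fg/equiv_cat_fg. Qed.

Definition equiv_fgproj (P : fgproj R) : fgproj S :=
  FGProj (equiv_finitely_generated (fgp_fg P)) (equiv_graded_projective (@fgp_proj R P)).

Lemma equiv_dsum (P Q : grmod R) :
  @isomorphic (Gr S) (F (dsum P Q)) (dsum (F P : grmod S) (F Q : grmod S)).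
Proof.
pose D : Gr S := dsum (F P : grmod S) (F Q : grmod S).
pose p1 : hom D (F P) := grfst _ _; pose p2 : hom D (F Q) := grsnd _ _.
pose q1 : hom (dsum P Q : Gr R) P := grfst _ _.
pose q2 : hom (dsum P Q : Gr R) Q := grsnd _ _.
pose al : hom (F (dsum P Q)) D := grpair (fhom F q1) (fhom F q2).
have al1 : ccomp p1 al = fhom F q1 by apply: grhom_eq.
have al2 : ccomp p2 al = fhom F q2 by apply: grhom_eq.
have [c [i [j [ji ij]]]] := esurj D.
(* The sum [D] need not be in the image of [F]; replacing it by an isomorphic [F c] allows its
   projections to be lifted and paired in the source category. *)
have [u uE] := full (ccomp p1 i); have [v vE] := full (ccomp p2 i).
pose be : hom D (F (dsum P Q)) := ccomp (fhom F (grpair u v : hom c (dsum P Q : Gr R))) j.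
have be1 : ccomp (fhom F q1) be = p1.
  rewrite ccompA -fhom_comp (_ : ccomp q1 _ = u); last exact: grhom_eq.
  by rewrite uE -ccompA ij ccomp1r.
have be2 : ccomp (fhom F q2) be = p2.
  rewrite ccompA -fhom_comp (_ : ccomp q2 _ = v); last exact: grhom_eq.
  by rewrite vE -ccompA ij ccomp1r.
exists al, be; split.
  have [w wE] := full (ccomp be al); rewrite -wE -fhom_id; congr fhom.
  have w1 : ccomp q1 w = q1 by apply: faithful; rewrite fhom_comp wE ccompA be1.
  have w2 : ccomp q2 w = q2 by apply: faithful; rewrite fhom_comp wE ccompA be2.
  apply: grhom_eq => x; apply: injective_projections.
    exact: (congr1 (fun k : grhom _ P => k x) w1).
  exact: (congr1 (fun k : grhom _ Q => k x) w2).
have e1 : ccomp p1 (ccomp al be) = p1 by rewrite ccompA al1.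
have e2 : ccomp p2 (ccomp al be) = p2 by rewrite ccompA al2.
apply: grhom_eq => x; apply: injective_projections.
  exact: (congr1 (fun k : grhom D (F P) => k x) e1).
exact: (congr1 (fun k : grhom D (F Q) => k x) e2).
Qed.

End GradedEquivalence.

Lemma gr_equiv_K0gr (R S : gradedRing) :
  equivalent_categories (Gr R) (Gr S) -> ordered_isomorphic (K0gr R) (K0gr S).
Proof.
move=> [F [G [GF FG]]].
pose eF := equiv_fgproj (natiso_id_full GF FG) (natiso_id_faithful GF) (natiso_id_esurj FG).
pose eG := equiv_fgproj (natiso_id_full FG GF) (natiso_id_faithful FG) (natiso_id_esurj GF).
pose cR x := qpi (@fgp_iso R) x; pose cS x := qpi (@fgp_iso S) x.
pose h (x : Vgr R) : Vgr S := cS (eF (qrepr x)).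
pose k (x : Vgr S) : Vgr R := cR (eG (qrepr x)).
have hE P : h (cR P) = cS (eF P).
  by apply/(qpi_eq (fgp_isoP S)); apply: functor_iso; apply: (qreprP (fgp_isoP R)).
have kE P : k (cS P) = cR (eG P).
  by apply/(qpi_eq (fgp_isoP R)); apply: functor_iso; apply: (qreprP (fgp_isoP S)).
apply: (@group_completion_iso (Vgr R) (Vgr S) h).
  exists k => x; rewrite -(qreprK x) -?/(cR _) -?/(cS _).
    rewrite hE kE; apply/(qpi_eq (fgp_isoP R)).
    by have [t [_ ti]] := GF; exists (t (qrepr x : grmod R)); apply: ti.
  rewrite kE hE; apply/(qpi_eq (fgp_isoP S)).
  by have [t [_ ti]] := FG; exists (t (qrepr x : grmod S)); apply: ti.
move=> x y; rewrite -(qreprK x) -(qreprK y) -!/(cR _).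
rewrite [cmD _ _]V_add_pi -/(cR _) !hE [RHS]V_add_pi.
apply/(qpi_eq (fgp_isoP S)).
exact: (equiv_dsum (natiso_id_full GF FG) (natiso_id_faithful GF) (natiso_id_esurj FG)).
Qed.

(** * Graded finitely generated projective modules are free *)

Section FiberBijection.

Lemma fiber_bijection (I J : finType) (T : eqType) (b : I -> T) (c : J -> T) :
  (forall w, #|[pred i | b i == w]| = #|[pred j | c j == w]|) ->
  exists (s : I -> J) (t : J -> I),
    [/\ cancel s t, cancel t s & forall i, c (s i) = b i].
Proof.
move=> h; pose A w := {i | b i == w}; pose B w := {j | c j == w}.
have hAB w : #|{: A w}| = #|{: B w}| by rewrite !card_sig.
pose f w (x : A w) : B w := enum_val (cast_ord (hAB w) (enum_rank x)).
pose g w (y : B w) : A w := enum_val (cast_ord (esym (hAB w)) (enum_rank y)).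
have fK w : cancel (@f w) (@g w).
  by move=> x; rewrite /g /f enum_valK cast_ordK enum_rankK.
have gK w : cancel (@g w) (@f w).
  by move=> y; rewrite /g /f enum_valK cast_ordKV enum_rankK.
pose s i := val (@f (b i) (exist (fun i' => b i' == b i) i (eqxx (b i)))).
pose t j := val (@g (c j) (exist (fun j' => c j' == c j) j (eqxx (c j)))).
have sE w (x : A w) : s (val x) = val (f w x).
  case: x => i /= e; have ei := eqP e; subst w; congr (val (f _ _)).
  exact: val_inj.
have tE w (y : B w) : t (val y) = val (g w y).
  case: y => j /= e; have ej := eqP e; subst w; congr (val (g _ _)).
  exact: val_inj.
exists s, t; split=> [i|j|i]; first by rewrite /s tE fK.
  by rewrite /t sE gK.
by rewrite /s; case: (f _ _) => j /= /eqP.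
Qed.

End FiberBijection.

Section LinearAlgebra.
Variables (K : fieldType) (V : lmodType K).

Definition lindep (I : finType) (g : I -> V) : Prop :=
  forall c : I -> K, \sum_i c i *: g i = 0 -> forall i, c i = 0.

Lemma lindep_card (A B : finType) (g : A -> V) (h : B -> V) :
  lindep h -> (forall b, exists c : A -> K, h b = \sum_a c a *: g a) ->
  (#|B| <= #|A|)%N.
Proof.
move=> hi /choice [c cP].
pose C : 'M[K]_(#|B|, #|A|) := \matrix_(j, i) c (enum_val j) (enum_val i).
suff /eqP <- : row_free C by apply: rank_leq_col.
apply: inj_row_free => v vC; apply/rowP => j; rewrite mxE.
have := hi (fun b => v 0 (enum_rank b)) _ (enum_val j); rewrite enum_valK; apply.
under eq_bigr do rewrite cP scaler_sumr.
rewrite exchange_big big1 //= => a _.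
under eq_bigr do rewrite scalerA.
rewrite -scaler_suml -[RHS](scale0r (g a)); congr (_ *: _).
have := congr1 (fun M : 'rV_#|A| => M 0 (enum_rank a)) vC; rewrite !mxE => E; apply: etrans E.
rewrite (reindex (@enum_val B predT)) /=.
  by apply: eq_bigr => k _; rewrite !mxE enum_valK enum_rankK.
by apply: onW_bij; apply: enum_val_bij.
Qed.

Lemma lindep_left_inverse (A B : finType) (l : A -> B -> K) :
  (forall c : B -> K, (forall a, \sum_b c b * l a b = 0) -> forall b, c b = 0) ->
  exists m : B -> A -> K, forall b b', \sum_a l a b * m b' a = (b == b')%:R.
Proof.
move=> li; pose C : 'M[K]_(#|B|, #|A|) := \matrix_(j, i) l (enum_val i) (enum_val j).
have /row_freeP [D CD] : row_free C.
  apply: inj_row_free => v vC; apply/rowP => j; rewrite mxE.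
  have := li (fun b => v 0 (enum_rank b)) _ (enum_val j); rewrite enum_valK; apply=> a.
  have := congr1 (fun M : 'rV_#|A| => M 0 (enum_rank a)) vC; rewrite !mxE => E; apply: etrans E.
  rewrite (reindex (@enum_val B predT)) /=.
    by apply: eq_bigr => k _; rewrite !mxE enum_valK enum_rankK.
  by apply: onW_bij; apply: enum_val_bij.
exists (fun b a => D (enum_rank a) (enum_rank b)) => b b'.
have := congr1 (fun M : 'M_#|B| => M (enum_rank b) (enum_rank b')) CD.
rewrite !mxE (inj_eq enum_rank_inj) => E; apply: etrans E.
rewrite (reindex (@enum_val A predT)) /=.
  by apply: eq_bigr => k _; rewrite !mxE enum_valK enum_rankK.
by apply: onW_bij; apply: enum_val_bij.
Qed.

(** A minimal spanning set of indices is independent, since a relation with a nonzero coefficient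
    would allow that index to be dropped. *)
Lemma spanning_independent (I : finType) (g : I -> V) :
  exists J : {set I}, (forall i, exists c : I -> K, g i = \sum_(j in J) c j *: g j) /\
    forall c : I -> K, \sum_(j in J) c j *: g j = 0 -> forall j, j \in J -> c j = 0.
Proof.
pose p (J : {set I}) := `[< forall i, exists c : I -> K, g i = \sum_(j in J) c j *: g j >].
have [|J /minsetP [/asboolP Jp Jm]] := @ex_minset I p.
  exists setT; apply/asboolP => i; exists (fun j => (j == i)%:R).
  rewrite (bigD1 i) ?inE //= eqxx scale1r big1 ?addr0 // => j /andP[_ /negPf ->].
  by rewrite scale0r.
exists J; split=> // c c0 j jJ; apply/eqP/contraT => cj.
have gj : g j = \sum_(k in J :\ j) (- (c j)^-1 * c k) *: g k.
  have : c j *: g j = - \sum_(k in J :\ j) c k *: g k.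
    by apply/eqP; rewrite -addr_eq0 -big_setD1 // c0.
  move/(congr1 ( *:%R (c j)^-1)); rewrite scalerA mulVf // scale1r => ->.
  by rewrite scalerN -scaleNr scaler_sumr; apply: eq_bigr => k _; rewrite scalerA.
suff pJ : p (J :\ j).
  by have /setP/(_ j) := Jm _ pJ (subD1set J j); rewrite !inE eqxx jJ.
apply/asboolP => i; have [d ->] := Jp i.
exists (fun k => d k + d j * (- (c j)^-1 * c k)).
rewrite (big_setD1 j) //= gj addrC scaler_sumr -big_split /=.
by apply: eq_bigr => k _; rewrite scalerDl scalerA.
Qed.

End LinearAlgebra.

Section VertexNonzero.
Variables (K : fieldType) (E : finite_graph).
Hypothesis Ens : no_sinks E.
Local Notation P := (path_gralgebra K E).

Lemma path_from (v : vert E) k : exists s, size s = k /\ is_path v s.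
Proof.
elim: k v => [|k IH] v; first by exists [::].
have [e ev] : exists e : edge E, src e = v.
  by apply: contrapT => h; apply: (Ens (v := v)) => e ev; apply: h; exists e.
by have [s [sk ps]] := IH (rng e); exists (e :: s); rewrite /= sk ev eqxx.
Qed.

Lemma pV_not_tors (v : vert E) :
  ~ tors ((pV K v : regmod P 0) : pop (regmod P 0)).
Proof.
move=> [k h]; have [s [sk ps]] := path_from v k.
pose p : gpath E := exist (fun p => is_path p.1 p.2) (v, s) ps.
have := h s sk.
have <- : op_v v ((pV K v : regmod P 0) : pop (regmod P 0)) = pV K v.
  by apply: etrans (pV_mul K v v) _; rewrite eqxx.
have e := pop_path (M := regmod P 0) (pV K v : regmod P 0) p.
move=> h0; have {h0} := etrans e h0.
rewrite -[ract _ _]/(pV K v * pP K p) (pV_path K p)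
  => /(congr1 (fun f : {malg K[gpath E]} => f@_p)).
by rewrite mcoeffUU mcoeff0 => /eqP; rewrite oner_eq0.
Qed.

(** No basis of the Leavitt path algebra is used: the algebra acts on the germ module of the path
    algebra, where [v] acts nontrivially because arbitrarily long paths leave it. *)
Lemma lV_neq0 (v : vert E) : lV K v <> 0.
Proof.
move=> v0; pose O := reflection (pop (regmod P 0)).
pose Oc : closed O := @reflection_closed _ _ _.
have vO (x : O) : op_v v x = 0.
  rewrite -[LHS](aact_gen Oc (inl v)) -(lrscaleE Oc).
  apply: etrans (congr1 (fun a => lrscale Oc a x) v0) _.
  by rewrite -lpi0 lrscaleE aact0.
apply: (@pV_not_tors v); apply: (reflection_unit_iso (pop (regmod P 0))).1.
apply: etrans (vO (reflection_unit (pop (regmod P 0)) ((pV K v : regmod P 0) : pop (regmod P 0)))).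
rewrite -oh_v; congr (reflection_unit _ _).
by apply: esym; apply: etrans (pV_mul K v v) _; rewrite eqxx.
Qed.

End VertexNonzero.

(** * Free generators of one common degree *)

Section Frames.
Variables (K : fieldType) (E : finite_graph).
Hypothesis Ens : no_sinks E.
Local Notation L := (leavitt_gralgebra K E).
Local Notation lV := (@lV K E : _ -> L).
Local Notation lE := (@lE K E : _ -> L).
Local Notation lG := (@lG K E : _ -> L).
Local Notation lK := (@lK K E : _ -> L).

Record frame (P : grmod L) := Frame {
  fr_I :> finType;
  fr_b : fr_I -> vert E;
  fr_g : fr_I -> lop P }.

Arguments fr_b {P} F _ : rename.
Arguments fr_g {P} F _ : rename.

Definition fixed_frame (P : grmod L) m (F : frame P) : Prop :=
  (forall i, op_comp m (fr_g F i)) /\ (forall i, op_v (fr_b F i) (fr_g F i) = fr_g F i).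

Definition generating (P : grmod L) (F : frame P) : Prop :=
  forall x : P, exists a : F -> L, x = \sum_i ract (fr_g F i : P) (a i).

(** Freeness is the universal property of the sum of the modules v_i L(E) with generators in degree
    [m]; linear independence is deduced in [free_lindep]. *)
Definition free_frame (P : grmod L) m (F : frame P) : Prop :=
  [/\ fixed_frame m F, generating F
    & forall (M : grmod L) (y : F -> lop M), (forall i, op_comp m (y i)) ->
        (forall i, op_v (fr_b F i) (y i) = y i) ->
        exists f : grhom P M, forall i, f (fr_g F i) = y i].

Definition fcount (P : grmod L) (F : frame P) (w : vert E) : nat :=
  #|[pred i | fr_b F i == w]|.

Definition composable_pair (P : grmod L) (F : frame P) : {pred F * edge E} :=
  [pred x | src x.2 == fr_b F x.1].

Definition raise (P : grmod L) (F : frame P) : frame P :=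
  @Frame P {x : F * edge E | x \in @composable_pair P F}
    (fun x => rng (val x).2) (fun x => op_e (val x).2 (fr_g F (val x).1)).

Definition adjacency (v w : vert E) : nat := #|[pred e : edge E | (src e == v) && (rng e == w)]|.

Lemma big_raise (R : Type) (idx : R) (op : Monoid.com_law idx) P (F : frame P)
    (Q : pred (edge E)) (G : F -> edge E -> R) :
  \big[op/idx]_(y : raise F | Q (val y).2) G (val y).1 (val y).2
  = \big[op/idx]_i \big[op/idx]_(e | (src e == fr_b F i) && Q e) G i e.
Proof.
rewrite pair_big_dep /=.
exact/esym/(big_sub_cond (@composable_pair P F) (fun x => Q x.2) (fun x => G x.1 x.2)).
Qed.

Lemma fcount_raise P (F : frame P) w :
  fcount (raise F) w = (\sum_v fcount F v * adjacency v w)%N.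
Proof.
rewrite /fcount -sum1_card.
rewrite (@big_raise _ _ _ _ F (fun e => rng e == w) (fun _ _ => 1%N)).
rewrite (partition_big (fr_b F) xpredT) //=; apply: eq_bigr => v _.
rewrite -sum1_card big_distrl /=; apply: eq_bigr => i /eqP ->.
by rewrite mul1n /adjacency -sum1_card.
Qed.

Section Basics.
Variables (P : grmod L).
Implicit Types (F : frame P) (x : lop P).

Lemma raise_fixed m F : fixed_frame m F -> fixed_frame (m + 1) (raise F).
Proof. by move=> [Fc Fv]; split=> i; [exact: op_ecomp (Fc _)|exact: op_re]. Qed.

Lemma gen_vertex F m (x : P) : fixed_frame m F -> generating F ->
  exists a : F -> L, x = \sum_i ract (fr_g F i : P) (a i) /\
    forall i, lV (fr_b F i) * a i = a i.
Proof.
move=> [_ Fv] /(_ x) [a ->]; exists (fun i => lV (fr_b F i) * a i); split=> [|i].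
  apply: eq_bigr => i _; rewrite -ractA; congr ract.
  exact: (esym (Fv i)).
by rewrite mulrA lV_mul eqxx.
Qed.

Lemma raise_generating m F : fixed_frame m F -> generating F -> generating (raise F).
Proof.
move=> FF Fg x; have [a [-> av]] := gen_vertex x FF Fg.
exists (fun y => lG (val y).2 * a (val y).1).
rewrite (@big_raise _ _ _ _ F xpredT
  (fun i e => ract (ract (fr_g F i : P) (lE e)) (lG e * a i))).
apply: eq_bigr => i _; rewrite -{1}[a i]av -(lE_lG K (Ens (v := fr_b F i))).
rewrite mulr_suml ract_sumr; apply: eq_big => [e|e _]; first by rewrite andbT.
by rewrite ractA mulrA.
Qed.

Lemma raise_free m F : free_frame m F -> free_frame (m + 1) (raise F).
Proof.
move=> [FF Fg Fm]; split; [exact: raise_fixed|exact: raise_generating FF Fg|].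
move=> M y yc yv.
(* As x_i is the sum of the x_i e e^*, its image has to be the sum of the prescribed images of x_i e
   times e^*. *)
pose z i : lop M := \sum_(x : raise F | (val x).1 == i) ract (y x : M) (lG (val x).2).
have [i|i|f fP] := Fm M z.
- apply: (grading_bigsum (gm_grading M)) => x _.
  by have := ract_comp (yc x) (@lG_comp K E (val x).2); rewrite addrK.
- rewrite linear_sum; apply: eq_bigr => x /eqP xi.
  apply: etrans (ractA _ _ _) _; congr ract.
  have := valP x; rewrite inE /= => /eqP; rewrite xi => <-.
  exact: lG_lV.
exists f => x; apply: etrans (grhom_ract f _ _) _.
rewrite [f _]fP /z ract_suml (bigD1 x) //= ractA lG_lE eqxx big1 ?addr0 => [|x'].
  exact: yv.
move=> /andP[/eqP x1 xx']; rewrite ractA lG_lE; case: eqP => [x2|_]; last exact: ract0.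
case/eqP: xx'; apply: val_inj; rewrite [LHS]surjective_pairing [RHS]surjective_pairing.
by congr pair.
Qed.

Lemma iter_raise_free m k F : free_frame m F -> free_frame (m + k%:Z) (iter k (@raise P) F).
Proof.
move=> FF; elim: k => [|k IH] /=; first by rewrite addr0.
by rewrite -addn1 PoszD addrA; apply: raise_free.
Qed.

Lemma iter_raise_elem k F (y : iter k (@raise P) F) :
  exists i s, size s = k /\ fr_g (iter k (@raise P) F) y = wact s (fr_g F i).
Proof.
elim: k y => [|k IH] y; first by exists y, [::].
have [i [s [sk ys]]] := IH (val y).1; exists i, (rcons s (val y).2).
by rewrite size_rcons sk wact_rcons -ys.
Qed.

Definition span F x : Prop := exists c : F -> K, x = \sum_i c i *: fr_g F i.

Lemma span0 F : span F 0.
Proof. by exists (fun=> 0); rewrite big1 // => i _; rewrite scale0r. Qed.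

Lemma spanD F x y : span F x -> span F y -> span F (x + y).
Proof.
move=> [c ->] [d ->]; exists (fun i => c i + d i).
by rewrite -big_split; apply: eq_bigr => i _; rewrite scalerDl.
Qed.

Lemma spanZ F a x : span F x -> span F (a *: x).
Proof.
move=> [c ->]; exists (fun i => a * c i).
by rewrite scaler_sumr; apply: eq_bigr => i _; rewrite scalerA.
Qed.

Lemma span_gen F i : span F (fr_g F i).
Proof.
exists (fun j => (j == i)%:R); rewrite (bigD1 i) //= eqxx scale1r big1 ?addr0 //.
by move=> j /negPf ->; rewrite scale0r.
Qed.

Lemma span_raise m F e x : fixed_frame m F -> span F x -> span (raise F) (op_e e x).
Proof.
move=> [_ Fv] [c ->]; exists (fun y => if (val y).2 == e then c (val y).1 else 0).
rewrite (@big_raise _ _ _ _ F xpredT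
  (fun i e' => (if e' == e then c i else 0) *: op_e e' (fr_g F i))).
have ge i : op_e e (fr_g F i) = if fr_b F i == src e then op_e e (fr_g F i) else 0.
  by rewrite -{1}(Fv i) op_ev.
rewrite op_e_sum; apply: eq_bigr => i _; rewrite op_eZ ge.
rewrite [fr_b F i == _]eq_sym; under eq_bigl do rewrite andbT.
case: (src e =P fr_b F i) => [ei|ei].
  rewrite (bigD1 e) /= ?ei // eqxx big1 ?addr0 // => e' /andP[_ /negPf ->].
  by rewrite scale0r.
rewrite scaler0 big1 // => e' /eqP e'i; case: eqP => [ee|_]; last by rewrite scale0r.
by case: ei; rewrite -ee.
Qed.

Lemma iter_raise_fixed m k F : fixed_frame m F -> fixed_frame (m + k%:Z) (iter k (@raise P) F).
Proof.
move=> FF; elim: k => [|k IH] /=; first by rewrite addr0.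
by rewrite -addn1 PoszD addrA; apply: raise_fixed.
Qed.

Lemma span_iter_raise m F s x : fixed_frame m F -> span F x ->
  span (iter (size s) (@raise P) F) (wact s x).
Proof.
move=> FF xs; elim/last_ind: s => [|s e IH] //.
by rewrite size_rcons wact_rcons; apply: span_raise (iter_raise_fixed _ FF) IH.
Qed.

(* [absorbed F j x]: multiplying [x] by a long word [s] gives a K-combination
   of the frame obtained by raising [F] [size s + j] times; here [j] plays the
   role of the degree of [x] relative to [F]. *)
Definition absorbed F (j : int) x : Prop := exists k, forall s, (k <= size s)%N ->
  exists n : nat, n%:Z = (size s)%:Z + j /\ span (iter n (@raise P) F) (wact s x).

Lemma absorbedD F j x y : absorbed F j x -> absorbed F j y -> absorbed F j (x + y).
Proof.
move=> [k h] [l h']; exists (k + l)%N => s sk.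
have [n [nj xn]] := h s (leq_trans (leq_addr l k) sk).
have [n' [nj' yn]] := h' s (leq_trans (leq_addl k l) sk).
have nn : n' = n by apply/eqP; rewrite -eqz_nat nj nj'.
by exists n; rewrite wactD; split=> //; apply: spanD => //; rewrite -nn.
Qed.

Lemma absorbedZ F j a x : absorbed F j x -> absorbed F j (a *: x).
Proof.
move=> [k h]; exists k => s sk; have [n [nj xn]] := h s sk.
by exists n; rewrite wactZ; split=> //; apply: spanZ.
Qed.

(** An edge is prefixed to the word, and a ghost edge is cancelled by the first letter of a word; so
    a longer word makes up for each generator. *)
Lemma absorbed_gen F j x g : absorbed F j x ->
  absorbed F (j + lgen_deg g) (ract (x : P) (lpi << fmu g >> : L)).
Proof.
move=> [k h]; case: g => [v|[e|e]] /=.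
- exists k.+1; move=> -[|e s] // sk; have [n [nj xn]] := h (e :: s) (ltnW sk).
  exists n; rewrite addr0; split=> //.
  rewrite -[ract _ _]/(op_v v x) wact_v; case: ifP => // _; exact: span0.
- exists k => s sk; have [n [nj xn]] := h (e :: s) (leqW sk).
  by exists n; split=> //; move: nj => /=; lia.
(* The first letter removes the ghost edge, and the vertex that is left is swallowed by the
   second. *)
- exists k.+2 => -[|f [|f' s]] // sk.
  have [n [nj xn]] := h (f' :: s) (ltnW sk).
  exists n; split; first by move: nj => /=; lia.
  rewrite wact_cons -[op_e f _]/(ract (ract (x : P) (lG e)) (lE f)) ractA lG_lE.
  case: ifP => _; last first.
    have -> : wact (f' :: s) (ract (x : P) 0 : lop P) = 0.
      exact: etrans (congr1 (@wact _ _ (lop P) (f' :: s)) (ract0 (x : P))) (wact0 _ _).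
    exact: span0.
  rewrite -[ract _ _]/(op_v (rng e) x) wact_v; case: ifP => // _; exact: span0.
Qed.

Lemma absorbed_word F j x w : absorbed F j x ->
  absorbed F (j + lword_deg w) (ract (x : P) (lpi << w >> : L)).
Proof.
elim/fmonom_ind: w j x => [|g w IH] j x h.
  rewrite [lpi _](_ : _ = 1); last exact: lpi1.
  by rewrite ract1 /lword_deg fm1 big_nil addr0.
rewrite lword_degM -malg_UM lpiM -ractA addrA {1}/lword_deg fmU big_seq1.
exact/IH/absorbed_gen.
Qed.

Lemma homog_ind (T : choiceType) (deg : T -> int) n (Q : {malg K[T]} -> Prop) :
  Q 0 -> (forall a b, Q a -> Q b -> Q (a + b)) ->
  (forall c t, deg t = n -> Q (c *: << t >>)) -> forall a, homog deg n a -> Q a.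
Proof.
move=> Q0 QD QZ a /homog_part_id <-; elim/malg_ind: a => [|a b Ha Hb|c t].
- by rewrite linear0.
- by rewrite linearD; apply: QD.
rewrite linearZ /= /homog_part lin_extU; case: eqP => [/QZ //|_].
by rewrite scaler0.
Qed.

(** Long words cancel all ghost edges in the coefficients, so that [x] times such a word is a
    combination, with scalars only, of the frame raised equally often. This reduces questions over
    L(E) to linear algebra over K. *)
Lemma absorbed_deg0 m F x : fixed_frame m F -> generating F -> op_comp m x ->
  exists k, forall s, (k <= size s)%N ->
    span (iter (size s) (@raise P) F) (wact s x).
Proof.
move=> FF Fg xm; suff [k h] : absorbed F 0 x.
  exists k => s sk; have [n [nj xn]] := h s sk.
  by have <- : n = size s by apply/eqP; rewrite -eqz_nat nj addr0.
have [a xa] := Fg x.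
(* [x] and the generators have the same degree, so the coefficients may be replaced by their
   components of degree 0. *)
have -> : x = \sum_i (ract (fr_g F i : P) (hcomp (gr_grading L) 0 (a i)) : lop P).
  rewrite -[LHS](hcomp_id (op_gr (lop P)) xm) {1}xa.
  elim/big_rec2: _ => [|i y z _ <-]; first exact: hcomp0.
  rewrite hcompD; congr (_ + _).
  have := @hcomp_morph L P _ _ (gr_grading L) (gm_grading P) (ract (fr_g F i : P)) m.
  move=> /(_ (ractDr _) _ 0 (a i)); rewrite add0r; apply.
  by move=> k b bk; rewrite addrC; apply: ract_comp (FF.1 i) bk.
elim/big_rec: _ => [|i y _ IH].
  exists 0%N => s _; exists (size s); rewrite addr0 linear0.
  by split=> //; apply: span0.
apply: absorbedD IH; have [b b0 ->] := hcompC (gr_grading L) 0 (a i).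
apply: (homog_ind (Q := fun b => absorbed F 0 (ract (fr_g F i : P) (lpi b : L) : lop P))
  _ _ _ b0) => [|b1 b2 hb hc|c w w0].
- rewrite lpi0 ract0.
  exists 0%N => s _; exists (size s); rewrite addr0 linear0.
  by split=> //; apply: span0.
- rewrite lpiD ractDr; exact: absorbedD hb hc.
have -> : ract (fr_g F i : P) (lpi (c *: << w >>) : L)
        = c *: (ract (fr_g F i : P) (lpi << w >> : L) : lop P).
  by rewrite lKZ -[LHS]ractA.
apply: absorbedZ; rewrite -[0](addr0 0) -[X in _ + X]w0; apply: absorbed_word.
exists 0%N => s _; exists (size s); rewrite addr0; split=> //.
exact: span_iter_raise FF (span_gen i).
Qed.

(** Send the i-th generator to that of v_i L(E) and the others to 0: the relation gives c_i v_i = 0,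
    and v_i is not zero. *)
Lemma free_lindep m F : free_frame m F -> lindep (fr_g F).
Proof.
move=> [FF _ Fm] c c0 i; apply/eqP/contraT => ci; case: (@lV_neq0 K E Ens (fr_b F i)).
have idem : lV (fr_b F i) * lV (fr_b F i) = lV (fr_b F i) by rewrite lV_mul eqxx.
have [Q [g [gc gv _ _ gi]]] := idempotent_projective m (@lV_comp K E (fr_b F i)) idem.
have [j|j|f fP] := Fm Q (fun j => if j == i then g else 0).
- by case: ifP => _ //; apply: grading0 (gm_grading Q) _.
- case: eqP => [->|_]; first exact: gv.
  exact: (linear0 (op_v (M := lop Q) (fr_b F j))).
have gc0 : ract g (lK (c i)) = 0.
  have h := congr1 (lop_hom f) c0; rewrite oh_sum oh0 in h.
  apply: etrans (_ : \sum_j c j *: (if j == i then (g : lop Q) else 0) = _).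
    rewrite (bigD1 i) //= eqxx big1 ?addr0 // => j /negPf ->; exact: scaler0.
  apply: etrans h; apply: eq_bigr => j _; rewrite ohZ; congr (_ *: _).
  exact: (esym (fP j)).
have vc := gi _ gc0; rewrite -[LHS]mulr1 -(lK1 K E) -(mulfV ci) -lKM mulrA.
by apply: etrans (congr1 (fun a => a * lK (c i)^-1) vc) _; apply: mul0r.
Qed.

Lemma span_vertex m F w x : fixed_frame m F -> span F x -> op_v w x = x ->
  exists c : F -> K, x = \sum_i c i *: fr_g F i /\ forall i, fr_b F i != w -> c i = 0.
Proof.
move=> [_ Fv] [c xc] xw; exists (fun i => if fr_b F i == w then c i else 0).
split=> [|i /negPf -> //]; rewrite -xw {1}xc op_v_sum; apply: eq_bigr => i _.
rewrite op_vZ -{1}(Fv i) op_vv; case: eqP => [_|_]; last by rewrite scaler0 scale0r.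
by rewrite Fv.
Qed.

(** A comparison of dimensions at the vertex [w]: independent vectors there lie in the span of the
    generators of [F] at [w]. *)
Lemma fcount_le m (F G : frame P) w : fixed_frame m F -> fixed_frame m G ->
  lindep (fr_g G) -> (forall j, span F (fr_g G j)) -> (fcount G w <= fcount F w)%N.
Proof.
move=> FF GG Gi GF.
suff: (#|{: {j | fr_b G j == w}}| <= #|{: {i | fr_b F i == w}}|)%N by rewrite !card_sig.
pose gF (x : {i | fr_b F i == w}) : lop P := fr_g F (val x).
pose gG (x : {j | fr_b G j == w}) : lop P := fr_g G (val x).
apply: (lindep_card (g := gF) (h := gG)) => [c c0 [j jw]|[j jw]].
  pose d j := if insub j is Some y then c y else 0.
  have /(_ j) : forall j, d j = 0.
    apply: Gi; rewrite (bigID (fun j => fr_b G j == w)) /= [X in _ + X]big1 ?addr0.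
      rewrite -[RHS]c0.
      apply: etrans (big_sub [pred j | fr_b G j == w] (fun j => d j *: fr_g G j)) _.
      by apply: eq_bigr => x _; rewrite /d valK.
    by move=> i iw; rewrite /d insubN // scale0r.
  by rewrite /d insubT.
have jv := GG.2 j; rewrite (eqP jw) in jv.
have [c [jc cw]] := span_vertex FF (GF j) jv.
exists (fun x : {i | fr_b F i == w} => c (val x));
  rewrite /gG /= jc (bigID (fun i => fr_b F i == w)) /=.
rewrite [X in _ + X]big1 ?addr0 => [|i /cw ->]; last by rewrite scale0r.
exact: (big_sub [pred i | fr_b F i == w] (fun i => c i *: fr_g F i)).
Qed.

(** By [absorbed_deg0], after enough raising each frame lies in the K-span of the other, and both
    are independent. The multiplicities are only compared after raising. *)
Lemma free_frame_count m (F G : frame P) : free_frame m F -> free_frame m G ->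
  exists k, forall w, fcount (iter k (@raise P) F) w = fcount (iter k (@raise P) G) w.
Proof.
move=> FF GG; have [[F1 F2 _] [G1 G2 _]] := (FF, GG).
have /choice [k kP] j := absorbed_deg0 F1 F2 (G1.1 j).
have /choice [l lP] i := absorbed_deg0 G1 G2 (F1.1 i).
pose n := (\sum_j k j + \sum_i l i)%N; exists n => w.
apply/eqP; rewrite eqn_leq; apply/andP; split.
  apply: (fcount_le w (iter_raise_fixed n G1) (iter_raise_fixed n F1)).
    exact: free_lindep (iter_raise_free n FF).
  move=> x; have [i [s [sn ->]]] := iter_raise_elem x; rewrite -sn.
  by apply: lP; rewrite sn /n (bigD1 i) //= addnCA leq_addr.
apply: (fcount_le w (iter_raise_fixed n F1) (iter_raise_fixed n G1)).
  exact: free_lindep (iter_raise_free n GG).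
move=> x; have [j [s [sn ->]]] := iter_raise_elem x; rewrite -sn.
by apply: kP; rewrite sn /n (bigD1 j) //= -addnA leq_addr.
Qed.

End Basics.
End Frames.

Arguments fr_b {K E P} F _ : rename.
Arguments fr_g {K E P} F _ : rename.

Section FrameExistence.
Variables (K : fieldType) (E : finite_graph).
Local Notation L := (leavitt_gralgebra K E).
Local Notation lV := (@lV K E : _ -> L).
Local Notation lE := (@lE K E : _ -> L).
Local Notation lG := (@lG K E : _ -> L).
Local Notation lK := (@lK K E : _ -> L).

Lemma generating_eq (P M : grmod L) (F : frame P) (f g : grhom P M) :
  generating F -> (forall i, f (fr_g F i) = g (fr_g F i)) -> forall x, f x = g x.
Proof.
move=> Fg fg x; have [a ->] := Fg x; rewrite !linear_sum; apply: eq_bigr => i _.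
by apply: etrans (grhom_ract f _ _) _; rewrite fg; apply/esym/grhom_ract.
Qed.

Lemma generating_fg (P : grmod L) (F : frame P) : generating F -> finitely_generated P.
Proof.
move=> Fg; exists #|F|, (fun i => fr_g F (enum_val i)) => x; have [a ->] := Fg x.
exists (fun i => a (enum_val i)); rewrite (reindex (@enum_val F predT)) //=.
by apply: onW_bij; apply: enum_val_bij.
Qed.

Lemma free_projective (P : grmod L) m (F : frame P) : free_frame m F -> graded_projective P.
Proof.
move=> [[Fc Fv] Fg Fm] M N q f qs.
have /choice [x xP] i := qs (f (fr_g F i)).
(* An arbitrary preimage is cut down to the degree and vertex of the generator. *)
pose y i : lop M := op_v (fr_b F i) (hcomp (op_gr (lop M)) m (x i : lop M)).
have [i|i|g gP] := Fm M y.
- by apply: op_vcomp; apply: hcompC.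
- by rewrite op_vv eqxx.
exists g; apply: (generating_eq (f := grhom_comp q g) (g := f) Fg) => i /=.
rewrite gP; apply: etrans (oh_v (lop_hom q) _ _) _.
have := @hcomp_morph _ _ _ _ (op_gr (lop M)) (op_gr (lop N)) (lop_hom q) 0 (ohD _).
move=> /(_ _ m (x i : lop M)); rewrite addr0 => <- => [|n z]; last first.
  by rewrite addr0; apply: oh_comp.
rewrite [lop_hom q _]xP hcomp_id; last exact: (oh_comp (lop_hom f) (Fc i)).
by rewrite -[f _]/(lop_hom f (fr_g F i)) -oh_v Fv.
Qed.

Lemma free_iso (P Q : grmod L) m (F : frame P) (G : frame Q) :
  free_frame m F -> free_frame m G -> (forall w, fcount F w = fcount G w) ->
  @isomorphic (Gr L) P Q.
Proof.
move=> [[Fc Fv] Fg Fm] [[Gc Gv] Gg Gm] FG; have [s [t [st ts sb]]] := fiber_bijection FG.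
have tb j : fr_b F (t j) = fr_b G j by rewrite -[in RHS](ts j) sb.
have [i|i|f fP] := Fm Q (fun i => fr_g G (s i)); first exact: Gc.
  by rewrite -sb Gv.
have [j|j|g gP] := Gm P (fun j => fr_g F (t j)); first exact: Fc.
  by rewrite -tb Fv.
exists f, g; split; apply: grhom_eq.
  apply: (generating_eq (f := grhom_comp g f) (g := grhom_id P) Fg) => i /=.
  by rewrite fP gP st.
apply: (generating_eq (f := grhom_comp f g) (g := grhom_id Q) Gg) => j /=.
by rewrite gP fP ts.
Qed.

Lemma free_transport (P Q : grmod L) m (F : frame P) : @isomorphic (Gr L) P Q ->
  free_frame m F -> exists G : frame Q, free_frame m G /\ forall w, fcount G w = fcount F w.
Proof.
move=> [f [g [gf fg]]] [[Fc Fv] Fg Fm].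
have gfK x : (g : grhom Q P) ((f : grhom P Q) x) = x.
  exact: (congr1 (fun h : grhom P P => h x) gf).
have fgK x : (f : grhom P Q) ((g : grhom Q P) x) = x.
  exact: (congr1 (fun h : grhom Q Q => h x) fg).
exists (@Frame K E Q F (fr_b F) (fun i => (f : grhom P Q) (fr_g F i))); split=> //.
split; first split=> i /=.
- exact: (oh_comp (lop_hom f) (Fc i)).
- by apply: etrans (esym (oh_v (lop_hom f) _ _)) _; rewrite Fv.
- move=> x; have [a xa] := Fg ((g : grhom Q P) x); exists a.
  rewrite -[x]fgK xa linear_sum; apply: eq_bigr => i _; exact: grhom_ract.
- move=> M y yc yv; have [h hP] := Fm M y yc yv.
  by exists (grhom_comp h g) => i /=; rewrite gfK.
Qed.

Lemma free_dsum (P Q : grmod L) m (F : frame P) (G : frame Q) :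
  free_frame m F -> free_frame m G ->
  exists H : frame (dsum P Q), free_frame m H /\
    forall w, fcount H w = (fcount F w + fcount G w)%N.
Proof.
move=> [[Fc Fv] Fg Fm] [[Gc Gv] Gg Gm].
pose H : frame (dsum P Q) := @Frame K E (dsum P Q) (F + G)%type
  (fun x => match x with inl i => fr_b F i | inr j => fr_b G j end)
  (fun x => match x with inl i => ((fr_g F i, 0) : P * Q)%type
                    | inr j => ((0, fr_g G j) : P * Q)%type end).
exists H; split; last first.
  move=> w; rewrite /fcount -!sum1_card big_sumType /=; congr (_ + _)%N;
  by apply: eq_bigl.
split; first split=> [[i|j]|[i|j]].
- by split; [exact: Fc|exact: (grading0 (gm_grading Q))].
- by split; [exact: (grading0 (gm_grading P))|exact: Gc].
- apply: injective_projections.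
    exact: (etrans (@grhom_ract L (dsum P Q) P (grfst P Q) (fr_g F i, 0) (lV (fr_b F i))) (Fv i)).
  exact: (etrans (@grhom_ract L (dsum P Q) Q (grsnd P Q) (fr_g F i, 0) (lV (fr_b F i)))
    (@ract0l L Q (lV (fr_b F i)))).
- apply: injective_projections.
    exact: (etrans (@grhom_ract L (dsum P Q) P (grfst P Q) (0, fr_g G j) (lV (fr_b G j)))
      (@ract0l L P (lV (fr_b G j)))).
  exact: (etrans (@grhom_ract L (dsum P Q) Q (grsnd P Q) (0, fr_g G j) (lV (fr_b G j))) (Gv j)).
- move=> [x y]; have [a xa] := Fg x; have [b yb] := Gg y.
  exists (fun z => match z with inl i => a i | inr j => b j end).
  rewrite big_sumType; apply: injective_projections.
    apply/esym; rewrite -[LHS]/(grfst P Q _) linearD.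
    rewrite !(linear_sum (grfst P Q)) [X in _ + X]big1 => [|j _]; last first.
      exact: (etrans (@grhom_ract L (dsum P Q) P (grfst P Q) (0, fr_g G j) (b j))
        (@ract0l L P (b j))).
    rewrite addr0; apply: etrans (esym xa); apply: eq_bigr => i _.
    exact: grhom_ract (grfst P Q) _ _.
  apply/esym; rewrite -[LHS]/(grsnd P Q _) linearD.
  rewrite !(linear_sum (grsnd P Q)) big1 => [|i _]; last first.
    exact: (etrans (@grhom_ract L (dsum P Q) Q (grsnd P Q) (fr_g F i, 0) (a i))
      (@ract0l L Q (a i))).
  rewrite add0r; apply: etrans (esym yb); apply: eq_bigr => j _.
  exact: grhom_ract (grsnd P Q) _ _.
- move=> M y yc yv.
  have [i|i|f fP] := Fm M (fun i => y (inl i)); [exact: yc|exact: (yv (inl i))|].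
  have [j|j|g gP] := Gm M (fun j => y (inr j)); [exact: yc|exact: (yv (inr j))|].
  exists (grcopair f g) => -[i|j] /=.
    by rewrite linear0 addr0.
  by rewrite linear0 add0r.
Qed.

Lemma free_exists m (s : seq (vert E)) :
  exists (P : grmod L) (F : frame P), free_frame m F /\
    forall w, fcount F w = count_mem w s.
Proof.
elim: s => [|v s [P [F [FF Fs]]]].
  exists (zero_grmod L), (@Frame K E (zero_grmod L) void (fun x => match x with end)
    (fun x => match x with end)); split=> [|w]; last first.
    by rewrite /fcount eq_card0 // => -[].
  split; first by split=> -[].
    by move=> x; exists (fun=> 0); rewrite big_pred0 => [|[]//]; apply: thinmx0.
  by move=> M y _ _; exists (grnull _ _) => -[].
have idem : lV v * lV v = lV v by rewrite lV_mul eqxx.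
have [Q [g [gc gv gg gm _]]] := idempotent_projective m (@lV_comp K E v) idem.
pose G : frame Q := @Frame K E Q unit (fun=> v) (fun=> g).
have GG : free_frame m G.
  split; first by split.
    by move=> x; have [a ->] := gg x; exists (fun=> a);
      rewrite (bigD1 tt) //= big1 ?addr0 // => -[].
  by move=> M y yc yv; have [f fP] := gm M (y tt) (yc tt) (yv tt); exists f => -[].
have [H [HH Hs]] := free_dsum GG FF; exists (dsum Q P), H; split=> // w.
rewrite Hs Fs /=; congr (_ + _)%N; rewrite /fcount -sum1_card big_mkcond /=.
by rewrite (bigD1 tt) //= big1 ?addn0 => [|[]//]; case: eqP.
Qed.

Lemma free_exists_over m (I : finType) (b : I -> vert E) :
  exists (P : grmod L) (g : I -> lop P), free_frame m (@Frame K E P I b g).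
Proof.
have [P [F [[[Fc Fv] Fg Fm] Fs]]] := free_exists m [seq b i | i <- enum I].
have h w : #|[pred i | b i == w]| = #|[pred j | fr_b F j == w]|.
  rewrite -[RHS]/(fcount F w) Fs count_map cardE -size_filter; congr size.
  by rewrite enumT /enum_mem; apply: eq_filter => i; rewrite !inE.
have [s [t [st ts sb]]] := fiber_bijection h.
exists P, (fun i => fr_g F (s i)); split; first split=> i /=; first exact: Fc.
- exact: etrans (congr1 (fun v => op_v v (fr_g F (s i))) (esym (sb i))) (Fv (s i)).
- move=> x; have [a ->] := Fg x; exists (fun i => a (s i)).
  by rewrite (reindex s) //=; apply: onW_bij; exists t.
- move=> M y yc yv; have [j|j|f fP] := Fm M (fun j => y (t j)); first exact: yc.
    by have := yv (t j); rewrite /= -sb ts.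
  by exists f => i /=; rewrite fP st.
Qed.
End FrameExistence.

Section ProjectivesAreFree.
Variables (K : fieldType) (E : finite_graph).
Hypothesis Ens : no_sinks E.
Local Notation L := (leavitt_gralgebra K E).
Local Notation lV := (@lV K E : _ -> L).
Local Notation lE := (@lE K E : _ -> L).
Local Notation lG := (@lG K E : _ -> L).
Local Notation lK := (@lK K E : _ -> L).

Section Generators.
Variable P : grmod L.

Definition generated (l : seq (vert E * P)) (x : P) : Prop :=
  forall N : submodule P, (forall p, p \in l -> N p.2) -> N x.

Definition level (m : int) (l : seq (vert E * P)) : Prop := forall p, p \in l ->
  op_comp m (p.2 : lop P) /\ op_v p.1 (p.2 : lop P) = p.2.

(** The element is the sum of the y e e^*, so it is generated one degree higher, and so on. At least
    one step is made: [y] itself need not lie at a vertex, while y e lies at the range of e. *)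
Lemma homogeneous_level k d (y : lop P) : op_comp d y ->
  exists l, level (d + k.+1%:Z) l /\ generated l y.
Proof.
elim: k d y => [|k IH] d y yd.
  exists [seq (rng e, op_e e y) | e <- enum (edge E)]; split.
    by move=> _ /mapP [e _ ->]; split; [exact: op_ecomp yd|exact: op_re].
  move=> N NP; rewrite -[y](ract_lE_lG Ens (y : P)); apply: sm_sum => e _.
  by apply: smZ; apply: (NP (rng e, op_e e y)); apply: map_f; rewrite mem_enum.
have /choice [l lP] e := IH (d + 1) (op_e e y) (op_ecomp e yd).
exists (flatten [seq l e | e <- enum (edge E)]); split.
  move=> p /flatten_mapP [e _ pl]; rewrite -[k.+2]add1n PoszD addrA.
  exact: (lP e).1.
move=> N NP; rewrite -[y](ract_lE_lG Ens (y : P)); apply: sm_sum => e _.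
apply: smZ; apply: (lP e).2 => p pl; apply: NP.
by apply/flatten_mapP; exists e; rewrite ?mem_enum.
Qed.

Lemma eventually_level (x : lop P) : exists m0, forall m, m0 <= m ->
  exists l, level m l /\ generated l x.
Proof.
elim/(@grading_ind _ _ (op_gr (lop P))) : x => [|x y [m hx] [m' hy]|n x xn].
- by exists 0 => m _; exists [::]; split=> // N _; apply: sm0.
- exists (Num.max m m') => n; rewrite ge_max => /andP[/hx [l [l1 l2]] /hy [l' [l1' l2']]].
  exists (l ++ l'); split=> [p|N NP]; first by rewrite mem_cat => /orP[/l1|/l1'].
  by apply: smD; [apply: l2|apply: l2'] => p pl; apply: NP; rewrite mem_cat pl ?orbT.
- exists (n + 1) => m nm; have [k ->] : exists k : nat, m = n + k.+1%:Z.
    by exists (absz (m - n - 1)%R); move: (m : int) nm => {}m nm; lia.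
  exact: homogeneous_level.
Qed.

Lemma generating_frame : finitely_generated P ->
  exists m (F : frame P), fixed_frame m F /\ generating F.
Proof.
move=> [n [z zP]]; have /choice [m0 m0P] i := eventually_level (z i : lop P).
(* A degree beyond all the bounds [m0 i], so that all generators can be moved to it. *)
pose m := \sum_i `|m0 i|.
have /choice [l lP] i : exists l, level m l /\ generated l (z i).
  apply: m0P; rewrite /m (bigD1 i) //= -[X in X <= _]addr0; apply: lerD.
    exact: ler_norm.
  by apply: sumr_ge0.
pose t := flatten [seq l i | i <- enum 'I_n].
have tl : level m t by move=> p /flatten_mapP [i _ pl]; apply: (lP i).1.
pose F : frame P := @Frame K E P 'I_(size t) (fun i => (tnth (in_tuple t) i).1)
  (fun i => ((tnth (in_tuple t) i).2 : lop P)).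
have tF i : tnth (in_tuple t) i \in t by apply: mem_tnth.
exists m, F; split; first by split=> i; have [] := tl _ (tF i).
have N0 : exists a : F -> L, (0 : P) = \sum_i ract (fr_g F i : P) (a i).
  by exists (fun=> 0); rewrite big1 // => i _; apply: ract0.
have NP (c : L^c) (x y : P) : (exists a : F -> L, x = \sum_i ract (fr_g F i : P) (a i)) ->
    (exists a : F -> L, y = \sum_i ract (fr_g F i : P) (a i)) ->
    exists a : F -> L, c *: x + y = \sum_i ract (fr_g F i : P) (a i).
  move=> [a ->] [b ->]; exists (fun i => a i * (c : L) + b i).
  rewrite -[c *: _]/(ract _ (c : L)) ract_suml -big_split.
  by apply: eq_bigr => i _; rewrite ractDr ractA.
pose N := Submodule N0 NP.
move=> x; suff : N x by [].
have [a ->] := zP x; apply: sm_sum => i _; apply: smZ; apply: (lP i).2 => p pl.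
have : p \in t by apply/flatten_mapP; exists i; rewrite ?mem_enum.
move=> /(nthP p) [j jt <-]; exists (fun k : F => if k == Ordinal jt then 1 else 0).
rewrite (bigD1 (Ordinal jt)) //= eqxx ract1 big1 => [|k /negPf ->]; last exact: ract0.
by rewrite addr0 (tnth_nth p).
Qed.

End Generators.

Section Splitting.
Variables (P Q : grmod L) (m : int) (H : frame Q) (p : grhom Q P) (s : grhom P Q).
Hypothesis HF : free_frame m H.
Hypothesis ps : forall x, p (s x) = x.
Hypothesis sp : forall j, span H (s (p (fr_g H j))).

Let g (j : H) : lop P := p (fr_g H j).

(** By [sp] the idempotent [s] after [p] is a matrix over K in the frame of [Q]. Hence a subset of
    the [g j], independent over K, generates [P], and freeness comes down to inverting a scalar
    matrix on one side. *)
Lemma split_free : exists F : frame P, free_frame m F.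
Proof.
have [[Hc Hv] Hg Hm] := HF; have [J [Jg Ji]] := spanning_independent g.
pose F : frame P := @Frame K E P {j | j \in J} (fun x => fr_b H (val x)) (fun x => g (val x)).
have gv j : op_v (fr_b H j) (g j) = g j.
  by rewrite -[g j]/(lop_hom p (fr_g H j)) -oh_v Hv.
have gc j : op_comp m (g j) by exact: (oh_comp (lop_hom p) (Hc j)).
exists F; split; first by split=> x; [exact: gc|exact: gv].
  move=> x; have [a sa] := Hg (s x).
  have /choice [c cP] i : exists c : F -> L, (g i : P) = \sum_x ract (fr_g F x : P) (c x).
    have [c ->] := Jg i; exists (fun x => lK (c (val x))).
    exact: (big_sub (mem J) (fun j => c j *: g j)).
  exists (fun x => \sum_i c i x * a i); rewrite -[LHS]ps sa linear_sum.
  under [RHS]eq_bigr do rewrite ract_sumr.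
  rewrite exchange_big /=; apply: eq_bigr => i _.
  apply: etrans (grhom_ract p _ _) _; rewrite -[p _]/(g i : P) cP ract_suml.
  by apply: eq_bigr => y _; rewrite ractA.
move=> M y yc yv.
have /choice [l lP] j := span_vertex (conj Hc Hv) (sp j)
  (etrans (esym (oh_v (lop_hom s) (fr_b H j) (g j))) (congr1 (lop_hom s) (gv j))).
(* The coefficient rows of the chosen vectors are independent because [s] is injective. *)
have [c c0|mu muP] := @lindep_left_inverse K H F (fun a b => l (val b) a).
  pose d j := if insub j is Some b then c b else 0 : K.
  have dv (b : F) : d (val b) = c b by rewrite /d valK.
  have d0 : \sum_(j in J) d j *: g j = 0.
    rewrite -[LHS]ps -[RHS](linear0 p); congr (p _).
    rewrite -[s _]/(lop_hom s (\sum_(j in J) d j *: g j)) oh_sum.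
    apply: etrans (big_sub (mem J) (fun j => lop_hom s (d j *: g j))) _.
    apply: etrans (_ : \sum_(b : F) \sum_a (c b * l (val b) a) *: fr_g H a = _).
      apply: eq_bigr => b _; rewrite ohZ dv -[lop_hom s _]/(s (p (fr_g H (val b)))).
      by rewrite (lP (val b)).1 scaler_sumr; apply: eq_bigr => a _; rewrite scalerA.
    by rewrite exchange_big big1 //= => a _; rewrite -scaler_suml c0 scale0r.
  by move=> b; rewrite -dv; apply: Ji d0 _ (valP b).
(* Chosen so that the matrix [l] followed by [mu] is the identity and [u] after [s] sends each [g b]
   to [y b]. *)
pose z a : lop M := op_v (fr_b H a) (\sum_(b : F) mu b a *: y b).
have [a|a|u uP] := Hm M z.
- apply: op_vcomp; apply: (grading_bigsum (op_gr (lop M))) => b _.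
  exact/op_compZ/yc.
- by rewrite /z op_vv eqxx.
exists (grhom_comp u s) => b.
rewrite -[LHS]/(lop_hom u (s (p (fr_g H (val b))))) (lP (val b)).1 oh_sum.
have Z a : lop_hom u (l (val b) a *: fr_g H a)
    = op_v (fr_b F b) (l (val b) a *: \sum_(b' : F) mu b' a *: y b').
  rewrite ohZ -[lop_hom u _]/(u (fr_g H a)) uP /z op_vZ.
  have [->//|ab] := eqVneq (fr_b H a) (fr_b H (val b)).
  by rewrite (lP (val b)).2 // !scale0r.
rewrite (eq_bigr _ (fun a _ => Z a)) -op_v_sum -[RHS]yv;
  apply: (congr1 (op_v (M := lop M) (fr_b F b))).
under eq_bigr do rewrite scaler_sumr.
rewrite exchange_big (bigD1 b) //= [X in _ + X]big1 ?addr0 => [|b' bb'].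
  under eq_bigr do rewrite scalerA.
  by rewrite -scaler_suml muP eqxx scale1r.
under eq_bigr do rewrite scalerA.
by rewrite -scaler_suml muP eq_sym (negPf bb') scale0r.
Qed.

End Splitting.

(** [P] is a retract of a free module [Q]. The idempotent may have coefficients outside K, but its
    values on the frame are of the frame's degree, so they become scalar combinations once the frame
    is raised far enough. *)
Lemma fgproj_free (P : fgproj L) : exists m (F : frame P), free_frame m F.
Proof.
have [m [F [FF Fg]]] := generating_frame (fgp_fg P).
have [Q [h HF]] := @free_exists_over K E m F (fr_b F).
set H := Frame _ _ in HF; have [H1 H2 Hm] := HF.
have [p pP] := Hm P (fr_g F) FF.1 FF.2.
have ps y : exists x, p x = y.
  have [a ->] := Fg y; exists (\sum_i ract (fr_g H i : Q) (a i)).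
  rewrite linear_sum; apply: eq_bigr => i _.
  by apply: etrans (grhom_ract p _ _) _; rewrite pP.
have [s sP] := @fgp_proj _ P Q P p (grhom_id P) ps.
have /choice [k kP] i : exists k, forall w, (k <= size w)%N ->
    span (iter (size w) (@raise K E Q) H) (wact w (s (fr_g F i) : lop Q)).
  by apply: absorbed_deg0 H1 H2 _; exact: (oh_comp (lop_hom s) (FF.1 i)).
(* A common number of raisings for all the generators. *)
pose n := (\sum_i k i)%N; exists (m + n%:Z).
apply: (split_free (iter_raise_free Ens n HF) (s := s) sP) => j.
have [i [w [wn ->]]] := iter_raise_elem j.
have -> : s (p (wact w (fr_g H i))) = wact w (s (fr_g F i) : lop Q).
  by rewrite -[LHS]/(lop_hom s (lop_hom p _)) !oh_wact -[lop_hom p _]/(p (fr_g H i)) pP.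
by rewrite -wn; apply: kP; rewrite wn /n (bigD1 i) //= leq_addr.
Qed.

End ProjectivesAreFree.

(** * The ordered group K_0 as a direct limit *)

Section RowVectors.

Definition rmul (V W : finType) (b : V -> nat) (C : V -> W -> nat) : W -> nat :=
  fun w => (\sum_v b v * C v w)%N.

Definition radd (V : finType) (b c : V -> nat) : V -> nat := fun v => (b v + c v)%N.

Definition rdelta (V : finType) (v : V) : V -> nat := fun v' => (v == v').

Lemma rmulA (U V W : finType) (b : U -> nat) (C : U -> V -> nat) (D : V -> W -> nat) :
  rmul (rmul b C) D = rmul b (fun u => rmul (C u) D).
Proof.
apply/funext => w; rewrite /rmul.
under eq_bigr do rewrite big_distrl /=.
rewrite exchange_big; apply: eq_bigr => u _ /=; rewrite big_distrr /=.
by apply: eq_bigr => v _; rewrite mulnA.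
Qed.

Lemma rmulDl (V W : finType) (b c : V -> nat) (C : V -> W -> nat) :
  rmul (radd b c) C = radd (rmul b C) (rmul c C).
Proof.
apply/funext => w; rewrite /rmul /radd -big_split /=.
by apply: eq_bigr => v _; rewrite mulnDl.
Qed.

Lemma rmul_delta (V W : finType) (v : V) (C : V -> W -> nat) : rmul (rdelta v) C = C v.
Proof.
apply/funext => w; rewrite /rmul /rdelta (bigD1 v) //= eqxx mul1n big1 ?addn0 //.
by move=> v'; rewrite eq_sym => /negPf ->.
Qed.

Lemma rmul_deltar (V : finType) (b : V -> nat) : rmul b (@rdelta V) = b.
Proof.
apply/funext => w; rewrite /rmul /rdelta (bigD1 w) //= eqxx muln1 big1 ?addn0 //.
by move=> v /negPf ->; rewrite muln0.
Qed.

Variables (V : finType) (A : V -> V -> nat).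

Definition rstep k (b : V -> nat) : V -> nat := iter k (fun b => rmul b A) b.

Lemma rstepD k (b c : V -> nat) : rstep k (radd b c) = radd (rstep k b) (rstep k c).
Proof. by elim: k => //= k ->; rewrite rmulDl. Qed.

Lemma rstep_rmul (U : finType) k (b : U -> nat) (C : U -> V -> nat) :
  rstep k (rmul b C) = rmul b (fun u => rstep k (C u)).
Proof. by elim: k => //= k ->; rewrite rmulA. Qed.

Lemma rstep_add k l b : rstep (k + l) b = rstep k (rstep l b).
Proof. exact: iterD. Qed.

End RowVectors.

(** Features of the direct limit of copies of Z^V along [A] with its standard cone, expressed
    through nonnegative rows: [cl n b] is the class of the row [b] at level [n], and [dg_inj] says
    that equality in the limit is eventual equality. *)
Record dimension_group (G : preordered_group) (V : finType) (A : V -> V -> nat)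
    (cl : int -> (V -> nat) -> G) : Prop := DimensionGroup {
  dg_step : forall n b, cl (n + 1) (rmul b A) = cl n b;
  dg_inj : forall n b c, cl n b = cl n c -> exists k, rstep A k b = rstep A k c;
  dg_pos : forall x, pg_pos x -> exists n b, x = cl n b;
  dg_clpos : forall n b, pg_pos (cl n b);
  dg_add : forall n b c, cl n (radd b c) = pgD (cl n b) (cl n c) }.

Lemma pg_idem0 (G : preordered_group) (x : G) : pgD x x = x -> x = pg0 G.
Proof.
move=> xx; apply: etrans (esym (pg0D x)) _.
by apply: etrans (congr1 (fun y => pgD y x) (esym (pgND x))) _; rewrite -pgDA xx pgND.
Qed.

(** * From an isomorphism of limits to interlacing matrices *)

Section Interlacing.

Section OneStep.
Variables (G H : preordered_group) (V W : finType) (A : V -> V -> nat) (B : W -> W -> nat).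
Variables (cG : int -> (V -> nat) -> G) (cH : int -> (W -> nat) -> H).
Hypothesis dG : dimension_group A cG.
Hypothesis dH : dimension_group B cH.
Variables (f : G -> H) (g : H -> G).
Hypothesis fg : cancel f g.
Hypothesis gD : forall x y, g (pgD x y) = pgD (g x) (g y).
Hypothesis gpos : forall x, pg_pos x -> pg_pos (g x).

Lemma dg_steps n k b : cG (n + k%:Z) (rstep A k b) = cG n b.
Proof.
elim: k => [|k IH]; first by rewrite addr0.
by rewrite -addn1 PoszD addrA addn1 /rstep iterS (dg_step dG).
Qed.

Lemma g_level m (b : W -> nat) : exists n0, forall n, n0 <= n -> exists c, g (cH m b) = cG n c.
Proof.
have [n [c gc]] := dg_pos dG (gpos (dg_clpos dH m b)); exists n => n' nn'.
have -> : n' = n + (absz (n' - n)%R)%:Z by lia.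
by exists (rstep A (absz (n' - n)%R) c); rewrite dg_steps.
Qed.

Definition represents (m n : int) (D : W -> V -> nat) : Prop :=
  forall b, g (cH m b) = cG n (rmul b D).

(** Additivity carries the equality from unit rows to all rows; the zero row is covered since its
    class is idempotent, hence 0. *)
Lemma representsP m n D :
  (forall w, g (cH m (rdelta w)) = cG n (D w)) -> represents m n D.
Proof.
move=> h b; rewrite -[in LHS](rmul_deltar b).
have cl0H : cH m (fun=> 0%N) = pg0 H.
  have e0 : radd (fun=> 0%N) (fun=> 0%N) = (fun=> 0%N) :> (W -> nat) by [].
  by apply: pg_idem0; rewrite -(dg_add dH) e0.
have cl0G : cG n (fun=> 0%N) = pg0 G.
  have e0 : radd (fun=> 0%N) (fun=> 0%N) = (fun=> 0%N) :> (V -> nat) by [].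
  by apply: pg_idem0; rewrite -(dg_add dG) e0.
have g0 : g (pg0 H) = pg0 G by apply: pg_idem0; rewrite -gD pg0D.
have hk w k : g (cH m (fun w' => k * rdelta w w')%N) = cG n (fun v => k * D w v)%N.
  elim: k => [|k IH].
    rewrite (_ : (fun w' => 0 * _)%N = (fun=> 0%N)); last by apply/funext => ?; rewrite mul0n.
    rewrite (_ : (fun v => 0 * _)%N = (fun=> 0%N)); last by apply/funext => ?; rewrite mul0n.
    by rewrite cl0H g0 cl0G.
  rewrite (_ : (fun w' => _) = radd (rdelta w) (fun w' => k * rdelta w w')%N); last first.
    by apply/funext => ?; rewrite /radd mulSn.
  rewrite (_ : (fun v => _) = radd (D w) (fun v => k * D w v)%N); last first.
    by apply/funext => ?; rewrite /radd mulSn.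
  by rewrite (dg_add dH) gD h IH -(dg_add dG).
pose S s w' := (\sum_(w <- s) b w * rdelta w w')%N.
pose T s v := (\sum_(w <- s) b w * D w v)%N.
have ST s : g (cH m (S s)) = cG n (T s).
  elim: s => [|w s IH].
    rewrite (_ : S [::] = fun=> 0%N); last by apply/funext => ?; rewrite /S big_nil.
    rewrite (_ : T [::] = fun=> 0%N); last by apply/funext => ?; rewrite /T big_nil.
    by rewrite cl0H g0 cl0G.
  rewrite (_ : S (w :: s) = radd (fun w' => b w * rdelta w w')%N (S s)); last first.
    by apply/funext => ?; rewrite /S big_cons.
  rewrite (_ : T (w :: s) = radd (fun v => b w * D w v)%N (T s)); last first.
    by apply/funext => ?; rewrite /T big_cons.
  by rewrite (dg_add dH) gD hk IH -(dg_add dG).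
have := ST (index_enum W); by [].
Qed.

Lemma represents_ex m n0 : exists n D, n0 <= n /\ represents m n D.
Proof.
have /choice [l lP] w := g_level m (rdelta w).
pose n := `|n0| + \sum_w `|l w|; have ln w : l w <= n.
  rewrite /n (bigD1 w) //=; apply: le_trans (ler_norm _) _.
  by rewrite addrCA lerDl addr_ge0 // sumr_ge0.
have /choice [D DP] w := lP w n (ln w).
exists n, D; split; last exact: representsP.
by rewrite /n; apply: le_trans (ler_norm _) _; rewrite lerDl; apply: sumr_ge0.
Qed.

(** A matrix [D] for [g] satisfies the desired identity in the limit only, that is, after finitely
    many further steps for each row; [D] followed by these steps satisfies it exactly. *)
Lemma interlace_step n m (C : V -> W -> nat) :
  (forall b, f (cG n b) = cH m (rmul b C)) ->
  exists d D, represents m (n + d.+1%:Z) D /\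
    forall v, rmul (C v) D = rstep A d.+1 (rdelta v).
Proof.
(* Starting at [n + 1] makes the number of steps positive, so that the levels strictly increase. *)
move=> fC; have [n' [D [nn' DP]]] := represents_ex m (n + 1).
pose e := absz (n' - n - 1)%R; have n'E : n' = n + e.+1%:Z by rewrite /e; lia.
have /choice [k kP] v : exists k,
    rstep A k (rmul (C v) D) = rstep A k (rstep A e.+1 (rdelta v)).
  apply: (dg_inj dG (n := n')).
  by rewrite -DP -[C v]rmul_delta -fC fg n'E dg_steps.
pose q := (\sum_v k v)%N; exists (q + e)%N, (fun w => rstep A q (D w)); split.
  move=> b; rewrite DP -rstep_rmul -[LHS](dg_steps _ q) n'E; congr (cG _ _).
  by rewrite -addnS PoszD addrA addrAC.
move=> v; rewrite -rstep_rmul -addnS rstep_add.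
have kq : (k v <= q)%N by rewrite /q (bigD1 v) //= leq_addr.
by rewrite -(subnK kq) !(rstep_add A (q - k v)) kP.
Qed.

End OneStep.

Variables (G H : preordered_group) (V W : finType) (A : V -> V -> nat) (B : W -> W -> nat).
Variables (cG : int -> (V -> nat) -> G) (cH : int -> (W -> nat) -> H).
Hypothesis dG : dimension_group A cG.
Hypothesis dH : dimension_group B cH.
Hypothesis GH : ordered_isomorphic G H.

Lemma interlacing : exists (C : nat -> V -> W -> nat) (D : nat -> W -> V -> nat)
    (p q : nat -> nat),
  (forall k v, rmul (C k v) (D k) = rstep A (p k).+1 (rdelta v)) /\
  (forall k w, rmul (D k w) (C k.+1) = rstep B (q k).+1 (rdelta w)).
Proof.
have [f [[g fg gf] fD fpos]] := GH.
have gD x y : g (pgD x y) = pgD (g x) (g y).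
  by apply: (can_inj fg); rewrite fD !gf.
have fp x : pg_pos x -> pg_pos (f x) by move=> h; apply/fpos; exists x.
have gp y : pg_pos y -> pg_pos (g y) by move=> /fpos [x xp <-]; rewrite fg.
pose st := (int * int * (V -> W -> nat))%type.
pose good (s : st) := forall b, f (cG s.1.1 b) = cH s.1.2 (rmul b s.2).
pose link (s t : st) (x : (W -> V -> nat) * nat * nat) :=
  (forall v, rmul (s.2 v) x.1.1 = rstep A x.1.2.+1 (rdelta v)) /\
  (forall w, rmul (x.1.1 w) t.2 = rstep B x.2.+1 (rdelta w)).
(* One application of [interlace_step] for [g], then one with the roles of the two groups
   exchanged. *)
have next s : good s -> exists tx, good tx.1 /\ link s tx.1 tx.2.
  case: s => [[n m] C] sC.
  have [p [D [DP CD]]] := interlace_step dG dH fg gD gp sC.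
  have [q [C' [C'P DC]]] := interlace_step dH dG gf fD fp DP.
  by exists ((n + p.+1%:Z, m + q.+1%:Z, C'), (D, p, q)).
have [m [C [_ C0]]] := represents_ex dH dG fD fp 0 0.
pose nx (s : {s | good s}) : {s | good s} * ((W -> V -> nat) * nat * nat) :=
  let t := cid (next (sval s) (svalP s)) in
  (exist _ (projT1 t).1 (projT2 t).1, (projT1 t).2).
pose s0 : {s | good s} := exist _ (0, m, C) C0.
pose s k := iter k (fun s => (nx s).1) s0.
have sP k : link (sval (s k)) (sval (s k.+1)) (nx (s k)).2.
  exact: (projT2 (cid (next (sval (s k)) (svalP (s k))))).2.
exists (fun k => (sval (s k)).2), (fun k => (nx (s k)).2.1.1),
  (fun k => (nx (s k)).2.1.2), (fun k => (nx (s k)).2.2).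
by split=> k; have [h1 h2] := sP k.
Qed.

End Interlacing.

Section LeavittDimensionGroup.
Variables (K : fieldType) (E : finite_graph).
Hypothesis Ens : no_sinks E.
Local Notation L := (leavitt_gralgebra K E).
Local Notation A := (@adjacency E).
Local Notation cls := (qpi (@fgp_iso L)).
Local Notation gc := (qpi (@gc_eq (Vgr L))).

Lemma fgproj_exists m (b : vert E -> nat) :
  exists (P : fgproj L) (F : frame P), free_frame m F /\ fcount F = b.
Proof.
pose s := flatten [seq nseq (b v) v | v <- enum (vert E)].
have [P [F [FF Fs]]] := @free_exists K E m s; have [_ Fg _] := FF.
exists (FGProj (generating_fg Fg) (free_projective FF)), F; split=> //.
apply/funext => w; rewrite Fs /s count_flatten -map_comp sumnE big_map big_enum /=.
rewrite (bigD1 w) //= count_nseq /= eqxx mul1n big1 ?addn0 // => v /negPf vw.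
by rewrite count_nseq /= vw.
Qed.

Definition free_class m b : K0gr L := gc (cls (projT1 (cid (fgproj_exists m b))), cm0 _).

Lemma free_classE m b (P : fgproj L) (F : frame P) :
  free_frame m F -> fcount F = b -> free_class m b = gc (cls P, cm0 _).
Proof.
rewrite /free_class; case: cid => Q /= [G [GG Gb]] FF Fb.
by congr (gc (_, _)); apply/(qpi_eq (@fgp_isoP L)); apply: free_iso GG FF _ => w; rewrite Gb Fb.
Qed.

Lemma free_classP m b : exists (P : fgproj L) (F : frame P),
  [/\ free_frame m F, fcount F = b & free_class m b = gc (cls P, cm0 _)].
Proof.
have [P [F [FF Fb]]] := fgproj_exists m b.
by exists P, F; split=> //; apply: free_classE FF Fb.
Qed.

Lemma fcount_iter_raise P (F : @frame K E P) k :
  fcount (iter k (@raise K E P) F) = rstep A k (fcount F).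
Proof.
elim: k => //= k <-; apply/funext => w; exact: fcount_raise.
Qed.

Lemma radd_inj (V : finType) (b c d : V -> nat) : radd b d = radd c d -> b = c.
Proof. by move=> h; apply/funext => v; apply/eqP; rewrite -(eqn_add2r (d v));
  apply/eqP/(congr1 (fun f => f v) h). Qed.

(** For injectivity, equal classes in K_0 only become isomorphic after adding a module Z. As Z is
    free as well, its multiplicities can be subtracted from the rows; no cancellation of modules is
    required. *)
Lemma leavitt_dimension_group : dimension_group A free_class.
Proof.
split.
- move=> n b; have [P [F [FF Fb ->]]] := free_classP n b.
  apply: free_classE (raise_free Ens FF) _; apply/funext => w.
  by rewrite fcount_raise Fb.
- move=> n b c; have [P [F [FF Fb ->]]] := free_classP n b.
  have [Q [G [GG Gc ->]]] := free_classP n c.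
  move=> /(qpi_eq (@gc_eqP (Vgr L))) [z zP].
  have {zP} : cmD (cmD (cls P : Vgr L) (cm0 _)) z = cmD (cmD (cls Q : Vgr L) (cm0 _)) z := zP.
  rewrite !(cmDC _ (cm0 (Vgr L))) !cm0D -(qreprK z) [LHS]V_add_pi [RHS]V_add_pi.
  move=> /(qpi_eq (@fgp_isoP L)) PQ; have [m [H HH]] := fgproj_free Ens (qrepr z).
  (* The frames of [P] and [Q] are raised [i] times and that of Z [j] times, to reach one degree. *)
  have [i [j ij]] : exists i j : nat, n + i%:Z = m + j%:Z.
    case: (lerP n m) => nm; first by exists (absz (m - n)%R), 0%N; lia.
    by exists 0%N, (absz (n - m)%R); lia.
  have HH' := iter_raise_free Ens j HH; rewrite -ij in HH'.
  have [X [XX Xc]] := free_dsum (iter_raise_free Ens i FF) HH'.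
  have [Y [YY Yc]] := free_dsum (iter_raise_free Ens i GG) HH'.
  have [X' [XX' X'c]] := free_transport PQ XX.
  have [k kP] := free_frame_count Ens XX' YY.
  exists (k + i)%N; rewrite !rstep_add.
  have := funext kP; rewrite !fcount_iter_raise.
  have -> : fcount X' = radd (rstep A i b) (fcount (iter j (@raise K E _) H)).
    by apply/funext => w; rewrite X'c Xc fcount_iter_raise Fb.
  have -> : fcount Y = radd (rstep A i c) (fcount (iter j (@raise K E _) H)).
    by apply/funext => w; rewrite Yc fcount_iter_raise Gc.
  by rewrite !rstepD => /radd_inj.
- move=> _ [z ->]; rewrite -(qreprK z); have [m [F FF]] := fgproj_free Ens (qrepr z).
  by exists m, (fcount F); apply/esym/(free_classE FF).
- by move=> n b; eexists.
- move=> n b c; have [P [F [FF Fb ->]]] := free_classP n b.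
  have [Q [G [GG Gc ->]]] := free_classP n c.
  have [X [XX Xc]] := free_dsum FF GG.
  rewrite [RHS]gcD_pi cm0D [cmD _ _]V_add_pi.
  by apply: (@free_classE _ _ (fgp_dsum P Q) X XX); apply/funext => w; rewrite Xc Fb Gc.
Qed.

End LeavittDimensionGroup.

(** * Ladders and the transfer functor *)

Section ClosedPaths.
Variables (K : fieldType) (E : finite_graph) (M : opmod K E).
Hypothesis Mc : closed M.
Implicit Types (v : vert E) (s : seq (edge E)).

Lemma wactB s (x y : M) : wact s (x - y) = wact s x - wact s y.
Proof. exact: linearB. Qed.

Definition path_end v s := last v (map rng s).

Lemma closed_paths_inj l v (x y : M) : op_v v x = x -> op_v v y = y ->
  (forall s, size s = l -> is_path v s -> wact s x = wact s y) -> x = y.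
Proof.
move=> xv yv h; apply/eqP; rewrite -subr_eq0; apply/eqP/(closed_inj_words Mc (k := l)) => s sl.
rewrite wactB; have [sp|sp] := boolP (is_path v s); first by rewrite h // subrr.
by rewrite -xv -yv !wact_not_path // subrr.
Qed.

(** This is [closed_words] for the family extended by zero to the words that are not paths from [v].
    The positive length lets the first letter force the solution to lie at [v]. *)
Lemma closed_paths l n v (y : seq (edge E) -> M) :
  (forall s, size s = l.+1 -> is_path v s -> op_v (path_end v s) (y s) = y s) ->
  (forall s, size s = l.+1 -> is_path v s -> op_comp (n + l.+1%:Z) (y s)) ->
  exists x : M, [/\ op_comp n x, op_v v x = x &
    forall s, size s = l.+1 -> is_path v s -> wact s x = y s].
Proof.
move=> yv yc; pose y' s := if is_path v s then y s else 0.
have [s sl sN|s e sl|x xP] := @closed_words K E M Mc l.+1 y'.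
- rewrite /y'; case: ifP => // sp; case/negP: sN.
  by case: s {sl} sp => //= e s /andP[_ ->]; rewrite eqxx.
- rewrite /y'; case: ifP => [sp|_]; last exact: linear0.
  have := yv _ _ sp; rewrite size_rcons sl => /(_ erefl).
  by rewrite /path_end map_rcons last_rcons.
have xv : op_v v x = x.
  apply/eqP; rewrite -subr_eq0; apply/eqP/(closed_inj_words Mc (k := l.+1)) => s sl.
  rewrite wactB; case: s sl => // e s sl; rewrite /= wact_v xP //.
  case: eqP => [_|ve]; first by rewrite subrr.
  rewrite /y'; case: ifP => [/andP[/eqP sv _]|_]; first by case: ve.
  by rewrite subrr.
exists x; split=> // [|s sl sp]; last by rewrite xP // /y' sp.
apply: (closed_homog_words Mc (k := l.+1)) => s sl; rewrite xP // /y'.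
by case: ifP => [sp|_]; [exact: yc|exact: (grading0 (op_gr M))].
Qed.

End ClosedPaths.

Section PathCount.
Variable E : finite_graph.

Definition path_tuple l (v w : vert E) : pred (l.-tuple (edge E)) :=
  fun s => is_path v s && (path_end v s == w).

Arguments path_tuple : clear implicits.

(** Iteration multiplies by the adjacency matrix at the end, while a path is read from its first
    edge. *)
Lemma rstep_delta_front l (v : vert E) :
  rstep (@adjacency E) l.+1 (rdelta v)
  = rmul (@adjacency E v) (fun u => rstep (@adjacency E) l (rdelta u)).
Proof.
rewrite -rstep_rmul -[in RHS]/(@rdelta (vert E)) rmul_deltar.
by rewrite /rstep iterSr rmul_delta.
Qed.

Lemma card_path_tuple l (v w : vert E) :
  #|path_tuple l v w| = rstep (@adjacency E) l (rdelta v) w.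
Proof.
elim: l v => [|l IH] v.
  rewrite -sum1_card big_mkcond /= (bigD1 [tuple]) //= big1 ?addn0 => [|t]; last first.
    by move/eqP; case; apply: tuple0.
  by rewrite /rdelta unfold_in /path_tuple /path_end /=; case: eqP.
rewrite rstep_delta_front /rmul /adjacency -sum1_card.
pose f (p : edge E * l.-tuple (edge E)) := [tuple of p.1 :: p.2].
rewrite (reindex f) /=; last first.
  exists (fun t : l.+1.-tuple (edge E) => (thead t, [tuple of behead t])) => [[e t] _|t _].
    by rewrite /f /= theadE; congr pair; apply: val_inj.
  by rewrite /f /= -tuple_eta.
transitivity (\sum_(e : edge E | src e == v) rstep (@adjacency E) l (rdelta (rng e)) w)%N.
  under [RHS]eq_bigr do rewrite -IH -sum1_card.
  rewrite pair_big_dep /=; apply: eq_bigl => -[e t].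
  by rewrite !unfold_in /path_tuple /path_end /= andbA.
rewrite (partition_big rng xpredT) //=; apply: eq_bigr => u _.
by rewrite -sum1_card big_distrl /=; apply: eq_bigr => e /andP[_ /eqP ->]; rewrite mul1n.
Qed.

End PathCount.

Arguments path_tuple {E} l v w _.

(** * Factoring paths through bipartite graphs *)

Section Factorisation.
Variables (G : finite_graph) (W : finType) (l : nat).
Variables (B : vert G -> W -> nat) (C : W -> vert G -> nat).

(* The edges of the bipartite graph with adjacency matrix B are the triples
   (v, w, i) with i < B v w. *)
Definition bedge (X Y : finType) : Type := (X * Y * nat)%type.
Definition bvalid (X Y : finType) (D : X -> Y -> nat) (b : bedge X Y) : bool :=
  (b.2 < D b.1.1 b.1.2)%N.

(** A bijection, preserving both ends, between composable pairs of bipartite edges and paths of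
    length [l]. The source is passed to [fc_split], as the empty word does not determine it; nothing
    is asked of [fc_split] on other words. *)
Record factorisation := Factorisation {
  fc_join : bedge (vert G) W -> bedge W (vert G) -> seq (edge G);
  fc_split : vert G -> seq (edge G) -> option (bedge (vert G) W * bedge W (vert G));
  fc_joinP : forall b c, bvalid B b -> bvalid C c -> b.1.2 = c.1.1 ->
    [/\ size (fc_join b c) = l, is_path b.1.1 (fc_join b c),
      path_end b.1.1 (fc_join b c) = c.1.2 &
      fc_split b.1.1 (fc_join b c) = Some (b, c)];
  fc_splitP : forall v s, size s = l -> is_path v s -> exists b c,
    fc_split v s = Some (b, c) /\
    [/\ bvalid B b, bvalid C c, b.1.1 = v, b.1.2 = c.1.1 & fc_join b c = s] }.

(** For given ends, the pairs and the paths are listed; the lists have equal length by the matrix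
    identity, and entries in equal positions are matched. *)
Lemma factorisation_exists :
  (forall v, rmul (B v) C = rstep (@adjacency G) l (rdelta v)) ->
  exists f : factorisation, True.
Proof.
move=> BC.
pose I v v' : finType := {w : W & ('I_(B v w) * 'I_(C w v'))%type}.
pose toL v v' (x : I v v') : bedge (vert G) W * bedge W (vert G) :=
  ((v, tag x, val (tagged x).1), (tag x, v', val (tagged x).2)).
pose L1 v v' := [seq toL v v' x | x <- enum (I v v')].
pose L2 (v v' : vert G) := [seq val t | t <- enum (path_tuple l v v')].
have sz v v' : size (L1 v v') = size (L2 v v').
  have cI : #|I v v'| = rmul (B v) C v'.
    rewrite card_tagged sumnE big_map big_enum /=.
    by apply: eq_bigr => w _; rewrite card_prod !card_ord.
  rewrite size_map; apply: etrans (etrans (esym (cardE _)) cI) _.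
  by rewrite BC -card_path_tuple cardE size_map.
have u1 v v' : uniq (L1 v v').
  rewrite map_inj_uniq ?enum_uniq // => -[w [i j]] [w' [i' j']] /= [ww ii _ jj].
  by subst w'; rewrite (val_inj ii : i = i') (val_inj jj : j = j').
have u2 v v' : uniq (L2 v v') by rewrite map_inj_uniq ?enum_uniq //; apply: val_inj.
have m1 v v' b c : reflect [/\ bvalid B b, bvalid C c, b.1.1 = v, b.1.2 = c.1.1 & c.1.2 = v']
    ((b, c) \in L1 v v').
  apply: (iffP mapP) => [[[w [i j]] _ [-> ->]]|] //=.
    by split=> //; rewrite /bvalid /= ltn_ord.
  case: b c => [[bv bw] bi] [[cw cv] ci]; rewrite /bvalid /= => -[h1 h2 e1 e2 e3].
  subst; exists (Tagged (fun w => 'I_(B v w) * 'I_(C w v'))%type (Ordinal h1, Ordinal h2)) => //.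
  by rewrite mem_enum.
have m2 v v' s : reflect [/\ size s = l, is_path v s & path_end v s = v'] (s \in L2 v v').
  apply: (iffP mapP) => [[t]|[sl sp se]].
    by rewrite mem_enum => /andP[tp /eqP te] ->; rewrite size_tuple.
  by exists (Tuple (introT eqP sl)); rewrite ?mem_enum // unfold_in /path_tuple /= sp se eqxx.
pose join b c := nth [::] (L2 b.1.1 c.1.2) (index (b, c) (L1 b.1.1 c.1.2)).
pose split v s := let v' := path_end v s in
  nth None [seq Some x | x <- L1 v v'] (index s (L2 v v')).
unshelve eexists; last by [].
exists join split => [b c hb hc bc|v s sl sp].
  have bcL : (b, c) \in L1 b.1.1 c.1.2 by apply/m1.
  have iL : (index (b, c) (L1 b.1.1 c.1.2) < size (L2 b.1.1 c.1.2))%N.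
    by rewrite -sz index_mem.
  have /m2 [jl jp je] : join b c \in L2 b.1.1 c.1.2 by apply: mem_nth.
  split=> //; rewrite /split je (nth_map (b, c)) ?index_uniq ?nth_index // sz //.
set v' := path_end v s; have sL : s \in L2 v v' by apply/m2.
have iL : (index s (L2 v v') < size (L1 v v'))%N by rewrite sz index_mem.
have [x0 _] : exists x, x \in L1 v v'.
  by case: (L1 v v') iL => // x t _; exists x; rewrite mem_head.
have := mem_nth x0 iL; set x := nth _ _ _.
have xE : split v s = Some x by rewrite /split (nth_map x0).
move=> xL; exists x.1, x.2; split; first by rewrite -surjective_pairing.
have /m1 [h1 h2 e1 e2 e3] : (x.1, x.2) \in L1 v v' by rewrite -surjective_pairing.
split=> //; rewrite /join e1 e3 -surjective_pairing /x index_uniq // nth_index //.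
Qed.

End Factorisation.

Section LevelIndex.
Variables (m : nat -> int) (g : nat -> nat).

(* If lv j = (k, d) then m k is the first of the levels m that is at
   least j, and d = m k - j. *)
Lemma level_index_exists : (forall k, m k.+1 = m k + (g k).+1%:Z) ->
  exists lv : int -> nat * nat,
  [/\ forall j, m (lv j).1 = j + (lv j).2%:Z,
      forall j, lv (j + 1) = if (lv j).2 is d.+1 then ((lv j).1, d)
                             else ((lv j).1.+1, g (lv j).1)
    & forall k, lv (m k) = (k, 0%N)].
Proof.
move=> mS; have mk k : m 0%N + k%:Z <= m k.
  by elim: k => [|k IH]; [rewrite addr0|rewrite mS; lia].
have mlt k l : (k < l)%N -> m k < m l.
  elim: l => // l IH; rewrite ltnS leq_eqVlt mS => /orP[/eqP ->|/IH]; lia.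
have ex j : exists k, j <= m k by exists (absz (j - m 0%N)); have := mk (absz (j - m 0%N)); lia.
pose k j := ex_minn (ex j).
have kP j : j <= m (k j) /\ forall l, j <= m l -> (k j <= l)%N by rewrite /k; case: ex_minnP.
have kU j l : j <= m l -> (forall i, (i < l)%N -> m i < j) -> k j = l.
  move=> h1 h2; have [p q] := kP j; have := q _ h1; rewrite leq_eqVlt => /orP[/eqP //|/h2].
  by rewrite ltNge p.
exists (fun j => (k j, absz (m (k j) - j))); split=> [j|j|l] /=.
- by have [p _] := kP j; lia.
- have [p q] := kP j; case E: (absz (m (k j) - j)%R) => [|i].
    have jk : j = m (k j) by lia.
    have -> : k (j + 1) = (k j).+1.
      apply: kU; first by rewrite mS -jk; lia.
      by move=> i; rewrite ltnS leq_eqVlt => /orP[/eqP ->|/mlt]; rewrite -jk; lia.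
    by congr pair; rewrite mS -jk; lia.
  have -> : k (j + 1) = k j; last by congr pair; lia.
  apply: kU; first by lia.
  move=> l lk; have : ~~ (j <= m l) by apply/negP => /q; rewrite leqNgt lk.
  lia.
- have -> : k (m l) = l by apply: kU => // i; apply: mlt.
  by rewrite subrr.
Qed.

End LevelIndex.

(* Levels n of E and m of F, the m-levels joined to the n-levels by the
   bipartite graphs B k, the n-levels to the next m-levels by C k. *)
Record ladder (E F : finite_graph) := Ladder {
  ld_n : nat -> int;
  ld_m : nat -> int;
  ld_h : nat -> nat;
  ld_g : nat -> nat;
  ld_nS : forall k, ld_n k.+1 = ld_n k + (ld_h k).+1%:Z;
  ld_mS : forall k, ld_m k.+1 = ld_m k + (ld_g k).+1%:Z;
  ld_B : nat -> vert F -> vert E -> nat;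
  ld_C : nat -> vert E -> vert F -> nat;
  ld_rho : forall k, factorisation (ld_g k).+1 (ld_B k) (ld_C k);
  ld_sig : forall k, factorisation (ld_h k).+1 (ld_C k) (ld_B k.+1) }.

(** The same ladder read from its first n-level, whence the shift of the m-levels. Two swaps give
    the ladder moved by one rung, not the original one. *)
Definition ladder_swap E F (d : ladder E F) : ladder F E :=
  @Ladder F E (fun k => ld_m d k.+1) (ld_n d) (fun k => ld_g d k.+1) (ld_h d)
    (fun k => ld_mS d k.+1) (ld_nS d) (ld_C d) (fun k => ld_B d k.+1)
    (ld_sig d) (fun k => ld_rho d k.+1).

(** * The transfer of closed modules along a ladder *)

Section Transfer.
Variables (K : fieldType) (E F : finite_graph) (d : ladder E F).

Definition lv : int -> nat * nat := projT1 (cid (level_index_exists (ld_mS d))).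

Lemma lv_m j : ld_m d (lv j).1 = j + (lv j).2%:Z.
Proof. by rewrite /lv; case: cid => lv []. Qed.

Lemma lvS j : lv (j + 1) = if (lv j).2 is i.+1 then ((lv j).1, i)
                           else ((lv j).1.+1, ld_g d (lv j).1).
Proof. by rewrite /lv; case: cid => lv []. Qed.

Lemma lv_level k : lv (ld_m d k) = (k, 0%N).
Proof. by rewrite /lv; case: cid => lv []. Qed.

Local Notation bE := (bedge (vert F) (vert E)).

(** The vertex [u] is used for the empty path only. *)
Definition start (u : vert F) (p : seq (edge F)) : vert F := head u (map src p).

(* The pairs of a path p from level j to the next level m k and an edge b of
   B k leaving the end of p. *)
Definition tail j (p : seq (edge F)) (b : bE) : bool :=
  [&& size p == (lv j).2, bvalid (ld_B d (lv j).1) b, is_path (start b.1.1 p) p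
    & path_end (start b.1.1 p) p == b.1.1].

Section OnModules.
Variable M : opmod K E.

Definition tr_sp : lmodType K := (seq (edge F) -> bE -> M : lmodType K).

(** In degree [j] an element of the transfer is a family of elements of [M], all of the degree of
    the next level, one for each tail and located at its end. *)
Definition tr_W j (x : tr_sp) : Prop := forall p b,
  [/\ op_comp (ld_n d (lv j).1) (x p b), op_v b.1.2 (x p b) = x p b
    & ~~ tail j p b -> x p b = 0].

Definition tr_v (v : vert F) (x : tr_sp) : tr_sp :=
  fun p b => if start b.1.1 p == v then x p b else 0.

(** Between levels [f] becomes part of the tail. At a level, [f :: p] is a full path between
    consecutive m-levels and factors into [a] and [c]; then [c] and [b] make up a path of E, which
    acts on the entry at [a]. *)
Definition tr_e j (f : edge F) (x : tr_sp) : tr_sp := fun p b =>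
  if tail (j + 1) p b && (start b.1.1 p == rng f) then
    if (lv j).2 is _.+1 then x (f :: p) b
    else if fc_split (ld_rho d (lv j).1) (src f) (f :: p) is Some (a, c) then
      wact (fc_join (ld_sig d (lv j).1) c b) (x [::] a)
    else 0
  else 0.

Lemma tail_nil j b : (lv j).2 = 0%N -> tail j [::] b = bvalid (ld_B d (lv j).1) b.
Proof. by move=> h; rewrite /tail h /path_end /= !eqxx !andbT. Qed.

Lemma tail_cons j f p b i : (lv j).2 = i.+1 ->
  tail j (f :: p) b = tail (j + 1) p b && (start b.1.1 p == rng f).
Proof.
move=> h; rewrite /tail lvS h /= eqSS eqxx /= !andbA -!(andbA _ (is_path _ _)) -!andbA.
congr (_ && (_ && _)).
rewrite /path_end /start; case: p => [|e p] /=; first by rewrite eqxx eq_sym.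
by rewrite eqxx; case: (src e == rng f); rewrite ?andbT ?andbF.
Qed.

Lemma tail_split j f p b : (lv j).2 = 0%N ->
  tail (j + 1) p b -> start b.1.1 p = rng f ->
  exists a c, [/\ bvalid (ld_B d (lv j).1) a, bvalid (ld_C d (lv j).1) c,
    bvalid (ld_B d (lv j).1.+1) b, a.1.1 = src f & a.1.2 = c.1.1 /\ c.1.2 = b.1.1] /\
    [/\ fc_split (ld_rho d (lv j).1) (src f) (f :: p) = Some (a, c) &
      fc_join (ld_rho d (lv j).1) a c = f :: p].
Proof.
move=> h; rewrite /tail lvS h => /and4P[/eqP /= sp bb pp /eqP pe] pf.
have fp : is_path (src f) (f :: p) by rewrite /= eqxx -pf.
have sz : size (f :: p) = (ld_g d (lv j).1).+1 by rewrite /= sp.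
have [a [c [sac [aB cC av ac jac]]]] := fc_splitP (ld_rho d (lv j).1) sz fp.
exists a, c; split=> //; split=> //; split=> //.
have [_ _ <- _] := fc_joinP (ld_rho d (lv j).1) aB cC ac.
by rewrite jac av -pe pf.
Qed.

Lemma tr_sp_eq (x y : tr_sp) : (forall p b, x p b = y p b) -> x = y.
Proof. by move=> h; apply/funext => p; apply/funext => b. Qed.

Lemma tr_vlin v : linear (tr_v v).
Proof.
move=> c x y; apply: tr_sp_eq => p b.
rewrite -[RHS]/(c *: tr_v v x p b + tr_v v y p b) /tr_v.
by case: ifP => // _; rewrite scaler0 addr0.
Qed.

Lemma tr_elin j f : linear (tr_e j f).
Proof.
move=> c x y; apply: tr_sp_eq => p b.
rewrite -[RHS]/(c *: tr_e j f x p b + tr_e j f y p b) /tr_e.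
case: ifP => _; last by rewrite scaler0 addr0.
case: (lv j).2 => [|//]; case: fc_split => [[a e]|]; last by rewrite scaler0 addr0.
by rewrite -wactZ -wactD.
Qed.

Lemma tr_eW j f x : tr_W j x -> tr_W (j + 1) (tr_e j f x).
Proof.
move=> Wx p b; rewrite /tr_e; case: ifP => [/andP[tpb /eqP pf]|]; last first.
  by split=> //; [exact: (grading0 (op_gr M))|exact: linear0].
case E0: (lv j).2 => [|i]; last first.
  by have [xc xv _] := Wx (f :: p) b; rewrite lvS E0; split=> //; rewrite tpb.
have [a [c [[aB cC bB af [ac cb]] [-> jac]]]] := tail_split E0 tpb pf.
have [xc xv _] := Wx [::] a.
have [sz sp se _] := fc_joinP (ld_sig d (lv j).1) cC bB cb.
split; last by rewrite tpb.
  by rewrite lvS E0 /= ld_nS; have := wact_comp (fc_join (ld_sig d (lv j).1) c b) xc; rewrite sz.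
by rewrite -xv ac -se; apply: wact_end.
Qed.

Definition tr_fam : fam K F.
Proof.
apply: (@Fam K F tr_sp tr_W tr_v tr_e) => //.
- by move=> n p b; split=> //; [exact: (grading0 (op_gr M))|exact: linear0].
- move=> n c x y Wx Wy p b; have [x1 x2 x3] := Wx p b; have [y1 y2 y3] := Wy p b.
  rewrite -[(_ + _) p b]/(c *: x p b + y p b); split.
  + exact: (gradingD (op_gr M) (op_compZ c x1) y1).
  + by rewrite op_vlin x2 y2.
  + by move=> h; rewrite x3 // y3 // scaler0 addr0.
- exact: tr_vlin.
- exact: tr_elin.
- move=> n v x Wx p b; have [x1 x2 x3] := Wx p b; rewrite /tr_v; case: ifP => // _.
  by split=> //; [exact: (grading0 (op_gr M))|exact: linear0].
- exact: tr_eW.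
- move=> n v w x _; apply: tr_sp_eq => p b; rewrite /tr_v.
  have [->|vw] := eqVneq v w; first by case: eqP.
  by have [sw|//] := eqVneq (start b.1.1 p) w; rewrite sw eq_sym (negPf vw).
- move=> n x _; apply: tr_sp_eq => p b.
  have -> : (\sum_v tr_v v x) p b = \sum_v tr_v v x p b.
    by elim/big_rec2: _ => // v y z _ <-.
  rewrite (bigD1 (start b.1.1 p)) //= /tr_v eqxx big1 ?addr0 // => v.
  by rewrite eq_sym => /negPf ->.
- move=> j f x _; apply: tr_sp_eq => p b; rewrite /tr_e.
  case: ifP => // /andP[tpb /eqP pf]; case E0: (lv j).2 => [|i]; last by rewrite /tr_v /= eqxx.
  have [a [c [[_ _ _ af _] [-> _]]]] := tail_split E0 tpb pf.
  by rewrite /tr_v /= af eqxx.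
- move=> j f x _; apply: tr_sp_eq => p b; rewrite /tr_v /tr_e.
  by case: eqP; rewrite ?andbF.
Defined.

Definition transfer : opmod K F := fam_op tr_fam.

Hypothesis Mc : closed M.

Lemma tail_join k a c b : bvalid (ld_B d k) a -> bvalid (ld_C d k) c ->
  bvalid (ld_B d k.+1) b -> a.1.2 = c.1.1 -> c.1.2 = b.1.1 ->
  exists f p, [/\ fc_join (ld_rho d k) a c = f :: p,
    tail (ld_m d k + 1) p b, start b.1.1 p = rng f &
    fc_split (ld_rho d k) (src f) (f :: p) = Some (a, c)].
Proof.
move=> aB cC bB ac cb; have [sz sp se ss] := fc_joinP (ld_rho d k) aB cC ac.
move: sz sp se ss; case: fc_join => [|f p] //= [sz] /andP[/eqP <- fp] se ss.
have pf : start b.1.1 p = rng f.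
  move: fp se; rewrite /start; case: p {sz ss} => [|e p] /=; last by case/andP=> /eqP.
  by rewrite -cb => _ <-.
exists f, p; split=> //; rewrite /tail lvS lv_level /= sz eqxx bB pf fp /=.
by rewrite -cb -se /path_end /= eqxx.
Qed.

(** Between levels the solution is read off from [y]. At a level, the entry at [a] must have
    prescribed products with all paths of E to the next n-level, and closedness of [M] provides
    it. *)
Lemma transfer_closed : closed transfer.
Proof.
apply: fam_op_closed => j y Wy yr.
have y0 f p b : start b.1.1 p != rng f -> y f p b = 0.
  move=> /negPf h; have : tr_v (rng f) (y f) p b = y f p b.
    exact (f_equal (fun z : fam_sp tr_fam => (z : tr_sp) p b) (yr f)).
  by rewrite /tr_v h => <-.
have gate f p b : ~~ (tail (j + 1) p b && (start b.1.1 p == rng f)) -> y f p b = 0.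
  by rewrite negb_and => /orP[h|/y0 //]; have [_ _ ->] := Wy f p b.
case E0: (lv j).2 => [|i]; last first.
  exists (fun p b => if p is f :: p' then y f p' b else 0); split.
  - move=> [|f p] b; first by split=> //; [exact: (grading0 (op_gr M))|exact: linear0].
    have [y1 y2 _] := Wy f p b; rewrite lvS E0 in y1; split=> //.
    by rewrite (tail_cons _ _ _ E0); apply: gate.
  - move=> f; apply: tr_sp_eq => p b; rewrite -[LHS]/(tr_e j f _ p b) /tr_e E0.
    by case: ifP => // /negbT /gate ->.
  - move=> x' Wx' x'P; apply: tr_sp_eq => -[|f p] b.
      by have [_ _ -> //] := Wx' [::] b; rewrite /tail E0.
    have [t|t] := boolP (tail j (f :: p) b); last first.
      by have [_ _ -> //] := Wx' (f :: p) b; rewrite gate // -(tail_cons _ _ _ E0).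
    rewrite (tail_cons _ _ _ E0) in t.
    by rewrite -x'P -[RHS]/(tr_e j f _ p b) /tr_e t E0.
set k := (lv j).1; have jm : j = ld_m d k by rewrite /k lv_m E0 addr0.
(* The path [q] of E factors as [c], [b]; joining [a] and [c] gives a path [f :: p] of F, and the
   entry of [y f] at [p], [b] is what [q] must produce. *)
pose Y (a : bE) q := if fc_split (ld_sig d k) a.1.2 q is Some (c, b) then
  if fc_join (ld_rho d k) a c is f :: p then y f p b else 0 else 0.
have /choice [z zP] (a : bE) : exists z : M, if bvalid (ld_B d k) a then
    [/\ op_comp (ld_n d k) z, op_v a.1.2 z = z
      & forall q, size q = (ld_h d k).+1 -> is_path a.1.2 q -> wact q z = Y a q] else z = 0.
  have [aB|_] := boolP (bvalid (ld_B d k) a); last by exists 0.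
  have YE q : size q = (ld_h d k).+1 -> is_path a.1.2 q ->
      exists f p b, Y a q = y f p b /\ path_end a.1.2 q = b.1.2.
    move=> qs qp; have [c [b [sq [cC bB ca cb jq]]]] := fc_splitP (ld_sig d k) qs qp.
    have [f [p [jac _ _ _]]] := tail_join aB cC bB (esym ca) cb.
    exists f, p, b; rewrite /Y sq jac; split=> //.
    by have [_ _ <- _] := fc_joinP (ld_sig d k) cC bB cb; rewrite jq ca.
  apply: (closed_paths Mc) => q qs qp; have [f [p [b [-> qb]]]] := YE q qs qp.
    by rewrite qb; have [_ ->] := Wy f p b.
  by have [h _ _] := Wy f p b; rewrite lvS E0 /= ld_nS in h.
exists (fun p b => if p is [::] then z b else 0); split.
- move=> [|f p] b; last by split=> //; [exact: (grading0 (op_gr M))|exact: linear0].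
  have := zP b; rewrite tail_nil //; case: ifP => [_ [? ? _]|_ ->]; first by split.
  by split=> //; [exact: (grading0 (op_gr M))|exact: linear0].
- move=> f; apply: tr_sp_eq => p b; rewrite -[LHS]/(tr_e j f _ p b) /tr_e E0.
  case: ifP => [/andP[t /eqP pf]|/negbT /gate -> //].
  have [a [c [[aB cC bB af [ac cb]] [-> jac]]]] := tail_split E0 t pf.
  have [qs qp _ qq] := fc_joinP (ld_sig d k) cC bB cb; rewrite -ac in qp qq.
  have := zP a; rewrite aB => -[_ _ /(_ _ qs qp) ->]; by rewrite /Y qq jac.
- move=> x' Wx' x'P; apply: tr_sp_eq => -[|f p] a; last first.
    by have [_ _ -> //] := Wx' (f :: p) a; rewrite /tail E0.
  have [_ xa xt] := Wx' [::] a; have := zP a.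
  case: ifP => [aB [_ za zq]|aB ->]; last by apply: xt; rewrite tail_nil // aB.
  apply: (closed_paths_inj Mc (l := (ld_h d k).+1) xa za) => q qs qp.
  have [c [b [sq [cC bB ca cb jq]]]] := fc_splitP (ld_sig d k) qs qp.
  have [f [p [jac t pf ss]]] := tail_join aB cC bB (esym ca) cb.
  rewrite zq // /Y sq jac -x'P -[RHS]/(tr_e j f x' p b) /tr_e E0.
  by rewrite [j in tail (j + 1)]jm t pf eqxx -/k ss jq.
Qed.

End OnModules.

Section OnMorphisms.
Variables (M N : opmod K E) (f : ophom M N).

Definition tr_map (x : tr_sp M) : tr_sp N := fun p b => f (x p b).

Lemma tr_map_linear : linear tr_map.
Proof. by move=> c x y; apply: tr_sp_eq => p b; apply: (oh_lin f). Qed.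

Lemma tr_mapW j x : tr_W j x -> tr_W j (tr_map x).
Proof.
move=> Wx p b; have [x1 x2 x3] := Wx p b; split; first exact: oh_comp.
  by rewrite -[LHS](oh_v f) x2.
by move=> h; rewrite /tr_map x3 // oh0.
Qed.

Lemma tr_map_v v x : tr_map (tr_v v x) = tr_v v (tr_map x).
Proof.
by apply: tr_sp_eq => p b; rewrite /tr_map /tr_v; case: ifP => // _; apply: oh0.
Qed.

Lemma tr_map_e j e x : tr_map (tr_e j e x) = tr_e j e (tr_map x).
Proof.
apply: tr_sp_eq => p b; rewrite /tr_map /tr_e; case: ifP => _; last exact: oh0.
case: (lv j).2 => //; case: fc_split => [[a c]|]; last exact: oh0.
exact: oh_wact.
Qed.

Definition transfer_map : ophom (transfer M) (transfer N) :=
  @fam_map K F (tr_fam M) (tr_fam N) tr_map tr_map_linear tr_mapW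
    (fun n v x _ => tr_map_v v x) (fun n e x _ => tr_map_e n e x).

End OnMorphisms.

Definition transfer_functor : functor (Cl K E) (Cl K F).
Proof.
refine (@Functor (Cl K E) (Cl K F)
  (fun M => exist _ (transfer (projT1 M)) (transfer_closed (projT2 M)))
  (fun M N f => transfer_map f) _ _).
- by move=> M; apply: ophom_eq => x; apply: fproj_inj.
- by move=> M N P g f; apply: ophom_eq => x; apply: fproj_inj.
Defined.

End Transfer.

Section Components.
Variables (K : fieldType) (E : finite_graph) (M N : opmod K E).

Definition ocomp (M : opmod K E) n (x : M) : M := hcomp (op_gr M) n x.

Lemma ocompC n (x : M) : op_comp n (ocomp n x).
Proof. exact: hcompC. Qed.

Lemma ocomp_id n (x : M) : op_comp n x -> ocomp n x = x.
Proof. exact: hcomp_id. Qed.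

Lemma ocomp_morph (g : M -> N) : {morph g : x y / x + y} ->
  (forall n x, op_comp n x -> op_comp n (g x)) -> forall n x, ocomp n (g x) = g (ocomp n x).
Proof.
move=> gD gC n x; have := @hcomp_morph _ _ _ _ (op_gr M) (op_gr N) g 0 gD _ n x.
by rewrite addr0; apply=> k y; rewrite addr0; apply: gC.
Qed.

Lemma ocomp_e n e (x : M) : ocomp (n + 1) (op_e e x) = op_e e (ocomp n x).
Proof.
exact: (hcomp_morph (op_gr M) (op_gr M) (linearD (op_e e)) (fun n => @op_ecomp _ _ M n e)).
Qed.

End Components.

Section ComponentOperations.
Variables (K : fieldType) (E : finite_graph) (M N : opmod K E).

Lemma ocompD n (x y : M) : ocomp n (x + y) = ocomp n x + ocomp n y.
Proof. exact: hcompD. Qed.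

Lemma ocompZ n c (x : M) : ocomp n (c *: x) = c *: ocomp n x.
Proof.
by apply: (ocomp_morph (g := *:%R c)) => [y z|k y]; [apply: scalerDr|apply: op_compZ].
Qed.

Lemma ocomp_v n v (x : M) : ocomp n (op_v v x) = op_v v (ocomp n x).
Proof.
by apply: (ocomp_morph (g := op_v v)) => [y z|k y]; [apply: linearD|apply: op_vcomp].
Qed.

Lemma oh_ocomp (f : ophom M N) n x : ocomp n (f x) = f (ocomp n x).
Proof. by apply: (ocomp_morph (g := f)) => [y z|k y]; [apply: ohD|apply: oh_comp]. Qed.

Lemma wact_path v u s (x : M) : is_path u s -> (0 < size s)%N ->
  wact s (op_v v x) = if u == v then wact s x else 0.
Proof. by case: s => //= e s /andP[/eqP <- _] _; rewrite wact_v eq_sym. Qed.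

Lemma wact_src u s (x : M) : is_path u s -> (0 < size s)%N -> wact s (op_v u x) = wact s x.
Proof. by move=> h1 h2; rewrite (wact_path _ _ h1 h2) eqxx. Qed.

End ComponentOperations.

Section TransferWords.
Variables (K : fieldType) (E F : finite_graph) (d : ladder E F).
Variable M : opmod K E.
Local Notation T := (transfer d M).
Local Notation bE := (bedge (vert F) (vert E)).
Local Notation pr x j p b := (fproj (x : fam_car (tr_fam d M)) j p b).

Lemma transfer_e (x : T) j f p b :
  pr (op_e f x) (j + 1) p b = tr_e d j f (fproj (x : fam_car (tr_fam d M)) j) p b.
Proof. by rewrite fproj_e. Qed.

Lemma transfer_W (x : T) j : tr_W d j (fproj (x : fam_car (tr_fam d M)) j).
Proof. by have [_ h] := fprojP (x : fam_car (tr_fam d M)); exact: (h j). Qed.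

Lemma transfer_tail (x : T) j p b : tail d j p b ->
  pr (wact p x) (ld_m d (lv d j).1) [::] b = pr x j p b.
Proof.
elim: p j x => [|f p IH] j x; rewrite lv_m.
  by rewrite /tail => /and4P[/eqP /= <- _ _ _]; rewrite addr0.
case E0: (lv d j).2 => [|i]; first by rewrite /tail E0.
rewrite (tail_cons _ _ _ E0) => /andP[t pf]; rewrite wact_cons.
have -> : j + i.+1%:Z = ld_m d (lv d (j + 1)).1 by rewrite lv_m lvS E0 /= -addrA.
by rewrite IH // transfer_e /tr_e t pf E0.
Qed.

(** This ties the two kinds of factorisation together: the path of F made of [a] and [c] acts
    through the path of E made of [c] and [b]. *)
Lemma transfer_wact (x : T) k a c b :
  bvalid (ld_B d k) a -> bvalid (ld_C d k) c -> bvalid (ld_B d k.+1) b ->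
  a.1.2 = c.1.1 -> c.1.2 = b.1.1 ->
  pr (wact (fc_join (ld_rho d k) a c) x) (ld_m d k.+1) [::] b
  = wact (fc_join (ld_sig d k) c b) (pr x (ld_m d k) [::] a).
Proof.
move=> aB cC bB ac cb; have [f [p [-> t pf ss]]] := tail_join aB cC bB ac cb.
have l1 : (lv d (ld_m d k + 1)).1 = k.+1 by rewrite lvS lv_level.
rewrite wact_cons -[in LHS]l1 transfer_tail // transfer_e /tr_e t pf eqxx.
by rewrite lv_level /= ss.
Qed.

Lemma transfer_eq k (x y : T) : op_comp (ld_m d k) x -> op_comp (ld_m d k) y ->
  (forall b, bvalid (ld_B d k) b -> pr x (ld_m d k) [::] b = pr y (ld_m d k) [::] b) ->
  x = y.
Proof.
move=> xk yk h; apply: (@fproj_inj _ _ (tr_fam d M)) => j.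
have [->|jk] := eqVneq j (ld_m d k); last by rewrite (xk _ jk) (yk _ jk).
apply: tr_sp_eq => p b; have [t|t] := boolP (tail d (ld_m d k) p b); last first.
  by have [_ _ -> //] := transfer_W x (ld_m d k) p b;
    have [_ _ -> //] := transfer_W y (ld_m d k) p b.
case: p t => [|f p]; last by rewrite /tail lv_level.
by rewrite tail_nil lv_level //; apply: h.
Qed.

(** Arbitrary values are projected to the required degree and vertex, so that [tr_in] carries no
    side conditions. *)
Definition tr_at k (u : bE -> M) : tr_sp F M := fun p b =>
  if nilp p && bvalid (ld_B d k) b then op_v b.1.2 (ocomp (ld_n d k) (u b)) else 0.

Lemma tr_atW k u : fam_W (f := tr_fam d M) (ld_m d k) (tr_at k u).
Proof.
move=> p b; rewrite lv_level /= /tr_at; case: ifP => [/andP[/nilP -> bB]|_]; last first.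
  by split=> //; [exact: (grading0 (op_gr M))|exact: linear0].
split; first by apply/op_vcomp/ocompC.
  by rewrite op_vv eqxx.
by rewrite tail_nil lv_level // bB.
Qed.

Definition tr_in k u : T := fin1 (tr_atW k u).

Lemma tr_inE k u b : bvalid (ld_B d k) b ->
  pr (tr_in k u) (ld_m d k) [::] b = op_v b.1.2 (ocomp (ld_n d k) (u b)).
Proof. by move=> bB; rewrite fmkK eqxx /tr_at bB. Qed.

Lemma tr_in_comp k u : op_comp (ld_m d k) (tr_in k u).
Proof. by move=> j jk; rewrite fmkK (negPf jk). Qed.

Lemma tr_in_eq k u w : (forall b, bvalid (ld_B d k) b -> u b = w b) -> tr_in k u = tr_in k w.
Proof.
move=> uw; apply: transfer_eq; try exact: tr_in_comp.
by move=> b bB; rewrite !tr_inE // uw.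
Qed.

Lemma tr_in0 k : tr_in k (fun=> 0) = 0.
Proof.
apply: transfer_eq; [exact: tr_in_comp|exact: (grading0 (op_gr T))|] => b bB.
rewrite tr_inE // /ocomp hcomp0; exact: linear0.
Qed.

Lemma tr_in_linear k c u w : tr_in k (fun b => c *: u b + w b) = c *: tr_in k u + tr_in k w.
Proof.
apply: transfer_eq; first exact: tr_in_comp.
  apply: (gradingD (op_gr T)); [apply: op_compZ|]; exact: tr_in_comp.
move=> b bB; rewrite fprojD fprojZ.
rewrite -[RHS]/(c *: pr (tr_in k u) (ld_m d k) [::] b + pr (tr_in k w) (ld_m d k) [::] b).
by rewrite !tr_inE // ocompD ocompZ op_vlin.
Qed.

Lemma tr_in_v k v u : op_v v (tr_in k u) = tr_in k (fun b => if b.1.1 == v then u b else 0).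
Proof.
apply: transfer_eq; [apply: op_vcomp| |]; try exact: tr_in_comp.
move=> b bB; rewrite fproj_v -[LHS]/(if b.1.1 == v then pr (tr_in k u) (ld_m d k) [::] b else 0).
rewrite !tr_inE //; case: ifP => // _; rewrite /ocomp hcomp0; exact/esym/linear0.
Qed.

End TransferWords.

Lemma transfer_map_in (K : fieldType) (E F : finite_graph) (d : ladder E F)
    (M N : opmod K E) (f : ophom M N) k u :
  transfer_map d f (tr_in d k u) = tr_in d k (fun b => f (u b)).
Proof.
apply: transfer_eq; [apply: oh_comp| |]; try exact: tr_in_comp.
move=> b bB; rewrite fproj_map /tr_map !tr_inE //.
by rewrite oh_v oh_ocomp.
Qed.

(** * Transfer there and back is naturally the identity *)

Section Unit.
Variables (K : fieldType) (E F : finite_graph) (d : ladder E F).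
Local Notation d' := (ladder_swap d).
Local Notation bE := (bedge (vert F) (vert E)).
Local Notation bF := (bedge (vert E) (vert F)).

Section OneModule.
Variable N : opmod K F.
Local Notation T := (transfer d' N).
Local Notation TT := (transfer d T).

(** An entry of the double transfer is indexed by a tail [p], [b] and an edge [c]; together they
    form a path of F reaching [ld_m d k.+1], and the entry is the product of [x] with that path. *)
Definition unit_at k (p : seq (edge F)) (b : bE) (x : N) (c : bF) : N :=
  if c.1.1 == b.1.2 then wact (p ++ fc_join (ld_rho d k) b c) x else 0.

Definition unit_fam j (x : N) : tr_sp F T := fun p b =>
  if tail d j p b then tr_in d' (lv d j).1 (unit_at (lv d j).1 p b x) else 0.

Lemma unit_famW j x : tr_W d j (unit_fam j x).
Proof.
move=> p b; rewrite /unit_fam; case: ifP => t; last first.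
  by split=> //; exact: linear0.
split=> //; first exact: tr_in_comp.
rewrite tr_in_v; apply: tr_in_eq => c _; rewrite /unit_at.
by case: eqP.
Qed.

Lemma unit_fam_linear j : linear (unit_fam j).
Proof.
move=> a x y; apply: tr_sp_eq => p b.
rewrite -[RHS]/(a *: unit_fam j x p b + unit_fam j y p b) /unit_fam.
case: ifP => _; last by rewrite scaler0 addr0.
rewrite -tr_in_linear; congr tr_in; apply/funext => c; rewrite /unit_at.
by case: ifP => _; [rewrite wactD wactZ|rewrite scaler0 addr0].
Qed.

Lemma unit_fam0 j : unit_fam j 0 = 0.
Proof. by have := unit_fam_linear j (-1) 0 0; rewrite !scaleN1r !addNr. Qed.

Lemma unit_fam_fin x : fin_fam (F := tr_fam d T) (fun j => unit_fam j (ocomp j x)).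
Proof.
split=> [|j]; last exact: unit_famW.
exists (hsupp (op_gr N) x) => j jx; rewrite /ocomp hcomp_out //; exact: unit_fam0.
Qed.

Lemma tail_joinP j p b c : tail d j p b -> bvalid (ld_C d (lv d j).1) c -> c.1.1 = b.1.2 ->
  [/\ is_path (start b.1.1 p) (p ++ fc_join (ld_rho d (lv d j).1) b c),
    (0 < size (p ++ fc_join (ld_rho d (lv d j).1) b c))%N &
    path_end b.1.1 (fc_join (ld_rho d (lv d j).1) b c) = c.1.2].
Proof.
move=> /and4P[_ bB pp /eqP pe] cC cb.
have [sz sp se _] := fc_joinP (ld_rho d (lv d j).1) bB cC (esym cb).
by rewrite is_path_cat pp -[last _ _]/(path_end _ p) pe sp size_cat sz addnS.
Qed.

Lemma unit_fam_v j v x : unit_fam j (op_v v x) = tr_v v (unit_fam j x).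
Proof.
apply: tr_sp_eq => p b; rewrite /tr_v /unit_fam; case: ifP => t; last by case: ifP.
rewrite -[RHS](fun_if (fun u => u)) (_ : (if _ then _ else _) = tr_in d' (lv d j).1
  (fun c => if start b.1.1 p == v then unit_at (lv d j).1 p b x c else 0)); last first.
  by case: ifP => // _; rewrite tr_in0.
apply: tr_in_eq => c cC; rewrite /unit_at; case: eqP => [cb|_]; last by case: ifP.
by have [h1 h2 _] := tail_joinP t cC cb; apply: wact_path.
Qed.

(** At a level both sides have the entry x a c b c'. On the left it arises from [f :: p], joined
    from [a] and [c]; on the right [c] and [b] act inside the inner transfer, where [transfer_wact]
    converts this into [b] and [c'] acting on x a c. *)
Lemma unit_fam_e j f x : op_comp j x ->
  unit_fam (j + 1) (op_e f x) = tr_e d j f (unit_fam j x).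
Proof.
move=> xj; apply: tr_sp_eq => p b; rewrite {1}/unit_fam /tr_e.
case: ifP => t //=; have [pf|pf] := eqVneq (start b.1.1 p) (rng f); last first.
  rewrite -(@tr_in0 _ _ _ d' N (lv d (j + 1)).1); apply: tr_in_eq => c cC.
  rewrite /unit_at; case: eqP => // cb; have [h1 h2 _] := tail_joinP t cC cb.
  by rewrite -op_re (wact_path _ _ h1 h2) (negPf pf).
case E0: (lv d j).2 => [|i]; last first.
  have l1 : (lv d (j + 1)).1 = (lv d j).1 by rewrite lvS E0.
  by rewrite /unit_fam (tail_cons _ _ _ E0) t pf eqxx l1.
have [a [c [[aB cC bB af [ac cb]] [-> jac]]]] := tail_split E0 t pf.
have l1 : (lv d (j + 1)).1 = (lv d j).1.+1 by rewrite lvS E0.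
rewrite l1 /unit_fam (tail_nil _ E0) aB; set k := (lv d j).1.
have mk : ld_m d k = j by rewrite /k lv_m E0 addr0.
apply: (transfer_eq (k := k.+1)); first exact: tr_in_comp.
  have [sz _ _ _] := fc_joinP (ld_sig d k) cC bB cb.
  have := wact_comp (fc_join (ld_sig d k) c b)
    (@tr_in_comp _ _ _ d' N k (unit_at k [::] a x)).
  by rewrite sz -[ld_m d' k]/(ld_n d k) -ld_nS.
have [qz qp qe _] := fc_joinP (ld_sig d k) cC bB cb.
have [rz rp re _] := fc_joinP (ld_rho d k) aB cC ac.
set z := wact (f :: p) x.
have zc : op_comp (ld_m d k.+1) z.
  have e : j + (ld_g d k).+1%:Z = ld_m d k.+1 by rewrite ld_mS mk.
  by rewrite /z -jac; have := wact_comp (fc_join (ld_rho d k) a c) xj; rewrite rz e.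
have zv : op_v b.1.1 z = z.
  rewrite /z -jac -cb -re -(wact_src x rp) ?rz //; exact: wact_end.
move=> c' c'C; rewrite tr_inE //.
have [bc|bc] := eqVneq b.1.2 c'.1.1; last first.
  (* When [c'] does not start at the end of [b], the left entry is 0 by default, and the right one
     because the path of [c] and [b] ends at [b.1.2]. *)
  rewrite /unit_at eq_sym (negPf bc) /ocomp hcomp0.
  rewrite (_ : wact (fc_join (ld_sig d k) c b) _ = op_v b.1.2 (wact (fc_join (ld_sig d k) c b)
    (tr_in d' k (unit_at k [::] a x)))); last first.
    rewrite -(wact_src _ qp) ?qz // -qe; exact/esym/wact_end.
  rewrite fproj_v -[RHS]/(if c'.1.1 == b.1.2 then _ else _) eq_sym (negPf bc).
  exact: linear0.
have [uz up ue _] := fc_joinP (ld_rho d k.+1) bB c'C bc.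
apply: etrans (esym (@transfer_wact _ _ _ d' N _ k c b c' cC bB c'C cb bc)).
rewrite (@tr_inE _ _ _ d' N k _ c cC) -[ld_n d' k]/(ld_m d k.+1) -[ld_n d' k.+1]/(ld_m d k.+2).
rewrite /unit_at bc ac !eqxx /= jac -/z cb (ocomp_id zc) zv.
rewrite wact_cat -[wact p _]/z ocomp_id.
  by rewrite -(wact_src z up) ?uz // -ue; apply: wact_end.
by have := wact_comp (fc_join (ld_rho d k.+1) b c') zc; rewrite uz -ld_mS.
Qed.

Definition unit_map : ophom N TT.
Proof.
apply: (@OpHom _ _ N TT (fun x => fmk (unit_fam_fin x))).
- move=> a x y; apply: (@fproj_inj _ _ (tr_fam d T)) => j; rewrite fprojD fprojZ !fmkK.
  by rewrite ocompD ocompZ unit_fam_linear.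
- move=> n x xn j jn; rewrite fmkK /ocomp (hcomp_neq (op_gr N) xn) ?unit_fam0 //.
  by rewrite eq_sym.
- move=> v x; apply: (@fproj_inj _ _ (tr_fam d T)) => j.
  by rewrite fproj_v !fmkK ocomp_v unit_fam_v.
- move=> e x; apply: (@fproj_inj _ _ (tr_fam d T)) => j.
  rewrite -(subrK 1 j) fproj_e !fmkK ocomp_e; apply: unit_fam_e; exact: ocompC.
Defined.

Lemma unit_mapE x j : fproj (unit_map x : fam_car (tr_fam d T)) j = unit_fam j (ocomp j x).
Proof. by []. Qed.

Hypothesis Nc : closed N.

(** The entries are the products with all paths from degree [j] to [ld_m d k.+1], and these paths,
    being of one length, detect elements of the closed module. *)
Lemma unit_map_inj0 x : unit_map x = 0 -> x = 0.
Proof.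
move=> x0; apply: (hcomp_eq0P (op_gr N)) => j; rewrite -[hcomp _ _ _]/(ocomp j x).
suff z0 u : op_v u (ocomp j x) = 0 by rewrite -[ocomp j x]op_v1 big1.
have u0 : unit_fam j (op_v u (ocomp j x)) = 0.
  by rewrite unit_fam_v -unit_mapE x0; apply: linear0 (@fam_v _ _ (tr_fam d T) u).
move: u0; set z := op_v u _ => u0; have zj : op_comp j z by apply/op_vcomp/ocompC.
set k := (lv d j).1.
apply: (closed_paths_inj Nc (l := (lv d j).2 + (ld_g d k).+1) (v := u)) => [||s ss sp].
- by rewrite /z op_vv eqxx.
- exact: linear0.
rewrite [RHS]linear0 -(cat_take_drop (lv d j).2 s); move: ss sp.
rewrite -{1 2}(cat_take_drop (lv d j).2 s).
have : size (take (lv d j).2 s) = (lv d j).2 \/ size s <> ((lv d j).2 + (ld_g d k).+1)%N.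
  case: (eqVneq (size s) ((lv d j).2 + (ld_g d k).+1)%N) => [ss|/eqP]; last by right.
  by left; rewrite size_takel // ss leq_addr.
case=> [pj|]; last by rewrite cat_take_drop.
move: (take _ s) (drop _ s) pj => p r pj.
rewrite size_cat pj => /addnI rg; rewrite is_path_cat => /andP[pp rp].
(* [p] leads up to the level, and [r] is a full path between two m-levels, hence a join. *)
have [b [c [_ [bB cC bv bc jr]]]] := fc_splitP (ld_rho d k) rg rp.
have st : start b.1.1 p = u.
  by rewrite bv; case: p pp {rp bv pj} => //= e p /andP[/eqP].
have t : tail d j p b by rewrite /tail pj eqxx bB st pp bv /path_end eqxx.
have [h1 h2 h3] := tail_joinP t cC (esym bc).
have : fproj (unit_fam j z p b : fam_car (tr_fam d' N)) (ld_n d k) [::] c = 0.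
  by rewrite u0.
rewrite /unit_fam t (@tr_inE _ _ _ d' N k _ c cC) /unit_at bc eqxx jr => zc.
apply: etrans zc; rewrite -[ld_n d' k]/(ld_m d k.+1) ocomp_id; last first.
  by have := wact_comp (p ++ r) zj; rewrite size_cat pj rg PoszD addrA -lv_m -ld_mS.
rewrite wact_cat -h3 jr bv -(wact_src _ rp) ?rg //; exact/esym/wact_end.
Qed.

Lemma unit_map_inj : injective unit_map.
Proof.
move=> x y xy; apply/eqP; rewrite -subr_eq0; apply/eqP/unit_map_inj0.
by rewrite ohB xy subrr.
Qed.

(** The entries of [y] at [b], [c] prescribe products with all full paths from each vertex [v];
    closedness of [N] gives an element for each [v], and these are added up. *)
Lemma unit_map_level k (y : TT) : op_comp (ld_m d k) y -> exists x, unit_map x = y.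
Proof.
move=> yk; pose yb b : T := fproj (y : fam_car (tr_fam d T)) (ld_m d k) [::] b.
pose Y v s : N := if fc_split (ld_rho d k) v s is Some (b, c) then
  fproj (yb b : fam_car (tr_fam d' N)) (ld_n d k) [::] c else 0.
have ybP b : op_comp (ld_n d k) (yb b) /\ op_v b.1.2 (yb b) = yb b.
  by have [h1 h2 _] := transfer_W y (ld_m d k) [::] b; rewrite lv_level in h1.
have ycP b c : op_comp (ld_m d k.+1) (fproj (yb b : fam_car (tr_fam d' N)) (ld_n d k) [::] c)
    /\ op_v c.1.2 (fproj (yb b : fam_car (tr_fam d' N)) (ld_n d k) [::] c)
      = fproj (yb b : fam_car (tr_fam d' N)) (ld_n d k) [::] c.
  have [h1 h2 _] := transfer_W (yb b) (ld_n d k) [::] c.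
  by rewrite (lv_level d') in h1.
have /choice [x xP] v : exists x : N, [/\ op_comp (ld_m d k) x, op_v v x = x &
    forall s, size s = (ld_g d k).+1 -> is_path v s -> wact s x = Y v s].
  apply: (closed_paths Nc) => s sg sp;
    have [b [c [ss [bB cC bv bc js]]]] := fc_splitP (ld_rho d k) sg sp;
    have [h1 h2] := ycP b c; rewrite /Y ss //.
    by have [_ _ h3 _] := fc_joinP (ld_rho d k) bB cC bc; rewrite js bv in h3; rewrite h3.
  by rewrite -ld_mS.
exists (\sum_v x v); have xk : op_comp (ld_m d k) (\sum_v x v).
  by apply: (grading_bigsum (op_gr N)) => v _; have [h _ _] := xP v; exact: h.
apply: (transfer_eq (k := k)) => [||b bB]; [exact: (oh_comp unit_map xk)|exact: yk|].
rewrite unit_mapE (ocomp_id xk) /unit_fam tail_nil lv_level //= bB.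
apply: (transfer_eq (k := k)); first exact: tr_in_comp.
  exact: (ybP b).1.
move=> c cC; rewrite tr_inE // /unit_at; have [cb|cb] := eqVneq c.1.1 b.1.2; last first.
  rewrite -[fproj y _ _ _]/(yb b) -(ybP b).2 fproj_v.
  rewrite -[RHS]/(if c.1.1 == b.1.2 then _ else _) (negPf cb) /ocomp hcomp0; exact: linear0.
have [jz jp je js] := fc_joinP (ld_rho d k) bB cC (esym cb).
have jx : wact (fc_join (ld_rho d k) b c) (\sum_v x v)
  = fproj (yb b : fam_car (tr_fam d' N)) (ld_n d k) [::] c.
  rewrite [LHS]linear_sum (bigD1 b.1.1) //= big1 ?addr0 => [|v vb].
    by have [_ _ ->] := xP b.1.1; rewrite ?jz // /Y js.
  have [_ <- _] := xP v; rewrite (wact_path _ _ jp) ?jz // eq_sym (negPf vb) //.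
rewrite /= jx; have [h1 h2] := ycP b c.
by rewrite ocomp_id.
Qed.

End OneModule.

(** Products of [y] with words of a fixed length reach a degree where preimages exist; injectivity
    of [f] makes these preimages a consistent family, which closedness of [M] glues. *)
Lemma closed_surjective (M N : opmod K F) (f : ophom M N) : closed M -> closed N ->
  injective f ->
  (forall j, exists i : nat, forall y, op_comp (j + i%:Z) y -> exists x, f x = y) ->
  forall y, exists x, f x = y.
Proof.
move=> Mc Nc fi fs; elim/(@grading_ind _ _ (op_gr N)) => [|_ _ [x <-] [y <-]|j y yj].
- by exists 0; apply: oh0.
- by exists (x + y); apply: ohD.
have [i iP] := fs j; have f0 x : f x = 0 -> x = 0 by move=> h; apply: fi; rewrite h oh0.
have /choice [x xP] s : exists x, size s = i -> f x = wact s y.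
  have [si|si] := eqVneq (size s) i; last by exists 0 => h; rewrite h eqxx in si.
  by have := wact_comp s yj; rewrite si => /iP [x]; exists x.
have [s si sN|s e si|z zP] := @closed_words K F M Mc i x.
- apply: f0; rewrite xP // -[y]op_v1 [LHS]linear_sum big1 // => v _.
  apply: wact_not_path; apply: contra sN; case: s {si} => //= e s /andP[_ ->].
  by rewrite eqxx.
- by apply: fi; rewrite oh_v !xP ?size_rcons // wact_rcons op_re.
exists z; apply/eqP; rewrite -subr_eq0; apply/eqP/(closed_inj_words Nc (k := i)) => s si.
by rewrite wactB -oh_wact zP // xP // subrr.
Qed.

Lemma transfer_unit : naturally_isomorphic (functor_id (Cl K F))
  (functor_comp (transfer_functor K d) (transfer_functor K d')).
Proof.
exists (fun N : Cl K F => unit_map (projT1 N)); split=> [N N' f|[N Nc]].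
  apply: ophom_eq => x; apply: (@fproj_inj _ _ (tr_fam d (transfer d' (projT1 N')))) => j.
  apply: tr_sp_eq => p b.
  rewrite -[LHS]/(unit_fam j (ocomp j (oh_fun f x)) p b).
  rewrite -[RHS]/(transfer_map d' f (unit_fam j (ocomp j x) p b)) oh_ocomp /unit_fam.
  case: ifP => _; last exact/esym/oh0.
  rewrite transfer_map_in; apply: tr_in_eq => c _; rewrite /unit_at.
  by case: ifP => _; [rewrite oh_wact|rewrite oh0].
apply: (@ophom_iso K F); first exact: unit_map_inj.
apply: (closed_surjective Nc) (@unit_map_inj N Nc) _.
  by do 2 apply: transfer_closed.
move=> j; exists (lv d j).2 => y; rewrite -lv_m; exact: unit_map_level.
Qed.

End Unit.

(** [transfer_unit] for the ladder and for its swap gives the middle functor an inverse on either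
    side; the two inverses come from different ladders, whence [equiv_of_left_right_inverse]. *)
Lemma ladder_equiv (K : fieldType) (E F : finite_graph) (d : ladder E F) :
  equivalent_categories (Cl K E) (Cl K F).
Proof.
apply: (@equiv_of_left_right_inverse _ _ (transfer_functor K d)
  (transfer_functor K (ladder_swap (ladder_swap d))) (transfer_functor K (ladder_swap d)));
  exact/natiso_sym/transfer_unit.
Qed.

Lemma ordered_isomorphic_Cl (K : fieldType) (E F : finite_graph) :
  no_sinks E -> no_sinks F ->
  ordered_isomorphic (K0gr (leavitt_gralgebra K E)) (K0gr (leavitt_gralgebra K F)) ->
  equivalent_categories (Cl K E) (Cl K F).
Proof.
move=> Ens Fns EF.
have [B [C [g [h [BC CB]]]]] :=
  interlacing (leavitt_dimension_group K Ens) (leavitt_dimension_group K Fns) EF.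
(* Only the step lengths are dictated by the matrices; both sequences of levels may start at 0. *)
pose m (g : nat -> nat) k : int := \sum_(i < k) (g i).+1%:Z.
have mS g' k : m g' k.+1 = m g' k + (g' k).+1%:Z by rewrite /m big_ord_recr.
apply/equiv_sym/ladder_equiv.
exact: (@Ladder F E (m h) (m g) h g (mS h) (mS g) B C
  (fun k => projT1 (cid (factorisation_exists (BC k))))
  (fun k => projT1 (cid (factorisation_exists (CB k))))).
Qed.

Theorem theorem20 (K : fieldType) (E F : finite_graph)
    (noSinksE : no_sinks E) (noSinksF : no_sinks F) :
  ordered_isomorphic (K0gr (leavitt_gralgebra K E))
                     (K0gr (leavitt_gralgebra K F))
  <-> equivalent_categories (QGr K E) (QGr K F).
Proof.
have QE := QGr_equiv_Cl K E; have QF := QGr_equiv_Cl K F; split=> [EF|EF].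
  have ClEF := ordered_isomorphic_Cl noSinksE noSinksF EF.
  exact: equiv_trans QE (equiv_trans ClEF (equiv_sym QF)).
apply: gr_equiv_K0gr; have GE := Gr_equiv_Cl K noSinksE; have GF := Gr_equiv_Cl K noSinksF.
apply: equiv_trans GE (equiv_trans _ (equiv_sym GF)).
exact: equiv_trans (equiv_sym QE) (equiv_trans EF QF).
Qed.
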